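(* Let $\Omega\subset\mathbb{R}^d$ be an open set of finite measure, let $\lambda_1(\Omega)<\lambda_2(\Omega)\le\dots$ be the eigenvalues (counted with multiplicity) of the operator $\mathcal H=\frac12\log(-\Delta)$ in $\Omega$ with Dirichlet condition $\varphi=0$ on $\mathbb{R}^d\setminus\Omega$, and let $N(\lambda)=\#\{k:\lambda_k(\Omega)<\lambda\}$. Then for every $\lambda\in\mathbb{R}$, $$N(\lambda)\le e^{\lambda d+1}\,\frac{1}{(2\pi)^d}\,|\Omega|\,|B_d|.$$
   Context: Here $d\ge1$ is an integer, $\Omega$ is nonempty, $|\cdot|$ of a set is Lebesgue measure, and $B_d$ is the unit ball in $\mathbb{R}^d$. The Fourier transform is $\widehat\varphi(\xi)=\int_{\mathbb{R}^d}e^{-ix\cdot\xi}\varphi(x)\,dx$, and $L^2(\Omega)$ is identified with the functions in $L^2(\mathbb{R}^d)$ vanishing on $\mathbb{R}^d\setminus\Omega$. Let $\mathbb{H}(\Omega)\subset L^2(\Omega)$ be the closure (completion) of $C_c^\infty(\Omega)$ with respect to the norm $\|\varphi\|_*$ given by $\|\varphi\|_*^2=\int_{\mathbb{R}^d}\log(e+|\xi|)\,|\widehat\varphi(\xi)|^2\,d\xi$. The quadratic form $$(\varphi,\varphi)_{\log}=\frac{1}{(2\pi)^d}\int_{\mathbb{R}^d}\log(|\xi|)\,|\widehat\varphi(\xi)|^2\,d\xi$$ (with associated sesquilinear form $(\varphi,\psi)_{\log}=\frac{1}{(2\pi)^d}\int_{\mathbb{R}^d}\log(|\xi|)\,\widehat\varphi(\xi)\overline{\widehat\psi(\xi)}\,d\xi$)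 with domain $\mathbb{H}(\Omega)$ is closed, symmetric and semibounded in $L^2(\Omega)$; $\mathcal H$ is the associated self-adjoint operator in $L^2(\Omega)$. Eigenvalues are understood weakly: $\varphi\in\mathbb{H}(\Omega)\setminus\{0\}$ is an eigenfunction with eigenvalue $\lambda$ if $(\varphi,\psi)_{\log}=\lambda\int_\Omega\varphi\overline{\psi}\,dx$ for all $\psi\in\mathbb{H}(\Omega)$. The spectrum is discrete: there is a sequence of eigenvalues $\lambda_1(\Omega)<\lambda_2(\Omega)\le\dots$, $\lambda_k(\Omega)\to\infty$, with a corresponding complete orthonormal system of eigenfunctions in $L^2(\Omega)$. *)

(* Defs.v *)
From HB Require Import structures.
From mathcomp Require Import all_boot all_order all_algebra.
From mathcomp Require Import all_classical all_reals all_analysis.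
From mathcomp Require Import complex.

Set Implicit Arguments.
Unset Strict Implicit.
Unset Printing Implicit Defensive.

Import Order.TTheory GRing.Theory Num.Theory.
Import numFieldNormedType.Exports.
Import Normc.

Local Open Scope classical_set_scope.
Local Open Scope ring_scope.

(** Product (equivalently Borel) sigma-algebra on R^n: the coarsest one making
    the coordinates measurable. *)

Definition measure_rV_display : measure_display.
Proof. exact: default_measure_display. Qed.

Section measurable_rV.
Context {R : realType} (n : nat).

Definition coord_rV (i : 'I_n) (x : 'rV[R]_n) : R := x ord0 i.

HB.instance Definition _ := @isMeasurable.Build measure_rV_display
  'rV[R]_n (g_sigma_preimage coord_rV)
  (@sigma_algebra0 _ _ _) (@sigma_algebraC _ _) (@sigma_algebra_bigcup _ _ _).

End measurable_rV.

Section lebesgue_rV.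
Context {R : realType}.

Lemma measurable_coord_rV n (i : 'I_n) :
  measurable_fun [set: 'rV[R]_n] (coord_rV i).
Proof.
move=> _ Y mY; rewrite setTI; apply: sub_sigma_algebra => /=.
rewrite -bigcup_seq/=; exists i => /=; first by rewrite mem_index_enum.
by exists Y => //; rewrite setTI.
Qed.

Lemma measurable_fun_rV d (T : measurableType d) n (f : T -> 'rV[R]_n) :
  (forall i, measurable_fun [set: T] (coord_rV i \o f)) ->
  measurable_fun [set: T] f.
Proof.
move=> mf; suff : preimage_set_system [set: T] f measurable `<=` measurable.
  by move=> prefS _ A mA; apply: prefS; exists A.
change (preimage_set_system [set: T] f (g_sigma_preimage (@coord_rV R n))
  `<=` measurable).
rewrite -g_sigma_preimage_comp.
apply: smallest_sub; first exact: sigma_algebra_measurable.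
case: n f mf => [|n] f mf; first by rewrite big_ord0.
rewrite -bigcup_mkord_ord; apply: bigcup_sub => i Ii.
by move=> A [B mB <-]; exact: mf.
Qed.

Definition cons_rV n (p : measurableTypeR R * 'rV[R]_n) : 'rV[R]_n.+1 :=
  row_mx (const_mx p.1 : 'rV_1) p.2.

Definition uncons_rV n (x : 'rV[R]_n.+1) : measurableTypeR R * 'rV[R]_n :=
  (x ord0 ord0, \row_j x ord0 (lift ord0 j)).

Lemma cons_rVK n : cancel (@cons_rV n) (@uncons_rV n).
Proof.
move=> [a v]; rewrite /uncons_rV /cons_rV/=; congr pair.
  apply: etrans (etrans (row_mxEl (const_mx a : 'rV_1) v ord0 ord0) (mxE _ _ _ _)).
  by apply: (congr1 (fun k : 'I_(1 + n) => row_mx _ v ord0 k)); exact/val_inj.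
apply/rowP => j; rewrite mxE -(row_mxEr (const_mx a : 'rV_1) v ord0 j).
by apply: (congr1 (fun k : 'I_(1 + n) => row_mx _ v ord0 k)); exact/val_inj.
Qed.

Lemma measurable_cons_rV n : measurable_fun setT (@cons_rV n).
Proof.
apply: measurable_fun_rV => i; rewrite /coord_rV /cons_rV.
case: (split_ordP (i : 'I_(1 + n))) => j ->.
  rewrite (_ : _ \o _ = fst); first exact: measurable_fst.
  by apply/funext => p; exact: etrans (row_mxEl _ _ _ _) (mxE _ _ _ _).
rewrite (_ : _ \o _ = coord_rV j \o snd).
  by apply: measurableT_comp; [exact: measurable_coord_rV|exact: measurable_snd].
by apply/funext => p; exact: row_mxEr.
Qed.

Lemma measurable_uncons_rV n : measurable_fun setT (@uncons_rV n).
Proof.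
apply: measurable_fun_pair; first exact: measurable_coord_rV.
apply: measurable_fun_rV => i.
rewrite (_ : _ \o _ = coord_rV (lift ord0 i)); first exact: measurable_coord_rV.
by apply/funext => x; rewrite /coord_rV/= mxE.
Qed.

Section step.
Context n (mu : {sigma_finite_measure set 'rV[R]_n -> \bar R}).

Definition lebesgue_rV_step : set 'rV[R]_n.+1 -> \bar R :=
  pushforward (lebesgue_measure \x mu)%E (@cons_rV n).

HB.instance Definition _ := Measure.copy lebesgue_rV_step
  (measure_function_pushforward__canonical__measure_function_Measure
     (lebesgue_measure \x mu)%E (@measurable_cons_rV n)).

Let sigma_finite_step : sigma_finite setT lebesgue_rV_step.
Proof.
have /sigma_finiteP[F [FT Fnd Foo]] := sigma_finiteT (@lebesgue_measure R).
have /sigma_finiteP[G [GT Gnd Goo]] := sigma_finiteT mu.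
exists (fun k => @uncons_rV n @^-1` (F k `*` G k)).
  rewrite -preimage_bigcup (_ : \bigcup_k _ = setT) ?preimage_setT//.
  rewrite -setXTT FT GT predeqE => -[x y]; split.
    by move=> [k _ []/= ? ?]; split; exists k.
  move=> [/= [k _ Fkx] [m _ Gmy]]; exists (maxn k m) => //; split.
    by move: x Fkx; exact/subsetPset/Fnd/leq_maxl.
  by move: y Gmy; exact/subsetPset/Gnd/leq_maxr.
move=> k; have [mF Fk] := Foo k; have [mG Gk] := Goo k; split.
  rewrite -[X in measurable X]setTI; apply: measurable_uncons_rV => //.
  exact: measurableX.
rewrite /lebesgue_rV_step /pushforward -comp_preimage.
rewrite (_ : _ \o _ = id); last by apply/funext => p /=; rewrite cons_rVK.
by rewrite preimage_id product_measure1E// lte_mul_pinfty// ge0_fin_numE.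
Qed.

HB.instance Definition _ := Measure_isSigmaFinite.Build _ _ _
  lebesgue_rV_step sigma_finite_step.

End step.

(** Lebesgue measure on R^n, as the n-fold product of one-dimensional Lebesgue
    measure. *)
Fixpoint lebesgue_rV (n : nat) : {sigma_finite_measure set 'rV[R]_n -> \bar R} :=
  match n with
  | 0 => dirac (0 : 'rV[R]_0)
  | m.+1 => lebesgue_rV_step (lebesgue_rV m)
  end.

End lebesgue_rV.

Section log_laplacian.
Context {R : realType} (d : nat).
Local Notation Rd := 'rV[R]_d.
Local Notation leb := (@lebesgue_rV R d).
Implicit Types (Omega : set Rd) (f g phi psi : Rd -> R[i]).

(** The norm carried by ['rV[R]_d] in the library is the sup norm; [enorm] is
    the Euclidean one. *)
Definition dotp (x y : Rd) : R := \sum_(i < d) x ord0 i * y ord0 i.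
Definition enorm (x : Rd) : R := Num.sqrt (dotp x x).
Definition unit_ball : set Rd := [set x | enorm x < 1].

Definition cmeasurable f :=
  measurable_fun setT (fun x => complex.Re (f x)) /\
  measurable_fun setT (fun x => complex.Im (f x)).

Definition cintegral (D : set Rd) f : R[i] :=
  Complex (\int[leb]_(x in D) complex.Re (f x))%R (\int[leb]_(x in D) complex.Im (f x))%R.

(** [e^(-it)] *)
Definition cexpNi (t : R) : R[i] := Complex (cos t) (- sin t).

(** Elements of L^2(Omega) with |Omega| finite are integrable, so on that space
    the Fourier transform is given by the absolutely convergent integral. *)
Definition fourier phi (xi : Rd) : R[i] :=
  cintegral setT (fun x => cexpNi (dotp x xi) * phi x).

Definition L2 Omega phi :=
  [/\ cmeasurable phi,
      (\int[leb]_x (normc (phi x) ^+ 2)%:E < +oo)%E &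
      {ae leb, forall x, ~ Omega x -> phi x = 0}].

Definition L2_inner Omega phi psi : R[i] :=
  cintegral Omega (fun x => phi x * (psi x)^*%C).

Definition partial (i : 'I_d) (f : Rd -> R) : Rd -> R :=
  fun x => 'D_(delta_mx ord0 i) f x.

Definition smooth (f : Rd -> R) := forall s : seq 'I_d,
  let g := foldr partial f s in
  continuous g /\ forall i x, derivable g x (delta_mx ord0 i).

Definition test_function Omega phi :=
  let supp := closure [set x | phi x != 0] in
  [/\ smooth (fun x => complex.Re (phi x)), smooth (fun x => complex.Im (phi x)),
      compact supp & supp `<=` Omega].

(** The square of the norm [|| . ||_*]. *)
Definition star_normsq phi : \bar R :=
  \int[leb]_xi (ln (expR 1 + enorm xi) * normc (fourier phi xi) ^+ 2)%:E.

Definition form_domain Omega phi := L2 Omega phi /\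
  exists u : nat -> Rd -> R[i], (forall n, test_function Omega (u n)) /\
    star_normsq (fun x => u n x - phi x) @[n --> \oo] --> 0%E.

(** [ln 0 = 0] in the library, on the null set [{0}]. *)
Definition log_form phi psi : R[i] :=
  (((2 * pi) ^+ d)^-1)%:C%C *
  cintegral setT (fun xi =>
    (ln (enorm xi))%:C%C * fourier phi xi * (fourier psi xi)^*%C).

Definition eigenfunction Omega (lam : R) phi :=
  [/\ form_domain Omega phi,
      ~ {ae leb, forall x, phi x = 0} &
      forall psi, form_domain Omega psi ->
        log_form phi psi = lam%:C%C * L2_inner Omega phi psi].

Definition complete_orthonormal Omega (phi : nat -> Rd -> R[i]) :=
  [/\ forall k, L2 Omega (phi k),
      forall j k, L2_inner Omega (phi j) (phi k) = (j == k)%:R &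
      forall f, L2 Omega f -> (forall k, L2_inner Omega f (phi k) = 0) ->
        {ae leb, forall x, f x = 0}].

(** [lam k] is the [(k+1)]-st eigenvalue, counted with multiplicity: the
    enumeration is determined by [Omega], since it comes with a complete
    orthonormal system of eigenfunctions. *)
Definition dirichlet_eigenvalues Omega (lam : nat -> R) :=
  [/\ lam 0%N < lam 1%N, nondecreasing_seq lam,
      lam n @[n --> \oo] --> +oo &
      exists phi : nat -> Rd -> R[i],
        complete_orthonormal Omega phi /\
        forall k, eigenfunction Omega (lam k) (phi k)].

End log_laplacian.
Arguments unit_ball {R} d.

(** [N(lambda)], equal to [+oo] if infinitely many [lam k] lie below. *)
Definition eigenvalue_count {R : realType} (lam : nat -> R) (lambda : R) : \bar R :=
  counting [set k | lam k < lambda].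

(* Main.v *)
Require Import Defs.
From mathcomp Require Import all_boot all_order all_algebra.
From mathcomp Require Import all_classical all_reals all_analysis.
From mathcomp Require Import measurable_realfun complex ring lra.

(* For an orthonormal system of eigenfunctions phi_k, Plancherel's identity gives
   m - lam_k = (2 pi)^-d \int (m - ln |xi|) |phi_k^(xi)|^2 dxi for every real m.
   Bound m - ln |xi| by its positive part and sum over the k with lam_k < lambda:
   by Bessel's inequality for the function x |-> e^(i x xi) on Omega one has
   \sum_k |phi_k^(xi)|^2 <= |Omega|, and the layer-cake formula computes
   \int (m - ln |xi|)_+ dxi = |B_d| e^(m d) / d. Each term on the left is at least
   1 / d when m = lambda + 1 / d, which is the optimal choice.

   Plancherel's identity on the line is obtained for real functions by pairing
   with the Poisson kernel: AM-GM gives the upper bound, and the lower bound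
   holds for continuous bounded functions by dominated convergence, hence for
   all functions by averaging over short intervals, Lebesgue differentiation
   and Fatou's lemma. Fubini's theorem then yields all dimensions.

   The logarithmic form is finite on its domain because test functions have
   finite logarithmic energy, by Plancherel applied to difference quotients. *)

Set Implicit Arguments.
Unset Strict Implicit.
Unset Printing Implicit Defensive.

Import Order.TTheory GRing.Theory Num.Theory.
Import numFieldNormedType.Exports.
Local Open Scope classical_set_scope.
Local Open Scope ring_scope.

(** * Real-valued integrals on product spaces *)

(** The real-valued integral is [0] when the extended one is infinite, so an integral is split into
    a sum only under a proof of integrability. Complex functions are carried as pairs of real ones:
    multiplication by [- i] turns [(a, b)] into [(b, - a)], so that one real oscillatory integral
    yields both parts of the Fourier transform.

    On the line, a damping factor [e^(-e t)] makes Fubini's theorem applicable: the phase alone is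
    not integrable in [t], and its damped integral is the Poisson kernel, whose mass [pi] does not
    depend on [e]. Averages over short intervals suit the passage to general functions for two
    reasons. They are difference quotients of a primitive, hence continuous, bounded and convergent
    almost everywhere. And averaging does not increase the modulus of the Fourier transform, so the
    spectral side of the lower bound needs no limit.

    The finite measure of Omega puts [L^2(Omega)] inside [L^1]; the transforms of the eigenfunctions
    are therefore bounded, which controls the singularity of [ln |xi|] at the origin. *)

Section integral_helpers.
Context d (T : measurableType d) (R : realType).
Variable mu : {measure set T -> \bar R}.
Implicit Types f g : T -> R.

Lemma integrable_measurable f :
  mu.-integrable setT (EFin \o f) -> measurable_fun setT f.
Proof. by move=> /integrableP[/measurable_EFinP]. Qed.

Lemma le_integrableR f g : measurable_fun setT f ->
  (forall x, `|f x| <= g x) ->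
  mu.-integrable setT (EFin \o g) -> mu.-integrable setT (EFin \o f).
Proof.
move=> mf fg; apply: le_integrable => //; first exact/measurable_EFinP.
move=> x _ /=; rewrite lee_fin (le_trans (fg x))// ler_norm//.
Qed.

Lemma integrable_mul_bounded f g (M : R) : mu.-integrable setT (EFin \o f) ->
  measurable_fun setT g -> (forall x, `|g x| <= M) ->
  mu.-integrable setT (EFin \o (fun x => f x * g x)).
Proof.
move=> intf mg gM.
apply: (@le_integrableR _ (fun x => M * `|f x|)).
- exact: measurable_funM (integrable_measurable intf) mg.
- by move=> x; rewrite normrM mulrC ler_wpM2r.
- have := integrableZl measurableT M (integrable_norm intf).
  by apply: eq_integrable => // x _ /=; rewrite EFinM.
Qed.

Lemma integrableZlR f (c : R) : mu.-integrable setT (EFin \o f) ->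
  mu.-integrable setT (EFin \o (fun x => c * f x)).
Proof.
move=> /(integrableZl measurableT c).
by apply: eq_integrable => // x _ /=; rewrite EFinM.
Qed.

Lemma integrableDR f g : mu.-integrable setT (EFin \o f) ->
  mu.-integrable setT (EFin \o g) ->
  mu.-integrable setT (EFin \o (fun x => f x + g x)).
Proof.
move=> intf intg; have := integrableD measurableT intf intg.
by apply: eq_integrable => // x _ /=; rewrite EFinD.
Qed.

Lemma integrableNR f : mu.-integrable setT (EFin \o f) ->
  mu.-integrable setT (EFin \o (fun x => - f x)).
Proof.
move=> intf; have := integrableN intf.
by apply: eq_integrable.
Qed.

Lemma integrableBR f g : mu.-integrable setT (EFin \o f) ->
  mu.-integrable setT (EFin \o g) ->
  mu.-integrable setT (EFin \o (fun x => f x - g x)).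
Proof. by move=> intf intg; apply: integrableDR => //; exact: integrableNR. Qed.

Lemma integrable_ge0 f : measurable_fun setT f -> (forall x, 0 <= f x) ->
  (\int[mu]_x (f x)%:E < +oo)%E -> mu.-integrable setT (EFin \o f).
Proof.
move=> mf f0 foo; apply/integrableP; split; first exact/measurable_EFinP.
by under eq_integral => x _ do rewrite /= ger0_norm//.
Qed.

Lemma integrable_EFinE f : mu.-integrable setT (EFin \o f) ->
  (\int[mu]_x f x)%:E = (\int[mu]_x (f x)%:E)%E.
Proof. by move=> intf; rewrite /Rintegral fineK// integrable_fin_num. Qed.

Lemma integrable_norm_lty f : mu.-integrable setT (EFin \o f) ->
  (\int[mu]_x `|f x|%:E < +oo)%E.
Proof. by move=> /integrableP[]. Qed.

End integral_helpers.

Section fubini_helpers.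
Context d1 d2 (T1 : measurableType d1) (T2 : measurableType d2) (R : realType).
Variables (m1 : {sigma_finite_measure set T1 -> \bar R}).
Variables (m2 : {sigma_finite_measure set T2 -> \bar R}).
Implicit Type F : T1 * T2 -> R.

Lemma measurable_pair1 F x : measurable_fun setT F ->
  measurable_fun setT (fun y => F (x, y)).
Proof. by move=> mF; apply: measurableT_comp => //. Qed.

Lemma measurable_pair2 F y : measurable_fun setT F ->
  measurable_fun setT (fun x => F (x, y)).
Proof. by move=> mF; apply: measurableT_comp => //. Qed.

(** The extended integral is the difference of the integrals of the positive and negative parts,
    both measurable in the parameter by Tonelli, and [fine] is measurable. *)
Lemma measurable_Rintegral1 F : measurable_fun setT F ->
  measurable_fun setT (fun x => \int[m2]_y F (x, y)).
Proof.
move=> mF; apply: measurableT_comp => //=.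
rewrite (_ : (fun x => _) = (fun x => \int[m2]_y (EFin \o F)^\+ (x, y)) \-
  (fun x => \int[m2]_y (EFin \o F)^\- (x, y)))%E; last first.
  apply/funext => x /=; rewrite [LHS]integralE.
  by congr (_ - _)%E; apply: eq_integral => y _; rewrite !(funeposE, funenegE).
apply: emeasurable_funB; apply: measurable_fun_fubini_tonelli_F => //.
- by apply: measurable_funepos; exact/measurable_EFinP.
- by apply: measurable_funeneg; exact/measurable_EFinP.
Qed.

Lemma measurable_Rintegral2 F : measurable_fun setT F ->
  measurable_fun setT (fun y => \int[m1]_x F (x, y)).
Proof.
move=> mF; apply: measurableT_comp => //=.
rewrite (_ : (fun y => _) = (fun y => \int[m1]_x (EFin \o F)^\+ (x, y)) \-
  (fun y => \int[m1]_x (EFin \o F)^\- (x, y)))%E; last first.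
  apply/funext => y /=; rewrite [LHS]integralE.
  by congr (_ - _)%E; apply: eq_integral => x _; rewrite !(funeposE, funenegE).
apply: emeasurable_funB; apply: measurable_fun_fubini_tonelli_G => //.
- by apply: measurable_funepos; exact/measurable_EFinP.
- by apply: measurable_funeneg; exact/measurable_EFinP.
Qed.

(** The inner real integral agrees with the extended one only on integrable sections, that is,
    almost everywhere; this is enough to transfer Fubini's theorem. *)
Lemma Rintegral12_prod F : (m1 \x m2)%E.-integrable setT (EFin \o F) ->
  \int[m1]_x \int[m2]_y F (x, y) = \int[(m1 \x m2)%E]_z F z.
Proof.
move=> intF; have mF := integrable_measurable intF.
transitivity (fine (\int[m1]_x fubini_F m2 (EFin \o F) x)%E); last first.
  by rewrite integral12_prod_meas1.
congr fine.
apply: ae_eq_integral => //.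
- by apply/measurable_EFinP; exact: measurable_Rintegral1.
- exact: (measurable_fubini_F intF).
- apply: filterS (ae_integrable1 intF) => x /= intx _.
  by rewrite /fubini_F/= /Rintegral fineK// integrable_fin_num.
Qed.

Lemma Rintegral21_prod F : (m1 \x m2)%E.-integrable setT (EFin \o F) ->
  \int[m2]_y \int[m1]_x F (x, y) = \int[(m1 \x m2)%E]_z F z.
Proof.
move=> intF; have mF := integrable_measurable intF.
transitivity (fine (\int[m2]_y fubini_G m1 (EFin \o F) y)%E); last first.
  by rewrite integral21_prod_meas1.
congr fine.
apply: ae_eq_integral => //.
- by apply/measurable_EFinP; exact: measurable_Rintegral2.
- exact: (measurable_fubini_G intF).
- apply: filterS (ae_integrable2 intF) => y /= inty _.
  by rewrite /fubini_G/= /Rintegral fineK// integrable_fin_num.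
Qed.

Lemma Rintegral_Fubini F : (m1 \x m2)%E.-integrable setT (EFin \o F) ->
  \int[m1]_x \int[m2]_y F (x, y) = \int[m2]_y \int[m1]_x F (x, y).
Proof. by move=> intF; rewrite Rintegral12_prod// Rintegral21_prod. Qed.

Lemma integrable_Rintegral1 F : (m1 \x m2)%E.-integrable setT (EFin \o F) ->
  m1.-integrable setT (EFin \o (fun x => \int[m2]_y F (x, y))).
Proof.
move=> intF; have mF := integrable_measurable intF.
apply/integrableP; split.
  by apply/measurable_EFinP; exact: measurable_Rintegral1.
have /integrableP[_ lty] := integrable_fubini_F intF.
apply: le_lt_trans lty; apply: ae_ge0_le_integral => //.
- by apply: measurableT_comp => //; apply/measurable_EFinP; exact: measurable_Rintegral1.
- by apply: measurableT_comp => //; exact: (measurable_fubini_F intF).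
- apply: filterS (ae_integrable1 intF) => x /= intx _.
  by rewrite -EFin_normr_Rintegral// /fubini_F lexx.
Qed.

Lemma integrable_Rintegral2 F : (m1 \x m2)%E.-integrable setT (EFin \o F) ->
  m2.-integrable setT (EFin \o (fun y => \int[m1]_x F (x, y))).
Proof.
move=> intF; have mF := integrable_measurable intF.
have mEF : measurable_fun setT (EFin \o F) by exact/measurable_EFinP.
apply/integrableP; split.
  by apply/measurable_EFinP; exact: measurable_Rintegral2.
apply: le_lt_trans ((integrable21ltyP m1 m2 mEF).1 intF).
apply: ae_ge0_le_integral => //.
- by apply: measurableT_comp => //; apply/measurable_EFinP; exact: measurable_Rintegral2.
- by move=> y _; exact: integral_ge0.
- apply: (measurable_fun_fubini_tonelli_G (fun z => `|F z|%:E)) => //=.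
  by apply/measurable_EFinP; exact: measurableT_comp.
- apply: filterS (ae_integrable2 intF) => y /= inty _.
  rewrite -[leLHS]/(`|\int[m1]_x F (x, y)|%:E) EFin_normr_Rintegral//.
  apply: le_abse_integral => //.
  exact: measurable_int inty.
Qed.

(** The criterion for oscillating kernels: a bounded phase leaves a product of one function per
    variable as a majorant. *)
Lemma integrable_prod_le F (f : T1 -> R) (g : T2 -> R) : measurable_fun setT F ->
  m1.-integrable setT (EFin \o f) -> m2.-integrable setT (EFin \o g) ->
  (forall x y, `|F (x, y)| <= `|f x| * `|g y|) ->
  (m1 \x m2)%E.-integrable setT (EFin \o F).
Proof.
move=> mF intf intg Ffg.
have [mf mg] := (integrable_measurable intf, integrable_measurable intg).
apply/integrable12ltyP; first exact/measurable_EFinP.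
apply: (@le_lt_trans _ _ (\int[m1]_x (`|f x|%:E * \int[m2]_y `|g y|%:E))%E).
  apply: ge0_le_integral => //.
  - by move=> x _; exact: integral_ge0.
  - apply: (measurable_fun_fubini_tonelli_F (fun z => `|F z|%:E)) => //=.
    by apply/measurable_EFinP; exact: measurableT_comp.
  - apply: emeasurable_funM => //.
    by apply/measurable_EFinP; exact: measurableT_comp.
  - move=> x _; rewrite -ge0_integralZl//.
    + apply: ge0_le_integral => //.
      * apply/measurable_EFinP; apply: measurableT_comp => //.
        exact: measurable_pair1.
      * by apply/measurable_EFinP; apply: measurable_funM => //; exact: measurableT_comp.
      * by move=> y _; rewrite /= lee_fin.
    + by apply/measurable_EFinP; exact: measurableT_comp.
rewrite ge0_integralZr//.
- have foo := integrable_norm_lty intf; have goo := integrable_norm_lty intg.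
  by rewrite lte_mul_pinfty ?integral_ge0// ge0_fin_numE ?integral_ge0.
- by apply/measurable_EFinP; exact: measurableT_comp.
- exact: integral_ge0.
Qed.

End fubini_helpers.

(** * Poisson kernel on the line *)

Section change_of_variables.
Context d (T : measurableType d) (R : realType).
Variables (mu : {measure set T -> \bar R}) (phi : T -> T) (c : R).
Hypotheses (mphi : measurable_fun setT phi) (c_gt0 : 0 < c).
Hypothesis mu_phi : forall A, measurable A -> (mu (phi @^-1` A) = c%:E * mu A)%E.

(** The hypothesis on [phi] says that the pushforward of [mu] is [c] times [mu]. Keeping the space
    abstract serves both affine maps of the line and translations of R^n. *)
Lemma ge0_integral_comp (f : T -> \bar R) : measurable_fun setT f ->
  (forall x, 0 <= f x)%E ->
  (\int[mu]_x f (phi x) = c%:E * \int[mu]_x f x)%E.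
Proof.
move=> mf f0; have := @ge0_integral_pushforward _ _ _ _ _ phi mphi mu setT f.
rewrite preimage_setT => <- //.
have c0 : (0 <= c)%R by exact: ltW.
rewrite -(ge0_integral_mscale mu measurableT (NngNum c0))//.
by apply: eq_measure_integral => A mA _; exact: mu_phi.
Qed.

Lemma integrable_comp (f : T -> R) : mu.-integrable setT (EFin \o f) ->
  mu.-integrable setT (EFin \o (f \o phi)).
Proof.
move=> intf; have mf := integrable_measurable intf.
apply/integrableP; split; first by apply/measurable_EFinP; exact: measurableT_comp.
rewrite (ge0_integral_comp (f := fun x => `|f x|%:E))//.
  by rewrite lte_mul_pinfty ?lee_fin ?ltW// integrable_norm_lty.
by apply/measurable_EFinP; exact: measurableT_comp.
Qed.

Lemma Rintegral_comp (f : T -> R) : mu.-integrable setT (EFin \o f) ->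
  \int[mu]_x f (phi x) = c * \int[mu]_x f x.
Proof.
move=> intf; have mf := integrable_measurable intf.
have mEf : measurable_fun setT (EFin \o f) by exact/measurable_EFinP.
rewrite {1}/Rintegral integralE.
under eq_integral => x _.
  rewrite (_ : _ x = (EFin \o f)^\+%E (phi x)); last by rewrite !funeposE.
  over.
under [X in (_ - X)%E]eq_integral => x _.
  rewrite (_ : _ x = (EFin \o f)^\-%E (phi x)); last by rewrite !funenegE.
  over.
rewrite !ge0_integral_comp//; [|exact: measurable_funeneg|exact: measurable_funepos].
rewrite -muleBr//; last exact: integrable_add_def.
by rewrite -integralE fineM// integrable_fin_num.
Qed.

End change_of_variables.

Section lebesgue_line.
Context {R : realType}.
Local Notation mu := (@lebesgue_measure R).

Lemma measurable_affine (r h : R) : measurable_fun setT (fun x : R => r * x + h).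
Proof. by apply: measurable_funD => //; exact: measurable_funM. Qed.

(** Uniqueness of Lebesgue measure: [r] times the pushforward gives every interval []a, b]] its
    length. *)
Lemma lebesgue_measure_affine (r h : R) (A : set (measurableTypeR R)) : 0 < r ->
  measurable A ->
  (mu ((fun x : R => (r * x + h)%R) @^-1` A) = (r^-1)%:E * mu A)%E.
Proof.
move=> r0 mA; have r0' : 0 <= r by exact: ltW.
pose phi : measurableTypeR R -> measurableTypeR R := fun x => r * x + h.
have mphi : measurable_fun setT phi by exact: measurable_affine.
pose m1 : {measure set _ -> \bar R} :=
  measure_function_pushforward__canonical__measure_function_Measure mu mphi.
have -> : mu A = mscale (NngNum r0') m1 A.
  apply: (@lebesgue_measure_unique R (mscale (NngNum r0') m1)) => // _ [[a b]] _ <-.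
  rewrite /= /mscale /= /pushforward.
  have -> : phi @^-1` `]a, b] = `](a - h) / r, (b - h) / r]%classic.
    apply/seteqP; split => x /=; rewrite !in_itv/= /phi ltr_pdivrMr// ler_pdivlMr//;
    by rewrite ltrBlDr lerBrDr mulrC.
  rewrite !lebesgue_measure_itv/= !lte_fin ltr_pM2r ?invr_gt0// ltrD2r.
  case: ifPn => ab; last by rewrite mule0.
  by rewrite -!EFinD -EFinM; congr EFin; field; exact: lt0r_neq0.
by rewrite /mscale/= muleA -EFinM mulVf ?lt0r_neq0// mul1e.
Qed.

(** The Poisson kernel without the factor [1 / pi]: its mass is [pi], and it is exactly the integral
    of [e^(-e t) cos (z t)] over [t > 0]. *)
Definition poisson (e z : R) : R := e / (e ^+ 2 + z ^+ 2).

Lemma poisson_ge0 e z : 0 < e -> 0 <= poisson e z.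
Proof. by move=> e0; rewrite divr_ge0 ?addr_ge0 ?sqr_ge0// ltW. Qed.

Lemma poissonN e z : poisson e (- z) = poisson e z.
Proof. by rewrite /poisson sqrrN. Qed.

Lemma poisson1_oneDsqr z : poisson 1 z = (oneDsqr z)^-1.
Proof. by rewrite /poisson /oneDsqr expr1n mul1r. Qed.

Lemma poisson_scale e z : 0 < e -> poisson e (e * z) = e^-1 * poisson 1 z.
Proof.
move=> e0; rewrite /poisson exprMn expr1n; field.
have := sqr_ge0 z; move=> z0.
by rewrite !lt0r_neq0// ?exprn_gt0//; nra.
Qed.

Lemma continuous_poisson e : 0 < e -> continuous (poisson e).
Proof.
move=> e0 z; apply: cvgM; first exact: cvg_cst.
apply: cvgV; first by rewrite lt0r_neq0// ltr_pwDl ?exprn_gt0// sqr_ge0.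
by apply: cvgD; [exact: cvg_cst|exact: exprn_continuous].
Qed.

Lemma measurable_poisson e : 0 < e -> measurable_fun setT (poisson e).
Proof. by move=> e0; apply: continuous_measurable_fun; exact: continuous_poisson. Qed.

Lemma integral_poisson1 : (\int[mu]_z (poisson 1 z)%:E = pi%:E)%E.
Proof.
under eq_integral do rewrite poisson1_oneDsqr.
rewrite ge0_symfun_integralT.
- by rewrite -set_itvcy integral0y_oneDsqr -EFinM mulrC divfK.
- by move=> x; rewrite invr_ge0 /oneDsqr addr_ge0 ?sqr_ge0.
- exact: continuous_oneDsqrV.
- by move=> x; rewrite /= /oneDsqr sqrrN.
Qed.

Lemma integral_poisson e x : 0 < e -> (\int[mu]_y (poisson e (x - y))%:E = pi%:E)%E.
Proof.
move=> e0.
pose f (y : R) := (poisson e (x - y))%:E.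
have mf : measurable_fun setT f.
  apply/measurable_EFinP; apply: measurableT_comp; first exact: measurable_poisson.
  exact: measurable_funB.
have f0 y : (0 <= f y)%E by rewrite lee_fin poisson_ge0.
have ei0 : 0 < e^-1 by rewrite invr_gt0.
have := @ge0_integral_comp _ (measurableTypeR R) R mu _ _ (measurable_affine e x)
  ei0 (fun A => @lebesgue_measure_affine e x A e0) f mf f0.
move=> /(congr1 (fun y => e%:E * y)%E).
rewrite muleA -EFinM divff ?lt0r_neq0// mul1e => <-.
under eq_integral => z _.
  rewrite /f opprD addrA addrAC addrN sub0r poissonN poisson_scale// EFinM; over.
rewrite ge0_integralZl//.
- by rewrite integral_poisson1 -!EFinM mulrA divff ?lt0r_neq0// mul1r.
- by apply/measurable_EFinP; exact: measurable_poisson.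
- by move=> z _; rewrite lee_fin poisson_ge0.
- by rewrite lee_fin ltW.
Qed.

End lebesgue_line.

Section laplace_cos.
Context {R : realType}.
Local Notation mu := (@lebesgue_measure R).
Variables (e z : R).
Hypothesis e_gt0 : 0 < e.

(* Adding 1 to the cosine makes the integrand nonnegative, as the improper FTC
   requires. *)
Let f (t : R) : R := expR (- (e * t)) * (1 + cos (z * t)).
(** The antiderivative of [f] that vanishes at [+oo]; the second summand comes from integrating
    [e^(-e t) cos (z t)] by parts twice. *)
Let F (t : R) : R :=
  expR (- (e * t)) * (- e^-1 + (z * sin (z * t) - e * cos (z * t)) / (e ^+ 2 + z ^+ 2)).

Let ez_gt0 : 0 < e ^+ 2 + z ^+ 2.
Proof. by rewrite ltr_pwDl ?exprn_gt0// sqr_ge0. Qed.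

Let is_derive_linear (c t : R) : is_derive t (1 : R) (fun t : R => c * t) c.
Proof.
have := is_deriveM (is_derive_cst c t (1:R)) (is_derive_id t (1:R)).
by move=> /is_derive_eq; apply; rewrite /GRing.scale/= mulr0 addr0 mulr1.
Qed.

Let is_derive_F (t : R) : is_derive t (1 : R) F (f t).
Proof.
have d1 : is_derive t (1 : R) (fun t : R => expR (- (e * t))) (expR (- (e * t)) * (- e)).
  exact: is_derive1_comp (is_derive_expR _) (is_deriveN (is_derive_linear e t)).
have d2 : is_derive t (1 : R) (fun t : R => sin (z * t)) (cos (z * t) * z).
  exact: is_derive1_comp (is_derive_sin _) (is_derive_linear z t).
have d3 : is_derive t (1 : R) (fun t : R => cos (z * t)) (- sin (z * t) * z).
  exact: is_derive1_comp (is_derive_cos _) (is_derive_linear z t).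
have d4 := is_deriveB (is_deriveM (is_derive_cst z t (1:R)) d2)
                      (is_deriveM (is_derive_cst e t (1:R)) d3).
have d5 := is_deriveD (is_derive_cst (- e^-1) t (1:R))
  (is_deriveM d4 (is_derive_cst (e ^+ 2 + z ^+ 2)^-1 t (1:R))).
have := is_deriveM d1 d5.
move=> /is_derive_eq; apply; rewrite /GRing.scale/= /f /cst/= !fctE.
by field; rewrite !lt0r_neq0.
Qed.

Let F_cvg0 : F t @[t --> +oo%R] --> 0.
Proof.
pose M := e^-1 + (`|z| + e) / (e ^+ 2 + z ^+ 2).
have cvgE : expR (- (e * t)) @[t --> +oo%R] --> (0 : R).
  apply: (@cvg_comp _ _ _ (fun t => e * t) (fun t => expR (- t)) _ +oo%R).
    exact: gt0_cvgMry.
  exact: cvgr_expR.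
have cvgM' (c : R) : c * expR (- (e * t)) @[t --> +oo%R] --> (0 : R).
  by rewrite -(mulr0 c); apply: cvgM => //; exact: cvg_cst.
apply: (squeeze_cvgr _ (cvgM' (- M)) (cvgM' M)).
near=> t; rewrite mulNr -ler_norml /F normrM ger0_norm ?expR_ge0// mulrC.
rewrite ler_wpM2r ?expR_ge0// (le_trans (ler_normD _ _))// normrN.
rewrite lerD//; first by rewrite ger0_norm// invr_ge0 ltW.
have D0 : 0 < (e ^+ 2 + z ^+ 2)^-1 by rewrite invr_gt0.
rewrite normrM (ger0_norm (ltW D0)) (ler_pM2r D0).
rewrite (le_trans (ler_normB _ _))// !normrM (ger0_norm (ltW e_gt0)).
rewrite lerD//.
  by rewrite ler_piMr// sin_max.
by rewrite ler_piMr ?cos_max// ltW.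
Unshelve. all: by end_near. Qed.

Let continuous_f : continuous f.
Proof.
move=> t; apply: cvgM.
  apply: (@continuous_comp _ _ _ (fun t => - (e * t)) expR).
    by apply: cvgN; apply: cvgM; [exact: cvg_cst|exact: cvg_id].
  exact: continuous_expR.
apply: cvgD; first exact: cvg_cst.
apply: (@continuous_comp _ _ _ (fun t => z * t) cos).
  by apply: cvgM; [exact: cvg_cst|exact: cvg_id].
exact: continuous_cos.
Qed.

Lemma integral_exp_1Dcos :
  (\int[mu]_(t in `]0%R, +oo[) (expR (- (e * t)) * (1 + cos (z * t)))%:E =
   (e^-1 + poisson e z)%:E)%E.
Proof.
rewrite integral_itv_obnd_cbnd; last first.
  apply/measurable_EFinP; apply: measurable_funTS.
  by apply: continuous_measurable_fun; exact: continuous_f.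
have dF t : derivable F t (1:R) by have [] := is_derive_F t.
have cF : continuous F.
  by move=> t; apply/differentiable_continuous/derivable1_diffP; exact: dF.
apply: etrans (@ge0_continuous_FTC2y R f F 0 0 _ _ _ _ _ _) _ => //.
- by move=> t _; rewrite /f mulr_ge0 ?expR_ge0//.
- exact: continuous_subspaceT.
- by apply: cvg_at_right_filter; exact: cF.
- move=> t _; rewrite derive1E; have [_ ->//] := is_derive_F t.
- rewrite sub0e /F !mulr0 oppr0 expR0 sin0 cos0 /poisson -EFinN; congr EFin.
  by field; rewrite !lt0r_neq0.
Qed.

End laplace_cos.

Section exponential_weight.
Context {R : realType}.
Local Notation mu := (@lebesgue_measure R).

(** Extension by [0] to [t <= 0] allows integration over the whole line, hence Fubini on a product
    of full spaces. Besides damping the spectral integrals, it carries the radial integral in the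
    layer-cake computation. *)
Definition expw (e t : R) : R := if 0 < t then expR (- (e * t)) else 0.

Lemma expw_ge0 e t : 0 <= expw e t.
Proof. by rewrite /expw; case: ifP => // _; exact: expR_ge0. Qed.

Lemma expwE e (g : R -> R) : (fun t => expw e t * g t) =
  (fun t => expR (- (e * t)) * g t) \_ `]0, +oo[.
Proof.
apply/funext => t; rewrite patchE /expw.
case: ifPn => t0; last by rewrite memNset ?mul0r//= in_itv/= andbT; apply/negP.
by rewrite mem_set//= in_itv/= t0.
Qed.

Lemma measurable_expw e : measurable_fun setT (expw e).
Proof.
rewrite (_ : expw e = (fun t => expR (- (e * t))) \_ `]0, +oo[); last first.
  apply/funext => t; have := congr1 (fun h => h t) (expwE e (cst 1)).
  by rewrite /= mulr1 => ->; rewrite !patchE mulr1.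
apply/(measurable_restrictT _ _).1 => //.
apply: measurable_funTS; apply: measurableT_comp => //.
by under eq_fun do rewrite -mulNr; exact: measurable_funM.
Qed.

Lemma integral_expw_1Dcos e z : 0 < e ->
  (\int[mu]_t (expw e t * (1 + cos (z * t)))%:E = (e^-1 + poisson e z)%:E)%E.
Proof.
move=> e0; rewrite -integral_exp_1Dcos// [RHS]integral_mkcond.
by apply: eq_integral => t _; rewrite restrict_EFin/= -expwE.
Qed.

Lemma integrable_expw e : 0 < e -> mu.-integrable setT (EFin \o expw e).
Proof.
move=> e0; apply: (@le_integrableR _ (measurableTypeR R) R mu (expw e)
    (fun t => expw e t * (1 + cos (0 * t)))).
- exact: measurable_expw.
- move=> t; rewrite ger0_norm ?expw_ge0// mul0r cos0 ler_peMr ?expw_ge0//.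
  by rewrite lerDl.
- apply: integrable_ge0.
  + apply: measurable_funM; first exact: measurable_expw.
    by under eq_fun do rewrite mul0r; exact: measurable_cst.
  + by move=> t; rewrite mulr_ge0 ?expw_ge0// mul0r cos0 addr_ge0.
  + by rewrite integral_expw_1Dcos// ltry.
Qed.

Lemma measurable_cosM (z : R) : measurable_fun setT (fun t : R => cos (z * t)).
Proof.
apply: continuous_measurable_fun => t.
apply: (@continuous_comp _ _ _ (fun t => z * t) cos); last exact: continuous_cos.
by apply: cvgM; [exact: cvg_cst|exact: cvg_id].
Qed.

(** The integral of [expw e] alone, to be subtracted from that of [expw e * (1 + cos)], is half of
    the latter at [z = 0]. *)
Lemma Rintegral_expw_cos e z : 0 < e ->
  \int[mu]_t (expw e t * cos (z * t)) = poisson e z.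
Proof.
move=> e0.
have intw := integrable_expw e0.
have intwc : mu.-integrable setT (EFin \o (fun t => expw e t * cos (z * t))).
  apply: (integrable_mul_bounded intw (measurable_cosM z)) => t.
  exact: cos_max.
have I0 : \int[mu]_t (expw e t) = e^-1.
  have := integral_expw_1Dcos 0 e0; under eq_integral do rewrite mul0r cos0 mulrDr.
  rewrite /poisson expr0n addr0 => /(congr1 fine) /= H.
  have : \int[mu]_t (expw e t * 1 + expw e t * 1) = e^-1 + e / e ^+ 2 by [].
  under eq_Rintegral do rewrite mulr1.
  rewrite RintegralD// => {}H.
  have ee : e / e ^+ 2 = e^-1 by field; rewrite lt0r_neq0.
  lra.
have := integral_expw_1Dcos z e0.
under eq_integral do rewrite mulrDr mulr1.
move=> /(congr1 fine) /= H.
have : \int[mu]_t (expw e t + expw e t * cos (z * t)) = e^-1 + poisson e z by [].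
by rewrite RintegralD// I0 => /addrI.
Qed.

End exponential_weight.

(** * Plancherel identity on the line *)

Lemma cvg_Rintegral d (T : measurableType d) (R : realType)
    (mu : {measure set T -> \bar R}) (f_ : nat -> T -> R) (f g : T -> R) :
  (forall n, measurable_fun setT (f_ n)) ->
  (forall x, f_ n x @[n --> \oo] --> f x) ->
  mu.-integrable setT (EFin \o g) ->
  (forall n x, `|f_ n x| <= g x) ->
  \int[mu]_x f_ n x @[n --> \oo] --> \int[mu]_x f x.
Proof.
move=> mf_ f_f intg fg.
have mf : measurable_fun setT f.
  by apply: (@measurable_fun_cvg _ _ _ setT f_) => // x _; exact: f_f.
have [|||||intf _ cvgf] := @dominated_convergence _ T R mu setT measurableT
    (fun n => EFin \o f_ n) (EFin \o f) (EFin \o g).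
- by move=> n; exact/measurable_EFinP.
- exact/measurable_EFinP.
- by apply: nearW => x _; apply: cvg_EFin; [exact: nearW|exact: f_f].
- exact: intg.
- by apply: nearW => x n _; rewrite /= lee_fin.
- move: cvgf; rewrite /= -(fineK (integrable_fin_num _ intf))//.
  exact: fine_cvg.
Qed.

Section cosine_sine_transforms.
Context {R : realType}.
Local Notation mu := (@lebesgue_measure R).
Local Notation RT := (measurableTypeR R).
Implicit Types f g : R -> R.

Definition cosT f (t : R) : R := \int[mu]_x (f x * cos (x * t)).
Definition sinT f (t : R) : R := \int[mu]_x (f x * sin (x * t)).

Lemma measurable_mul2 : measurable_fun setT (fun z : RT * RT => z.1 * z.2).
Proof. by apply: measurable_funM. Qed.

Lemma measurable_cos : measurable_fun setT (@cos R).
Proof. by apply: continuous_measurable_fun; exact: continuous_cos. Qed.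

Lemma measurable_sin : measurable_fun setT (@sin R).
Proof. by apply: continuous_measurable_fun; exact: continuous_sin. Qed.

Lemma measurable_cos2 : measurable_fun setT (fun z : RT * RT => cos (z.1 * z.2)).
Proof. exact: measurableT_comp measurable_cos measurable_mul2. Qed.

Lemma measurable_sin2 : measurable_fun setT (fun z : RT * RT => sin (z.1 * z.2)).
Proof. exact: measurableT_comp measurable_sin measurable_mul2. Qed.

Lemma measurable_cosr (t : R) : measurable_fun setT (fun x : RT => cos (x * t)).
Proof. exact: (measurable_pair2 (t : RT) measurable_cos2). Qed.

Lemma measurable_sinr (t : R) : measurable_fun setT (fun x : RT => sin (x * t)).
Proof. exact: (measurable_pair2 (t : RT) measurable_sin2). Qed.

Lemma measurable_cosT f : measurable_fun setT f -> measurable_fun setT (cosT f).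
Proof.
move=> mf; apply: (@measurable_Rintegral2 _ _ RT RT R mu (fun z => f z.1 * cos (z.1 * z.2))).
by apply: measurable_funM; [exact: measurableT_comp|exact: measurable_cos2].
Qed.

Lemma measurable_sinT f : measurable_fun setT f -> measurable_fun setT (sinT f).
Proof.
move=> mf; apply: (@measurable_Rintegral2 _ _ RT RT R mu (fun z => f z.1 * sin (z.1 * z.2))).
by apply: measurable_funM; [exact: measurableT_comp|exact: measurable_sin2].
Qed.

Lemma integrable_fcos f t : mu.-integrable setT (EFin \o f) ->
  mu.-integrable setT (EFin \o (fun x : RT => f x * cos (x * t))).
Proof.
move=> intf; apply: (integrable_mul_bounded intf (measurable_cosr t)) => x.
exact: cos_max.
Qed.

Lemma integrable_fsin f t : mu.-integrable setT (EFin \o f) ->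
  mu.-integrable setT (EFin \o (fun x : RT => f x * sin (x * t))).
Proof.
move=> intf; apply: (integrable_mul_bounded intf (measurable_sinr t)) => x.
exact: sin_max.
Qed.

Lemma normr_cosT f t : mu.-integrable setT (EFin \o f) ->
  `|cosT f t| <= \int[mu]_x `|f x|.
Proof.
move=> intf; apply: le_trans (le_normr_Rintegral measurableT (integrable_fcos t intf)) _.
apply: le_Rintegral => //; first exact: integrable_norm (integrable_fcos t intf).
  exact: integrable_norm.
by move=> x _; rewrite normrM ler_piMr// cos_max.
Qed.

Lemma normr_sinT f t : mu.-integrable setT (EFin \o f) ->
  `|sinT f t| <= \int[mu]_x `|f x|.
Proof.
move=> intf; apply: le_trans (le_normr_Rintegral measurableT (integrable_fsin t intf)) _.
apply: le_Rintegral => //; first exact: integrable_norm (integrable_fsin t intf).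
  exact: integrable_norm.
by move=> x _; rewrite normrM ler_piMr// sin_max.
Qed.

(* The squared modulus of the Fourier transform of a real function. *)
Definition specdens f t : R := cosT f t ^+ 2 + sinT f t ^+ 2.

Lemma specdens_ge0 f t : 0 <= specdens f t.
Proof. by rewrite addr_ge0 ?sqr_ge0. Qed.

Lemma measurable_specdens f : measurable_fun setT f -> measurable_fun setT (specdens f).
Proof.
move=> mf; apply: measurable_funD; apply: measurable_funX.
  exact: measurable_cosT.
exact: measurable_sinT.
Qed.

Lemma Rintegral_cos_sin f (a b t : R) : mu.-integrable setT (EFin \o f) ->
  \int[mu]_x (f x * (a * cos (x * t) + b * sin (x * t))) = a * cosT f t + b * sinT f t.
Proof.
move=> intf.
have intc := integrable_fcos t intf; have ints := integrable_fsin t intf.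
rewrite -!RintegralZl// -RintegralD//; first last.
- exact: integrableZlR.
- exact: integrableZlR.
by apply: eq_Rintegral => x _; ring.
Qed.

Section poisson_pairing.
Variables (f : R -> R) (e : R).
Hypothesis intf : mu.-integrable setT (EFin \o f).
Hypothesis e_gt0 : 0 < e.
Let mf : measurable_fun setT f := integrable_measurable intf.

(** The real part of [e^(i x t)] times the Fourier transform of [f] at [t]. Integrated against
    [f x], it gives [specdens f t]. *)
Let D (x t : R) := cosT f t * cos (x * t) + sinT f t * sin (x * t).

Let DE x t : D x t = \int[mu]_y (f y * cos ((x - y) * t)).
Proof.
rewrite /D mulrC [X in _ + X]mulrC -Rintegral_cos_sin//.
by apply: eq_Rintegral => y _; rewrite mulrBl cosB.
Qed.

Let stepA x : \int[mu]_t (expw e t * D x t) = \int[mu]_y (f y * poisson e (x - y)).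
Proof.
pose G (z : RT * RT) := f z.1 * (expw e z.2 * cos ((x - z.1) * z.2)).
have mG : measurable_fun setT G.
  apply: measurable_funM; first exact: measurableT_comp.
  apply: measurable_funM.
    by apply: measurableT_comp => //; exact: measurable_expw.
  apply: measurableT_comp; first exact: measurable_cos.
  by apply: measurable_funM => //; exact: measurable_funB.
have intG : (mu \x mu)%E.-integrable setT (EFin \o G).
  apply: (integrable_prod_le mG intf (integrable_expw e_gt0)) => y t.
  by rewrite /G/= !normrM ler_wpM2l// ler_piMr// cos_max.
have := Rintegral_Fubini intG; rewrite /G/= => H.
transitivity (\int[mu]_y \int[mu]_t (f y * (expw e t * cos ((x - y) * t)))); last first.
  apply: eq_Rintegral => y _; rewrite RintegralZl//.
    by rewrite Rintegral_expw_cos.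
  apply: (integrable_mul_bounded (integrable_expw e_gt0) (measurable_cosM (x - y))) => t.
  exact: cos_max.
rewrite H; apply: eq_Rintegral => t _; rewrite DE -RintegralZl//.
  by apply: eq_Rintegral => y _; rewrite mulrCA.
apply: (integrable_mul_bounded intf (M := 1)) => [|y]; last exact: cos_max.
apply: measurableT_comp; first exact: measurable_cos.
by apply: measurable_funM => //; exact: measurable_funB.
Qed.

Let intw := integrable_expw e_gt0.

(** A damped Plancherel identity. The weight [expw e] makes the integral over both space variables
    and [t] absolutely convergent; integrating in [t] before the space variables turns the cosine of
    [(x - y) t] into the Poisson kernel. *)
Lemma Rintegral_expw_specdens :
  \int[mu]_t (expw e t * specdens f t) =
  \int[mu]_x (f x * \int[mu]_y (f y * poisson e (x - y))).
Proof.
pose M := \int[mu]_x `|f x|.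
pose H (z : RT * RT) := f z.1 * (expw e z.2 * D z.1 z.2).
have mC : measurable_fun setT (fun z : RT * RT => cosT f z.2).
  by apply: measurableT_comp => //; exact: measurable_cosT.
have mS : measurable_fun setT (fun z : RT * RT => sinT f z.2).
  by apply: measurableT_comp => //; exact: measurable_sinT.
have mH : measurable_fun setT H.
  apply: measurable_funM; first exact: measurableT_comp.
  apply: measurable_funM.
    by apply: measurableT_comp => //; exact: measurable_expw.
  by apply: measurable_funD; apply: measurable_funM => //;
    [exact: measurable_cos2|exact: measurable_sin2].
have normD x t : `|D x t| <= 2 * M.
  rewrite mulr_natl mulr2n (le_trans (ler_normD _ _))// lerD// normrM.
    rewrite -[leRHS]mulr1 ler_pM ?cos_max//; exact: normr_cosT.
  rewrite -[leRHS]mulr1 ler_pM ?sin_max//; exact: normr_sinT.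
have intH : (mu \x mu)%E.-integrable setT (EFin \o H).
  apply: (integrable_prod_le mH intf (integrableZlR (2 * M) intw)) => y t.
  rewrite /H/= !normrM ler_wpM2l// mulrC ler_wpM2r//.
  by rewrite (le_trans (normD _ _))// -normrM ler_norm.
have := Rintegral_Fubini intH; rewrite /H/= => E.
transitivity (\int[mu]_x \int[mu]_t (f x * (expw e t * D x t))).
  rewrite E; apply: eq_Rintegral => t _.
  rewrite /specdens !expr2 -Rintegral_cos_sin// -RintegralZl//.
    by apply: eq_Rintegral => x _; rewrite /D; ring.
  apply: (integrable_mul_bounded intf (M := 2 * M)) => [|x]; last exact: normD.
  by apply: measurable_funD; apply: measurable_funM => //;
    [exact: measurable_cosr|exact: measurable_sinr].
apply: eq_Rintegral => x _; rewrite -stepA RintegralZl//.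
apply: (integrable_mul_bounded intw (M := 2 * M)) => [|t]; last exact: normD.
apply: measurable_funD; apply: measurable_funM.
- exact: measurable_cosT.
- exact: measurable_cosM.
- exact: measurable_sinT.
- exact: (measurable_pair1 (x : RT) measurable_sin2).
Qed.

End poisson_pairing.

End cosine_sine_transforms.

Lemma sqr_le_norm {R : realDomainType} (x M : R) : `|x| <= M -> x ^+ 2 <= M ^+ 2.
Proof.
move=> xM; rewrite -(real_normK (num_real x)); apply: lerXn2r => //.
by rewrite nnegrE (le_trans _ xM).
Qed.

(** Fatou's lemma in the form used for the limits below: a uniform bound on the integrals passes to
    the almost everywhere limit, which is also the lower limit. *)
Lemma ge0_integral_lim_le d (T : measurableType d) (R : realType)
    (mu : {measure set T -> \bar R}) (D : set T) (f_ : nat -> T -> \bar R)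
    (f : T -> \bar R) (M : \bar R) : measurable D ->
  (forall n, measurable_fun D (f_ n)) -> (forall n x, D x -> 0 <= f_ n x)%E ->
  measurable_fun D f -> (forall x, D x -> 0 <= f x)%E ->
  {ae mu, forall x, D x -> f_ n x @[n --> \oo] --> f x} ->
  (forall n, \int[mu]_(x in D) f_ n x <= M)%E ->
  (\int[mu]_(x in D) f x <= M)%E.
Proof.
move=> mD mf_ f_0 mf f0 f_f leM.
have mlim : measurable_fun D (fun x => limn_einf (f_ ^~ x)).
  apply: (emeasurable_fun_cvg (fun n x => einfs (f_ ^~ x) n)).
    exact: measurable_fun_einfs.
  by move=> x Dx; rewrite limn_einf_lim; exact: is_cvg_einfs.
have lim0 x : D x -> (0 <= limn_einf (f_ ^~ x))%E.
  move=> Dx; rewrite limn_einf_lim; apply: lime_ge; first exact: is_cvg_einfs.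
  by apply: nearW => n; apply: le_ereal_inf_tmp => _ [m /= _ <-]; exact: f_0.
rewrite (ge0_ae_eq_integral mD mf mlim f0 lim0); last first.
  by apply: filterS f_f => x /= f_fx Dx; rewrite (cvg_limn_einf_sup (f_fx Dx)).
apply: le_trans (fatou mu mD mf_ f_0) _.
rewrite limn_einf_lim; apply: lime_le; first exact: is_cvg_einfs.
apply: nearW => n; apply: le_trans (leM n).
by apply: ereal_inf_lbound; exists n => /=.
Qed.

(** * Upper bound for the spectral integral on the half line *)

Section plancherel_upper.
Context {R : realType}.
Local Notation mu := (@lebesgue_measure R).
Local Notation RT := (measurableTypeR R).

Lemma poisson_le_inv (e z : R) : 0 < e -> poisson e z <= e^-1.
Proof.
move=> e0; have : 0 < e ^+ 2 + z ^+ 2 by rewrite ltr_pwDl ?exprn_gt0// sqr_ge0.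
move=> D0; rewrite /poisson ler_pdivrMr// mulrDr expr2 mulrA mulVf ?lt0r_neq0//.
by rewrite mul1r lerDl mulr_ge0 ?sqr_ge0// invr_ge0 ltW.
Qed.

Lemma normr_poisson (e z : R) : 0 < e -> `|poisson e z| <= e^-1.
Proof. by move=> e0; rewrite ger0_norm ?poisson_ge0// poisson_le_inv. Qed.

Lemma measurable_poissonB (e : R) : 0 < e ->
  measurable_fun setT (fun z : RT * RT => poisson e (z.1 - z.2)).
Proof.
move=> e0; apply: measurableT_comp; first exact: measurable_poisson.
by apply: measurable_funB.
Qed.

(* AM-GM [f x * f y <= (f x ^+ 2 + f y ^+ 2) / 2] under the symmetric kernel. *)
Lemma Rintegral_poisson_pairing_le (f : R -> R) (e : R) : 0 < e ->
  mu.-integrable setT (EFin \o f) ->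
  mu.-integrable setT (EFin \o (fun x => f x ^+ 2)) ->
  \int[mu]_x (f x * \int[mu]_y (f y * poisson e (x - y))) <= pi * \int[mu]_x (f x ^+ 2).
Proof.
move=> e0 intf intf2; have mf := integrable_measurable intf.
have mp := measurable_poissonB e0.
have mf1 : measurable_fun setT (fun z : RT * RT => f z.1) by exact: measurableT_comp.
have mf2 : measurable_fun setT (fun z : RT * RT => f z.2) by exact: measurableT_comp.
pose Phi (z : RT * RT) := f z.1 * (f z.2 * poisson e (z.1 - z.2)).
pose Psi1 (z : RT * RT) := f z.1 ^+ 2 * poisson e (z.1 - z.2).
pose Psi2 (z : RT * RT) := f z.2 ^+ 2 * poisson e (z.1 - z.2).
have intPhi : (mu \x mu)%E.-integrable setT (EFin \o Phi).
  apply: (integrable_prod_le _ intf (integrableZlR e^-1 intf)).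
    by apply: measurable_funM => //; exact: measurable_funM.
  move=> x y; rewrite /Phi/= (normrM (f x)) ler_wpM2l// (normrM (f y)) (normrM e^-1) mulrC.
  rewrite ler_wpM2r//; by rewrite (le_trans (normr_poisson _ _))// ler_norm.
have mPsi1 : measurable_fun setT Psi1.
  by apply: measurable_funM => //; exact: measurable_funX.
have mPsi2 : measurable_fun setT Psi2.
  by apply: measurable_funM => //; exact: measurable_funX.
have I1 : (\int[mu]_x \int[mu]_y (Psi1 (x, y))%:E = (pi * \int[mu]_x (f x ^+ 2))%:E)%E.
  under eq_integral => x _.
    under eq_integral do rewrite /Psi1/= EFinM.
    rewrite ge0_integralZl//; [|by apply/measurable_EFinP; exact: (measurable_pair1 x mp)|
      by move=> y _; rewrite lee_fin poisson_ge0|by rewrite lee_fin sqr_ge0].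
    rewrite integral_poisson//; over.
  rewrite ge0_integralZr//; [|exact/measurable_EFinP/measurable_funX|
    by move=> x _; rewrite lee_fin sqr_ge0|by rewrite lee_fin pi_ge0].
  by rewrite muleC -integrable_EFinE.
have I2 : (\int[mu]_y \int[mu]_x (Psi2 (x, y))%:E = (pi * \int[mu]_x (f x ^+ 2))%:E)%E.
  rewrite -I1; apply: eq_integral => x _; apply: eq_integral => y _.
  by rewrite /Psi1 /Psi2/= -poissonN opprB.
have intPsi1 : (mu \x mu)%E.-integrable setT (EFin \o Psi1).
  apply/integrable12ltyP; first exact/measurable_EFinP.
  rewrite (_ : (\int[mu]_a _)%E = (pi * \int[mu]_x (f x ^+ 2))%:E) ?ltry// -I1.
  apply: eq_integral => a _; apply: eq_integral => b _.
  by rewrite /= ger0_norm// mulr_ge0 ?sqr_ge0 ?poisson_ge0.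
have intPsi2 : (mu \x mu)%E.-integrable setT (EFin \o Psi2).
  apply/integrable21ltyP; first exact/measurable_EFinP.
  rewrite (_ : (\int[mu]_a _)%E = (pi * \int[mu]_x (f x ^+ 2))%:E) ?ltry// -I2.
  apply: eq_integral => a _; apply: eq_integral => b _.
  by rewrite /= ger0_norm// mulr_ge0 ?sqr_ge0 ?poisson_ge0.
have E1 : \int[(mu \x mu)%E]_z Psi1 z = pi * \int[mu]_x (f x ^+ 2).
  by rewrite /Rintegral -integral12_prod_meas1// I1.
have E2 : \int[(mu \x mu)%E]_z Psi2 z = pi * \int[mu]_x (f x ^+ 2).
  by rewrite /Rintegral -integral21_prod_meas1// I2.
have -> : \int[mu]_x (f x * \int[mu]_y (f y * poisson e (x - y))) =
          \int[(mu \x mu)%E]_z Phi z.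
  rewrite -Rintegral12_prod//; apply: eq_Rintegral => x _.
  rewrite /Phi/= RintegralZl//.
  apply: (integrable_mul_bounded intf (measurable_pair1 x mp)) => y.
  exact: normr_poisson.
have -> : pi * \int[mu]_x (f x ^+ 2) =
          \int[(mu \x mu)%E]_z (2^-1 * Psi1 z + 2^-1 * Psi2 z).
  rewrite RintegralD//; try exact: integrableZlR.
  by rewrite !RintegralZl// E1 E2 -mulrDl; field.
apply: le_Rintegral => //; first by apply: integrableDR; exact: integrableZlR.
move=> [x y] _; rewrite /Phi /Psi1 /Psi2/=.
have := poisson_ge0 (x - y) e0; set p := poisson _ _ => p0.
by have := sqr_ge0 (f x - f y); nra.
Qed.

(** One sequence of positive numbers tending to [0] serves as damping parameter, as length of the
    averaging intervals and as step of the difference quotients. *)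
Definition rate (n : nat) : R := n.+1%:R^-1.

Lemma rate_gt0 n : 0 < rate n. Proof. by rewrite invr_gt0. Qed.

Lemma cvg_rate : rate n @[n --> \oo] --> (0 : R).
Proof. exact: cvg_harmonic. Qed.

Lemma cvg_expw_rate (t : R) : 0 < t -> expw (rate n) t @[n --> \oo] --> (1 : R).
Proof.
move=> t0; rewrite /expw t0 -expR0.
apply: continuous_cvg.
  exact: continuous_expR.
rewrite -[X in _ --> X]oppr0 -(mul0r t); apply: cvgN; apply: cvgM.
  exact: cvg_rate.
exact: cvg_cst.
Qed.

Lemma ge0_integral_expw_le (e : R) (h : R -> R) : 0 < e ->
  measurable_fun setT h -> (forall t, 0 <= h t) ->
  (\int[mu]_t (expw e t * h t)%:E <= \int[mu]_(t in `]0%R, +oo[) (h t)%:E)%E.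
Proof.
move=> e0 mh h0; rewrite [leRHS]integral_mkcond; apply: ge0_le_integral => //.
- by move=> t _; rewrite lee_fin mulr_ge0 ?expw_ge0.
- by apply/measurable_EFinP; apply: measurable_funM => //; exact: measurable_expw.
- by apply/(measurable_restrictT _ _).1 => //; exact/measurable_funTS/measurable_EFinP.
- move=> t _; rewrite patchE /expw; case: ifPn => [t0|t0].
    rewrite mem_set/= ?in_itv/= ?t0// lee_fin ler_piMl//.
    by rewrite -expR0 ler_expR oppr_le0 mulr_ge0// ltW.
  by rewrite mul0r; case: ifP => // _; rewrite lee_fin.
Qed.

(** The weights [expw (rate n)] tend pointwise to the indicator of []0, +oo[], so a bound uniform in
    the damping survives its removal by Fatou. *)
Lemma ge0_integral_le_expw (h : R -> R) (M : \bar R) :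
  measurable_fun setT h -> (forall t, 0 <= h t) ->
  (forall n, (\int[mu]_t (expw (rate n) t * h t)%:E <= M)%E) ->
  (\int[mu]_(t in `]0%R, +oo[) (h t)%:E <= M)%E.
Proof.
move=> mh h0 hM.
rewrite integral_mkcond.
apply: (@ge0_integral_lim_le _ _ _ mu setT (fun n t => (expw (rate n) t * h t)%:E)) => //.
- move=> n; apply/measurable_EFinP; apply: measurable_funM => //.
  exact: measurable_expw.
- by move=> n t _; rewrite lee_fin mulr_ge0 ?expw_ge0.
- by apply/(measurable_restrictT _ _).1 => //; exact/measurable_funTS/measurable_EFinP.
- by move=> t _; rewrite erestrict_ge0// => ? _; rewrite lee_fin.
- apply: nearW => t _; apply: (@cvg_trans _ ((expw (rate n) t * h t)%:E @[n --> \oo])) => //.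
  rewrite patchE; case: ifPn.
    rewrite inE/= in_itv/= andbT => t0; apply: cvg_EFin; first exact: nearW.
    rewrite -[X in _ --> X]mul1r; apply: cvgM; last exact: cvg_cst.
    exact: cvg_expw_rate.
  move=> /negP t0; rewrite (_ : (fun n => _) = cst 0%E); first exact: cvg_cst.
  apply/funext => n; rewrite /expw ifF ?mul0r//.
  by apply/negP => t1; apply: t0; rewrite inE/= in_itv/= t1.
Qed.

Lemma integrable_expw_mul (e : R) (h : R -> R) (M : R) : 0 < e ->
  measurable_fun setT h -> (forall t, `|h t| <= M) ->
  mu.-integrable setT (EFin \o (fun t => expw e t * h t)).
Proof. by move=> e0 mh hM; apply: (integrable_mul_bounded (integrable_expw e0) mh hM). Qed.

Lemma specdens_le (f : R -> R) t : mu.-integrable setT (EFin \o f) ->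
  `|specdens f t| <= 2 * (\int[mu]_x `|f x|) ^+ 2.
Proof.
move=> intf; rewrite ger0_norm ?specdens_ge0// mulr_natl mulr2n lerD//.
  exact: sqr_le_norm (normr_cosT t intf).
exact: sqr_le_norm (normr_sinT t intf).
Qed.

(** The bound on the Poisson pairing does not depend on [e], so the damping can be removed. *)
Lemma integral_specdens_le (f : R -> R) :
  mu.-integrable setT (EFin \o f) ->
  mu.-integrable setT (EFin \o (fun x => f x ^+ 2)) ->
  (\int[mu]_(t in `]0%R, +oo[) (specdens f t)%:E <= pi%:E * \int[mu]_x (f x ^+ 2)%:E)%E.
Proof.
move=> intf intf2; have mf := integrable_measurable intf.
rewrite -integrable_EFinE//.
apply: ge0_integral_le_expw => [|t|n].
- exact: measurable_specdens.
- exact: specdens_ge0.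
- rewrite -EFinM -integrable_EFinE.
    rewrite lee_fin Rintegral_expw_specdens ?rate_gt0//.
    by apply: Rintegral_poisson_pairing_le; rewrite ?rate_gt0.
  apply: (@integrable_expw_mul _ _ (2 * (\int[mu]_x `|f x|) ^+ 2) (rate_gt0 n)).
    exact: measurable_specdens.
  by move=> t; exact: specdens_le.
Qed.

End plancherel_upper.

(** * Lower bound for bounded continuous functions *)

Section plancherel_continuous.
Context {R : realType}.
Local Notation mu := (@lebesgue_measure R).
Local Notation RT := (measurableTypeR R).
Variables (g : R -> R) (M : R).
Hypothesis intg : mu.-integrable setT (EFin \o g).
Hypothesis contg : continuous g.
Hypothesis gM : forall x, `|g x| <= M.

Let p1 : R -> R := poisson 1.

Let mg : measurable_fun setT g := integrable_measurable intg.

Let intp1 : mu.-integrable setT (EFin \o p1).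
Proof.
apply: integrable_ge0.
- exact: measurable_poisson.
- by move=> z; exact: poisson_ge0.
- by rewrite integral_poisson1 ltry.
Qed.

Let Rintegral_p1 : \int[mu]_z p1 z = pi.
Proof. by rewrite /Rintegral integral_poisson1. Qed.

(** The convolution of [g] with the Poisson kernel of width [rate n], after the substitution
    [y = rate n * z + x]. The small parameter now sits inside [g]: continuity gives the pointwise
    limit, and [M * p1] dominates for all [n]. *)
Let smooth (n : nat) (x : R) : R := \int[mu]_z (p1 z * g (rate n * z + x)).

Let mgn n x : measurable_fun setT (fun z : RT => g (rate n * z + x)).
Proof. by apply: measurableT_comp => //; exact: measurable_affine. Qed.

Let smoothE n x : smooth n x = \int[mu]_y (g y * poisson (rate n) (x - y)).
Proof.
have r0 : 0 < rate n :> R := rate_gt0 n.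
have inth : mu.-integrable setT (EFin \o (fun y : RT => g y * poisson (rate n) (x - y))).
  apply: (integrable_mul_bounded intg (M := (rate n)^-1)) => [|y].
    exact: (measurable_pair1 (x : RT) (measurable_poissonB r0)).
  exact: normr_poisson.
have ri0 : 0 < (rate n : R)^-1 by rewrite invr_gt0.
have := @Rintegral_comp _ RT R mu _ _ (measurable_affine (rate n) x) ri0
  (fun A => @lebesgue_measure_affine _ (rate n) x A r0) _ inth.
move=> /(congr1 (fun y => rate n * y)).
rewrite mulrA divff ?lt0r_neq0// mul1r => <-.
rewrite -RintegralZl//.
  apply: eq_Rintegral => z _ /=.
  rewrite opprD addrA addrAC addrN sub0r poissonN poisson_scale// /p1.
  by rewrite mulrCA (mulrA (rate n)) divff ?lt0r_neq0// mul1r mulrC.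
exact: (@integrable_comp _ RT R mu _ _ (measurable_affine (rate n) x) ri0
  (fun A => @lebesgue_measure_affine _ (rate n) x A r0) _ inth).
Qed.

Let M0 : 0 <= M. Proof. exact: le_trans (normr_ge0 _) (gM 0). Qed.

Let cvg_smooth x : smooth n x @[n --> \oo] --> pi * g x.
Proof.
rewrite -Rintegral_p1 -RintegralZr//.
apply: (@cvg_Rintegral _ _ _ mu _ _ (fun z => M * p1 z)).
- by move=> n; apply: measurable_funM => //; exact: measurable_poisson.
- move=> z; apply: cvgM; first exact: cvg_cst.
  apply: continuous_cvg; first exact: contg.
  rewrite -[X in _ --> X]add0r -(mul0r z); apply: cvgD; last exact: cvg_cst.
  by apply: cvgM; [exact: cvg_rate|exact: cvg_cst].
- exact: integrableZlR.
- move=> n z; rewrite normrM mulrC (ger0_norm (poisson_ge0 _ _))//.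
  by rewrite ler_wpM2r// poisson_ge0.
Qed.

Let norm_smooth n x : `|smooth n x| <= M * pi.
Proof.
have int1 : mu.-integrable setT (EFin \o (fun z => p1 z * g (rate n * z + x))).
  by apply: (integrable_mul_bounded intp1 (mgn n x)) => z; exact: gM.
apply: le_trans (le_normr_Rintegral measurableT int1) _.
rewrite -Rintegral_p1 -RintegralZl//; apply: le_Rintegral => //.
- exact: (integrable_norm int1).
- exact: integrableZlR.
- move=> z _; rewrite normrM mulrC (ger0_norm (poisson_ge0 _ _))//.
  by rewrite ler_wpM2r// poisson_ge0.
Qed.

Let measurable_smooth n : measurable_fun setT (smooth n).
Proof.
apply: (@measurable_Rintegral1 _ _ RT RT R mu (fun u => p1 u.2 * g (rate n * u.2 + u.1))).
apply: measurable_funM.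
  by apply: measurableT_comp => //; exact: measurable_poisson.
apply: measurableT_comp => //; apply: measurable_funD => //.
by apply: measurable_funM.
Qed.

(** The damped integrals are at most the undamped one, and through the pairing with [smooth n] they
    converge to [pi] times the integral of [g^2]. *)
Lemma integral_specdens_ge_continuous :
  (pi%:E * \int[mu]_x (g x ^+ 2)%:E <= \int[mu]_(t in `]0%R, +oo[) (specdens g t)%:E)%E.
Proof.
have intg2 : mu.-integrable setT (EFin \o (fun x => g x ^+ 2)).
  by under eq_fun do rewrite expr2; exact: (integrable_mul_bounded intg mg gM).
have cvgJ : \int[mu]_x (g x * smooth n x) @[n --> \oo] --> \int[mu]_x (g x * (pi * g x)).
  apply: (@cvg_Rintegral _ _ _ mu _ _ (fun x => M * pi * `|g x|)).
  - by move=> n; apply: measurable_funM => //; exact: measurable_smooth.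
  - by move=> x; apply: cvgM; [exact: cvg_cst|exact: cvg_smooth].
  - exact: (integrableZlR (M * pi) (integrable_norm intg)).
  - by move=> n x; rewrite normrM mulrC ler_wpM2r.
rewrite -integrable_EFinE// -EFinM -RintegralZl//.
have -> : \int[mu]_x (pi * g x ^+ 2) = \int[mu]_x (g x * (pi * g x)).
  by apply: eq_Rintegral => x _; ring.
have cvgJE : (\int[mu]_x (g x * smooth n x))%:E @[n --> \oo] -->
    (\int[mu]_x (g x * (pi * g x)))%:E.
  by apply: cvg_EFin; [exact: nearW|exact: cvgJ].
rewrite -(cvg_lim _ cvgJE)//.
apply: lime_le; first by apply/cvg_ex; eexists; exact: cvgJE.
apply: nearW => n /=.
have -> : \int[mu]_x (g x * smooth n x) = \int[mu]_t (expw (rate n) t * specdens g t).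
  rewrite Rintegral_expw_specdens ?rate_gt0//.
  by apply: eq_Rintegral => x _; rewrite smoothE.
rewrite integrable_EFinE.
  apply: ge0_integral_expw_le; first exact: rate_gt0.
    exact: measurable_specdens.
  exact: specdens_ge0.
apply: (@integrable_expw_mul _ _ _ (2 * (\int[mu]_x `|g x|) ^+ 2) (rate_gt0 n)).
  exact: measurable_specdens.
by move=> t; exact: specdens_le.
Qed.

End plancherel_continuous.

(** * Averages over short intervals *)

Section box_average.
Context {R : realType}.
Local Notation mu := (@lebesgue_measure R).
Local Notation RT := (measurableTypeR R).
Variable f : R -> R.
Hypothesis intf : mu.-integrable setT (EFin \o f).
Let mf : measurable_fun setT f := integrable_measurable intf.

(** A primitive of [f]. Averages of [f] are its difference quotients, which gives their continuity
    and, by Lebesgue differentiation, their limit. *)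
Definition cumul (x : R) : R := \int[mu]_(t in `]-oo, x]) f t.

(** Near [x] the primitive is a constant plus an integral from the finite base point [x - 1], and
    the latter is continuous in its upper end. *)
Lemma continuous_cumul : continuous cumul.
Proof.
move=> x.
have lt11 : x - 1 < x + 1 by rewrite ltrBlDr -addrA ltrDl.
have intS A : measurable A -> mu.-integrable A (EFin \o f).
  by move=> mA; apply: integrableS intf.
have := parameterized_integral_continuous (ltW lt11) (intS _ (measurable_itv `[x - 1, x + 1])).
move=> /(continuous_within_itvP _ lt11)[+ _ _].
have xin : x \in `]x - 1, x + 1[ by rewrite in_itv/= ltrBlDr ltrDl ltr01.
move=> /(_ x xin) cx.
have E (y : R) : x - 1 < y ->
    cumul y = cumul (x - 1) + parameterized_integral mu (x - 1) y f.
  move=> xy; rewrite /parameterized_integral -Rintegral_itv_obnd_cbnd; last exact: intS.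
  rewrite -(@Rintegral_itvB _ f -oo%O (BRight y) (x - 1)).
  - by rewrite addrC subrK.
  - exact: intS.
  - by [].
  - by rewrite bnd_simp ltW.
have Ex := E x; rewrite ltrBlDr ltrDl ltr01 in Ex.
rewrite /continuous_at Ex//.
have : cumul (x - 1) + parameterized_integral mu (x - 1) y f @[y --> x] -->
   cumul (x - 1) + parameterized_integral mu (x - 1) x f.
  by apply: cvgD; [exact: cvg_cst|exact: cx].
apply: cvg_trans; apply: near_eq_cvg; near=> y; rewrite -E//.
near: y; apply: lt_nbhsr; rewrite ltrBlDr ltrDl//.
Unshelve. all: by end_near. Qed.

(** The averaging window as a function of both variables, so that Fubini can exchange the window
    []x, x + h]] in [y] for the window [[y - h, y[] in [x]. *)
Definition box (h : R) (x y : R) : R := \1_(`]0, h]) (y - x).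

Lemma box_ge0 h x y : 0 <= box h x y.
Proof. by rewrite /box indicE. Qed.

Lemma normr_box_le1 h x y : `|box h x y| <= 1.
Proof. by rewrite /box indicE; case: (_ \in _); rewrite ?normr1 ?normr0. Qed.

Lemma measurable_box h : measurable_fun setT (fun z : RT * RT => box h z.1 z.2).
Proof.
apply: (@measurableT_comp _ _ _ _ _ _ (\1_(`]0, h]) : R -> R)).
  exact: measurable_indic.
by apply: measurable_funB.
Qed.

Lemma boxE1 h x (k : R -> R) : (fun y => k y * box h x y) = k \_ `]x, x + h].
Proof.
apply/funext => y; rewrite /box indicE patchE.
have -> : (y - x \in `]0, h]%classic) = (y \in `]x, x + h]%classic).
  by apply/idP/idP; rewrite !inE/= !in_itv/= subr_gt0 lerBlDl.
by case: (_ \in _); rewrite ?mulr1 ?mulr0.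
Qed.

Lemma boxE2 h y (k : R -> R) : (fun x => box h x y * k x) = k \_ `[y - h, y[.
Proof.
apply/funext => x; rewrite /box indicE patchE.
have -> : (y - x \in `]0, h]%classic) = (x \in `[y - h, y[%classic).
  by apply/idP/idP; rewrite !inE/= !in_itv/= subr_gt0 lerBlDl lerBlDr andbC addrC.
by case: (_ \in _); rewrite ?mul1r ?mul0r.
Qed.

Definition boxavg (h x : R) : R := h^-1 * \int[mu]_y (f y * box h x y).

Lemma boxavgE h x : 0 < h -> boxavg h x = h^-1 * (cumul (x + h) - cumul x).
Proof.
move=> h0; rewrite /boxavg boxE1 -Rintegral_mkcond /cumul.
rewrite (@Rintegral_itvB _ f -oo%O (BRight (x + h)) x)//.
- by apply: integrableS intf.
- by rewrite bnd_simp lerDl ltW.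
Qed.

Lemma continuous_boxavg h : 0 < h -> continuous (boxavg h).
Proof.
move=> h0; rewrite (_ : boxavg h = fun x => h^-1 * (cumul (x + h) - cumul x)).
  move=> x; apply: cvgM; first exact: cvg_cst.
  apply: cvgB; last exact: continuous_cumul.
  apply: (@continuous_comp _ _ _ (fun x => x + h) cumul); last exact: continuous_cumul.
  by apply: cvgD; [exact: cvg_id|exact: cvg_cst].
by apply/funext => x; rewrite boxavgE.
Qed.

Let intfbox h x : mu.-integrable setT (EFin \o (fun y => f y * box h x y)).
Proof.
apply: (integrable_mul_bounded intf (M := 1)) => [|y]; last exact: normr_box_le1.
exact: (measurable_pair1 (x : RT) (measurable_box h)).
Qed.

Lemma normr_boxavg h x : 0 < h -> `|boxavg h x| <= h^-1 * \int[mu]_y `|f y|.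
Proof.
move=> h0; have hi0 : 0 < h^-1 by rewrite invr_gt0.
rewrite normrM (gtr0_norm hi0) ler_pM2l//.
apply: le_trans (le_normr_Rintegral measurableT (intfbox h x)) _.
apply: le_Rintegral => //; first exact: (integrable_norm (intfbox h x)).
  exact: (integrable_norm intf).
by move=> y _; rewrite normrM ler_piMr// normr_box_le1.
Qed.

Lemma integral_box h y : 0 < h -> (\int[mu]_x (box h x y)%:E = h%:E)%E.
Proof.
move=> h0; have := boxE2 h y (cst 1).
rewrite (_ : (fun x => box h x y * _) = (fun x => box h x y)); last first.
  by apply/funext => x; rewrite mulr1.
move=> /(congr1 (fun k => \int[mu]_x (k x)%:E)%E) ->.
transitivity (\int[mu]_(x in `[(y - h)%R, y[) (cst 1 x)%:E)%E.
  by rewrite [RHS]integral_mkcond; apply: eq_integral => x _; rewrite restrict_EFin.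
rewrite (integral_cst mu (measurable_itv _) 1%:E) mul1e.
apply: etrans (lebesgue_measure_itv _) _; rewrite /= lte_fin.
by rewrite ltrBlDr ltrDl h0 -EFinD opprB addrC subrK.
Qed.

(** Integrate in [x] first: the window has length [h], which leaves [h * |f y|]. *)
Lemma integrable_box2 h (c : R -> R) : 0 < h -> measurable_fun setT c ->
  (forall x, `|c x| <= 1) ->
  (mu \x mu)%E.-integrable setT (EFin \o (fun z : RT * RT => f z.2 * (box h z.1 z.2 * c z.1))).
Proof.
move=> h0 mc c1; have mb := measurable_box h.
have mff : measurable_fun setT (fun z : RT * RT => f z.2) by exact: measurableT_comp.
have mcc : measurable_fun setT (fun z : RT * RT => c z.1) by exact: measurableT_comp.
have int1 : (mu \x mu)%E.-integrable setT (EFin \o (fun z : RT * RT => `|f z.2| * box h z.1 z.2)).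
  have m1 : measurable_fun setT (fun z : RT * RT => `|f z.2| * box h z.1 z.2).
    by apply: measurable_funM => //; exact: measurableT_comp.
  apply/integrable21ltyP; first exact/measurable_EFinP.
  apply: (@le_lt_trans _ _ (\int[mu]_y (h%:E * `|f y|%:E))%E); last first.
    rewrite ge0_integralZl//; last by rewrite lee_fin ltW.
      by rewrite lte_mul_pinfty ?lee_fin ?ltW// integrable_norm_lty.
    by apply/measurable_EFinP; exact: measurableT_comp.
  rewrite le_eqVlt; apply/orP; left; apply/eqP; apply: eq_integral => y _.
  rewrite -(integral_box y h0) muleC -ge0_integralZl//.
  - apply: eq_integral => x _ /=.
    by rewrite normrM normr_id (ger0_norm (box_ge0 _ _ _)) EFinM.
  - by apply/measurable_EFinP; exact: (measurable_pair2 (y : RT) mb).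
  - by move=> x _; rewrite lee_fin box_ge0.
apply: le_integrableR int1.
  by apply: measurable_funM => //; exact: measurable_funM.
move=> [x y] /=; rewrite !normrM ler_wpM2l// (ger0_norm (box_ge0 _ _ _)).
by rewrite ler_piMr// box_ge0.
Qed.

Lemma integrable_boxavg h : 0 < h -> mu.-integrable setT (EFin \o boxavg h).
Proof.
move=> h0; apply: integrableZlR.
have c1 (x : R) : `|cst 1 x : R| <= 1 by rewrite normr1.
have := integrable_Rintegral1 (integrable_box2 h0 (measurable_cst (1 : R)) c1).
by under eq_fun do under eq_Rintegral do rewrite /= mulr1.
Qed.

(** Fubini moves the average from [f] to [c]. For [c] a cosine or a sine the inner integral is then
    explicit. *)
Lemma Rintegral_boxavg h (c : R -> R) : 0 < h -> measurable_fun setT c ->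
  (forall x, `|c x| <= 1) ->
  \int[mu]_x (boxavg h x * c x) =
  h^-1 * \int[mu]_y (f y * \int[mu]_(x in `[y - h, y[) c x).
Proof.
move=> h0 mc c1; have int2 := integrable_box2 h0 mc c1.
have intbc y : mu.-integrable setT (EFin \o (fun x => box h x y * c x)).
  rewrite boxE2 -restrict_EFin.
  apply/(integrable_mkcond _ _).1 => //.
  apply: (@measurable_bounded_integrable _ RT) => //.
  - apply: le_lt_trans (_ : (_ <= (lebesgue_measure `[(y - h)%R, y[))%E) _ => //.
    by rewrite lebesgue_measure_itv/=; case: ifPn; rewrite ?ltry// -EFinD ltry.
  - exact: measurable_funTS.
  - by exists 1; split => // M M1 x _ /=; exact: le_trans (c1 x) (ltW M1).
transitivity (h^-1 * \int[mu]_x \int[mu]_y (f y * (box h x y * c x))).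
  rewrite -RintegralZl//; last exact: (integrable_Rintegral1 int2).
  apply: eq_Rintegral => x _; rewrite /boxavg -mulrA; congr *%R.
  by rewrite -RintegralZr//; apply: eq_Rintegral => y _; rewrite mulrA.
rewrite (Rintegral_Fubini int2); congr *%R; apply: eq_Rintegral => y _ /=.
by rewrite RintegralZl// boxE2 -Rintegral_mkcond.
Qed.

End box_average.

(** * Lower bound for integrable functions by averaging *)

Section plancherel_line.
Context {R : realType}.
Local Notation mu := (@lebesgue_measure R).
Local Notation RT := (measurableTypeR R).

Lemma sin_sqr_le (u : R) : 0 < u -> sin u ^+ 2 <= u ^+ 2.
Proof.
move=> u0; apply: sqr_le_norm.
have cs : {within `[0, u], continuous (@sin R)}.
  by apply: continuous_subspaceT => x; exact: continuous_sin.
have [c _] := MVT u0 (fun x _ => is_derive_sin x) cs.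
by rewrite sin0 !subr0 => ->; rewrite normrM (gtr0_norm u0) ler_piMl ?cos_max// ltW.
Qed.

(** By the half-angle formula the left-hand side is [4 sin^2 (v / 2)]. *)
Lemma two_sub_cos_le (v : R) : 0 < v -> 2 - 2 * cos v <= v ^+ 2.
Proof.
move=> v0; have v20 : 0 < v / 2 by rewrite divr_gt0.
have := sin_sqr_le v20; rewrite sin2cos2.
have -> : cos v = cos (v / 2) ^+ 2 *+ 2 - 1.
  by rewrite -cos_mulr2n; congr cos; rewrite mulr2n -splitr.
by rewrite expr_div_n; set c := cos _; lra.
Qed.

Lemma Rintegral_bo_FTC2 (k K : R -> R) (a b : R) : a < b -> continuous k ->
  (forall x : R, is_derive x (1 : R) K (k x)) ->
  \int[mu]_(x in `[a, b[) k x = K b - K a.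
Proof.
move=> ab ck dK.
have cK : continuous K.
  move=> x; apply/differentiable_continuous/derivable1_diffP.
  by have [] := dK x.
have ckW : {within `[a, b], continuous k} by exact: continuous_subspaceT.
rewrite Rintegral_itv_bndo_bndc; last first.
  apply: (@integrableS _ RT R mu `[a, b]) => //; first exact: subset_itv_co_cc.
  by apply: continuous_compact_integrable; [exact: segment_compact|].
rewrite /Rintegral (@continuous_FTC2 _ k K)//.
- split; first by move=> x _; have [] := dK x.
    by apply: cvg_at_right_filter; exact: cK.
  by apply: cvg_at_left_filter; exact: cK.
- by move=> x _; rewrite derive1E; have [_ ->] := dK x.
Qed.

Let is_derive_Mr (c x : R) : is_derive x (1 : R) (fun x : R => x * c) c.
Proof.
have := is_deriveM (is_derive_id x (1:R)) (is_derive_cst c x (1:R)).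
by move=> /is_derive_eq; apply; rewrite /GRing.scale/= mulr0 add0r mulr1.
Qed.

Lemma Rintegral_cos_itv (a b t : R) : a < b -> 0 < t ->
  \int[mu]_(x in `[a, b[) cos (x * t) = (sin (b * t) - sin (a * t)) / t.
Proof.
move=> ab t0; rewrite mulrBl.
have ck : continuous (fun x : R => cos (x * t)).
  move=> x; apply: (@continuous_comp _ _ _ (fun x : R => x * t) (@cos R));
    last exact: continuous_cos.
  by apply: cvgM; [exact: cvg_id|exact: cvg_cst].
apply: (@Rintegral_bo_FTC2 (fun x => cos (x * t)) (fun x => sin (x * t) * t^-1)) => // x.
have d1 : is_derive x (1 : R) (fun x : R => sin (x * t)) (cos (x * t) * t).
  exact: is_derive1_comp (is_derive_sin _) (is_derive_Mr t x).
have := is_deriveM d1 (is_derive_cst t^-1 x (1:R)).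
move=> /is_derive_eq; apply; rewrite /GRing.scale/= mulr0 add0r.
by rewrite /cst mulrCA mulVf ?lt0r_neq0// mulr1.
Qed.

Lemma Rintegral_sin_itv (a b t : R) : a < b -> 0 < t ->
  \int[mu]_(x in `[a, b[) sin (x * t) = (cos (a * t) - cos (b * t)) / t.
Proof.
move=> ab t0; have -> : (cos (a * t) - cos (b * t)) / t =
    cos (b * t) * (- t^-1) - cos (a * t) * (- t^-1) by ring.
have ck : continuous (fun x : R => sin (x * t)).
  move=> x; apply: (@continuous_comp _ _ _ (fun x : R => x * t) (@sin R));
    last exact: continuous_sin.
  by apply: cvgM; [exact: cvg_id|exact: cvg_cst].
apply: (@Rintegral_bo_FTC2 (fun x => sin (x * t)) (fun x => cos (x * t) * - t^-1)) => // x.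
have d1 : is_derive x (1 : R) (fun x : R => cos (x * t)) (- sin (x * t) * t).
  exact: is_derive1_comp (is_derive_cos _) (is_derive_Mr t x).
have := is_deriveM d1 (is_derive_cst (- t^-1) x (1:R)).
move=> /is_derive_eq; apply; rewrite /GRing.scale/= mulr0 add0r.
by rewrite /cst; field; rewrite lt0r_neq0.
Qed.

Section boxavg.
Variable f : R -> R.
Hypothesis intf : mu.-integrable setT (EFin \o f).
Let mf : measurable_fun setT f := integrable_measurable intf.

(* Averaging over translations by 0 < s <= h multiplies the Fourier transform
   by a number of modulus [|sin (h t / 2) / (h t / 2)| <= 1]. *)
Lemma specdens_boxavg_le h t : 0 < h -> 0 < t ->
  specdens (boxavg f h) t <= specdens f t.
Proof.
move=> h0 t0.
(* Over the window [[y - h, y[], the integral of [cos (x t)] is [a cos (y t) + b sin (y t)] and that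
   of [sin (x t)] is [a sin (y t) - b cos (y t)]. *)
pose a := sin (h * t) / t; pose b := (1 - cos (h * t)) / t.
have cE : cosT (boxavg f h) t = h^-1 * (a * cosT f t + b * sinT f t).
  rewrite /cosT Rintegral_boxavg//; [|exact: measurable_cosr|by move=> x; exact: cos_max].
  rewrite -Rintegral_cos_sin//; congr *%R; apply: eq_Rintegral => y _; congr *%R.
  rewrite Rintegral_cos_itv// ?ltrBlDr ?ltrDl// (mulrBl t y h) sinB /a /b; field.
  by rewrite lt0r_neq0.
have sE : sinT (boxavg f h) t = h^-1 * (- b * cosT f t + a * sinT f t).
  rewrite /sinT Rintegral_boxavg//; [|exact: measurable_sinr|by move=> x; exact: sin_max].
  rewrite -Rintegral_cos_sin//; congr *%R; apply: eq_Rintegral => y _; congr *%R.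
  rewrite Rintegral_sin_itv// ?ltrBlDr ?ltrDl// (mulrBl t y h) cosB /a /b; field.
  by rewrite lt0r_neq0.
rewrite {1}/specdens cE sE.
have -> : (h^-1 * (a * cosT f t + b * sinT f t)) ^+ 2 +
    (h^-1 * (- b * cosT f t + a * sinT f t)) ^+ 2 =
    (a ^+ 2 + b ^+ 2) / h ^+ 2 * specdens f t.
  by rewrite /specdens; field; rewrite lt0r_neq0.
rewrite ler_piMl ?specdens_ge0// ler_pdivrMr ?exprn_gt0// mul1r.
have -> : a ^+ 2 + b ^+ 2 = (2 - 2 * cos (h * t)) / t ^+ 2.
  rewrite /a /b !expr_div_n -mulrDl sin2cos2; congr (_ / _); ring.
rewrite ler_pdivrMr ?exprn_gt0// -exprMn.
by apply: two_sub_cos_le; rewrite mulr_gt0.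
Qed.

(** Lebesgue differentiation of [cumul f], read along the nonzero steps [rate n]. *)
Lemma ae_cvg_boxavg : {ae mu, forall x, boxavg f (rate n) x @[n --> \oo] --> f x}.
Proof.
have intfy y : mu.-integrable `]-oo, y] (EFin \o f) by apply: integrableS intf.
have := FTC1Ny intfy (open_integrable_locally openT intf).
apply: filterS; first exact: (ae_filter_ringOfSetsType mu).
move=> x [] /= dF; rewrite derive1E => F'x.
have /cvgr_dnbhsP : (fun e => e^-1 *: (cumul f (e + x) - cumul f x)) h @[h --> 0^'] --> f x.
  rewrite -F'x; have := dF; rewrite /derivable /derive.
  move=> /cvg_ex[l cl].
  have -> : (lim (h^-1 *: ((fun x0 : R => \int[mu]_(t in `]-oo, x0]) f t) (h *: (1:R) + x) -
     \int[mu]_(t in `]-oo, x]) f t) @[h --> 0^'])) = l.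
    by apply/cvg_lim => //; exact: cl.
  by move: cl; under eq_fun do rewrite [_ *: 1]mulr1.
move=> /(_ (fun n => rate n)) H.
have : (rate n)^-1 *: (cumul f (rate n + x) - cumul f x) @[n --> \oo] --> f x.
  by apply: H; split; [move=> n; rewrite lt0r_neq0// rate_gt0|exact: cvg_rate].
apply: cvg_trans; apply: near_eq_cvg; apply: nearW => n.
by rewrite boxavgE ?rate_gt0// [x + _]addrC.
Qed.

(** Each average is continuous, bounded and integrable, so the previous lower bound applies to it,
    and its spectral density is at most that of [f]. Only the square integral of the averages has to
    pass to the limit, which Fatou does in the required direction. *)
Lemma integral_specdens_ge :
  (pi%:E * \int[mu]_x (f x ^+ 2)%:E <= \int[mu]_(t in `]0%R, +oo[) (specdens f t)%:E)%E.
Proof.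
rewrite -ge0_integralZl//; last 3 first.
- by apply/measurable_EFinP; exact: measurable_funX.
- by move=> x _; rewrite lee_fin sqr_ge0.
- by rewrite lee_fin pi_ge0.
have mE (k : R -> R) : measurable_fun setT k ->
    measurable_fun setT (fun x : RT => pi%:E * (k x ^+ 2)%:E)%E.
  move=> mk; under eq_fun do rewrite -EFinM.
  by apply/measurable_EFinP; apply: measurable_funM => //; exact: measurable_funX.
have mbox n : measurable_fun setT (boxavg f (rate n)).
  by apply: continuous_measurable_fun; apply: continuous_boxavg => //; exact: rate_gt0.
apply: (@ge0_integral_lim_le _ _ _ mu setT
  (fun n x => pi%:E * (boxavg f (rate n) x ^+ 2)%:E)%E) => //.
- by move=> n; exact: mE.
- by move=> n x _; rewrite -EFinM lee_fin mulr_ge0 ?pi_ge0 ?sqr_ge0.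
- exact: mE.
- by move=> x _; rewrite -EFinM lee_fin mulr_ge0 ?pi_ge0 ?sqr_ge0.
- have := ae_cvg_boxavg; apply: filterS.
    exact: (ae_filter_ringOfSetsType mu).
  move=> x /= cx _.
  apply: cvg_EFin; first exact: nearW.
  apply: cvgM; first exact: cvg_cst.
  by rewrite expr2; under eq_fun do rewrite expr2; exact: cvgM.
- move=> n; have r0 : 0 < rate n :> R := rate_gt0 n.
  rewrite ge0_integralZl//; last 3 first.
  + by apply/measurable_EFinP; apply: measurable_funX; exact: mbox.
  + by move=> x _; rewrite lee_fin sqr_ge0.
  + by rewrite lee_fin pi_ge0.
  have := integral_specdens_ge_continuous (integrable_boxavg intf r0)
    (continuous_boxavg intf r0) (fun x => normr_boxavg intf x r0).
  move=> /le_trans; apply; apply: ge0_le_integral => //.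
  + by move=> t _; rewrite lee_fin specdens_ge0.
  + by apply/measurable_EFinP/measurable_funTS; exact: measurable_specdens.
  + by apply/measurable_EFinP/measurable_funTS; exact: measurable_specdens.
  + move=> t /=; rewrite in_itv/= andbT => t0.
    by rewrite lee_fin specdens_boxavg_le.
Qed.

Lemma plancherel_half_line : mu.-integrable setT (EFin \o (fun x => f x ^+ 2)) ->
  (\int[mu]_(t in `]0%R, +oo[) (specdens f t)%:E = pi%:E * \int[mu]_x (f x ^+ 2)%:E)%E.
Proof.
move=> intf2; apply/eqP; rewrite eq_le integral_specdens_le//=.
exact: integral_specdens_ge.
Qed.

End boxavg.

End plancherel_line.

(** * Plancherel for complex functions on the line *)

Section plancherel_line_pair.
Context {R : realType}.
Local Notation mu := (@lebesgue_measure R).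
Local Notation RT := (measurableTypeR R).
Implicit Types a b : R -> R.

(* [osc mu theta a b] is the real part of the integral of
   [e^(- i theta) (a + i b)]; its imaginary part is [osc mu theta b (- a)]. *)
Definition osc d (T : measurableType d) (mu : {measure set T -> \bar R})
  (theta a b : T -> R) : R := \int[mu]_x (a x * cos (theta x) + b x * sin (theta x)).

Lemma osc_lineE a b t : mu.-integrable setT (EFin \o a) ->
  mu.-integrable setT (EFin \o b) ->
  osc mu (fun x : R => x * t) a b = cosT a t + sinT b t.
Proof.
by move=> inta intb; rewrite /osc RintegralD//; [exact: integrable_fcos|exact: integrable_fsin].
Qed.

Lemma cosTN a t : cosT a (- t) = cosT a t.
Proof. by apply: eq_Rintegral => x _; rewrite mulrN cosN. Qed.

Lemma sinTN a t : mu.-integrable setT (EFin \o a) -> sinT a (- t) = - sinT a t.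
Proof.
move=> inta; rewrite -[RHS]mulN1r -RintegralZl//; last exact: integrable_fsin.
by apply: eq_Rintegral => x _; rewrite mulrN sinN mulrN mulN1r.
Qed.

Lemma sinT_opp a t : mu.-integrable setT (EFin \o a) -> sinT (\- a) t = - sinT a t.
Proof.
move=> inta; rewrite -[RHS]mulN1r -RintegralZl//; last exact: integrable_fsin.
by apply: eq_Rintegral => x _; rewrite mulNr mulN1r.
Qed.

Lemma ge0_integral_line_even (h : R -> R) : measurable_fun setT h ->
  (forall t, 0 <= h t) ->
  (\int[mu]_t (h t)%:E = \int[mu]_(t in `]0%R, +oo[) (h t + h (- t))%:E)%E.
Proof.
move=> mh h0.
have mEh (D : set RT) : measurable_fun D (fun t => (h t)%:E).
  by apply/measurable_EFinP; exact: measurable_funTS.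
have mhN : measurable_fun setT (fun t : R => h (- t)).
  by apply: measurableT_comp => //; apply: continuous_measurable_fun; exact: opp_continuous.
have mEhN (D : set RT) : measurable_fun D (fun t : R => (h (- t))%:E).
  by apply/measurable_EFinP; exact: measurable_funTS.
have hE (t : R) : (0 <= (h t)%:E)%E by rewrite lee_fin.
have -> : [set: R] = `]-oo, 0%R] `|` `]0%R, +oo[.
  by rewrite -setCitvr setvU.
rewrite ge0_integral_setU//=; last first.
  rewrite disj_set2E; apply/eqP; rewrite -subset0 => x []/= /[!in_itv]/=.
  by rewrite leNgt andbT => /negP.
under [RHS]eq_integral do rewrite EFinD addeC.
rewrite ge0_integralD//.
congr (_ + _)%E.
rewrite integral_itv_obnd_cbnd//.
rewrite (@ge0_integration_by_substitution0 _ (fun t => (h (- t))%:E))//.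
- by apply: eq_integral => x _; rewrite opprK.
- exact: mEhN.
- exact: mEhN.
Qed.

Lemma measurable_osc_line a b : mu.-integrable setT (EFin \o a) ->
  mu.-integrable setT (EFin \o b) ->
  measurable_fun setT (fun t => osc mu (fun x : R => x * t) a b).
Proof.
move=> inta intb; under eq_fun do rewrite osc_lineE//.
apply: measurable_funD.
  exact: measurable_cosT (integrable_measurable inta).
exact: measurable_sinT (integrable_measurable intb).
Qed.

(* The cross terms between [a] and [b] are odd in [t], so it suffices to add the
   values at [t] and [- t]. *)
Lemma plancherel_line a b :
  mu.-integrable setT (EFin \o a) -> mu.-integrable setT (EFin \o b) ->
  mu.-integrable setT (EFin \o (fun x => a x ^+ 2)) ->
  mu.-integrable setT (EFin \o (fun x => b x ^+ 2)) ->
  (\int[mu]_t (osc mu (fun x : R => (x * t)%R) a b ^+ 2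
      + osc mu (fun x : R => (x * t)%R) b (\- a)%R ^+ 2)%:E =
   (2 * pi)%:E * \int[mu]_x (a x ^+ 2 + b x ^+ 2)%:E)%E.
Proof.
move=> inta intb inta2 intb2.
have intNa : mu.-integrable setT (EFin \o (\- a)) by exact: integrableNR.
rewrite ge0_integral_line_even; last 2 first.
- by apply: measurable_funD; apply: measurable_funX; exact: measurable_osc_line.
- by move=> t; rewrite addr_ge0 ?sqr_ge0.
transitivity (\int[mu]_(t in `]0%R, +oo[) (2%:E * (specdens a t)%:E + 2%:E * (specdens b t)%:E))%E.
  apply: eq_integral => t _; rewrite !osc_lineE// !sinT_opp// !cosTN !sinTN//.
  by rewrite /specdens -!EFinM -EFinD; congr EFin; ring.
have ms (f : R -> R) : mu.-integrable setT (EFin \o f) ->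
    measurable_fun (`]0, +oo[%classic : set RT) (fun t => (specdens f t)%:E).
  move=> intf; apply/measurable_EFinP; apply: measurable_funTS.
  exact: measurable_specdens (integrable_measurable intf).
have ms2 (f : R -> R) : mu.-integrable setT (EFin \o f) ->
    measurable_fun (`]0, +oo[%classic : set RT) (fun t => 2%:E * (specdens f t)%:E)%E.
  by move=> intf; apply: emeasurable_funM => //; exact: ms.
have s0 (f : R -> R) t : (0 <= (specdens f t)%:E)%E by rewrite lee_fin specdens_ge0.
have s20 (f : R -> R) t : (0 <= 2%:E * (specdens f t)%:E)%E by rewrite mule_ge0.
rewrite ge0_integralD//; [|exact: ms2|exact: ms2].
rewrite !ge0_integralZl//; [|exact: ms|exact: ms].
rewrite !plancherel_half_line// !muleA -EFinM.
under [in RHS]eq_integral do rewrite EFinD.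
have sq0 (f : R -> R) t : (0 <= (f t ^+ 2)%:E)%E by rewrite lee_fin sqr_ge0.
rewrite [in RHS]ge0_integralD//; [|exact: measurable_int inta2|exact: measurable_int intb2].
by apply/esym/ge0_muleDr; apply: integral_ge0 => t _; exact: sq0.
Qed.

End plancherel_line_pair.

(** * Plancherel identity in several variables *)

(** Negation exchanges the positive and negative parts. If one of their integrals is infinite, both
    sides are the default value [0]. *)
Lemma RintegralN d (T : measurableType d) (R : realType)
    (mu : {measure set T -> \bar R}) (f : T -> R) :
  \int[mu]_x (- f x) = - \int[mu]_x f x.
Proof.
rewrite /Rintegral integralE [in RHS]integralE.
rewrite (_ : (fun x => (- f x)%:E)^\+ = (fun x => (f x)%:E)^\-)%E; last first.
  by apply/funext => x; rewrite funeposE funenegE.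
rewrite (_ : (fun x => (- f x)%:E)^\- = (fun x => (f x)%:E)^\+)%E; last first.
  by apply/funext => x; rewrite funeposE funenegE EFinN oppeK.
have p0 : (0 <= \int[mu]_x (fun x => (f x)%:E)^\+%E x)%E by exact: integral_ge0.
have n0 : (0 <= \int[mu]_x (fun x => (f x)%:E)^\-%E x)%E by exact: integral_ge0.
move: p0 n0; case: (integral _ _ _) => [p| |]//; case: (integral _ _ _) => [n| |]//=.
all: by rewrite ?oppr0 ?opprB.
Qed.

Section rV_slices.
Context {R : realType}.
Local Notation mu := (@lebesgue_measure R).
Local Notation RT := (measurableTypeR R).
Local Notation leb n := (@lebesgue_rV R n).

Lemma ge0_integral_rVS n (f : 'rV[R]_n.+1 -> \bar R) : measurable_fun setT f ->
  (forall x, 0 <= f x)%E ->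
  (\int[leb n.+1]_x f x = \int[mu \x leb n]_z f (cons_rV z))%E.
Proof.
move=> mf f0; have := @ge0_integral_pushforward _ _ _ _ R (@cons_rV R n)
  (@measurable_cons_rV R n) (mu \x leb n)%E setT f measurableT.
by rewrite preimage_setT => <-.
Qed.

Lemma measurable_cons_comp n d (T : measurableType d) (f : 'rV[R]_n.+1 -> T) :
  measurable_fun setT f -> measurable_fun setT (fun z => f (cons_rV z)).
Proof. by move=> mf; apply: measurableT_comp => //; exact: measurable_cons_rV. Qed.

Lemma integrable_rVS n (f : 'rV[R]_n.+1 -> R) : (leb n.+1).-integrable setT (EFin \o f) ->
  (mu \x leb n)%E.-integrable setT (EFin \o (fun z => f (cons_rV z))).
Proof.
move=> intf; have mf := integrable_measurable intf.
apply/integrableP; split; first by apply/measurable_EFinP; exact: measurable_cons_comp.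
rewrite -(ge0_integral_rVS (f := fun x => `|f x|%:E))//; first exact: integrable_norm_lty.
by apply/measurable_EFinP; exact: measurableT_comp.
Qed.

Lemma Rintegral_rVS n (f : 'rV[R]_n.+1 -> R) : (leb n.+1).-integrable setT (EFin \o f) ->
  \int[leb n.+1]_x f x = \int[(mu \x leb n)%E]_z f (cons_rV z).
Proof.
move=> intf; have mf := integrable_measurable intf.
have := @integral_pushforward _ _ _ _ R (@cons_rV R n) (@measurable_cons_rV R n)
  (mu \x leb n)%E setT (EFin \o f).
rewrite preimage_setT => H; congr fine; apply: H => //; first exact/measurable_EFinP.
exact: integrable_rVS.
Qed.

Lemma cons_rV0 n (z : RT * 'rV[R]_n) : cons_rV z ord0 ord0 = z.1.
Proof. by have := congr1 fst (cons_rVK z). Qed.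

Lemma cons_rVS n (z : RT * 'rV[R]_n) (i : 'I_n) : cons_rV z ord0 (lift ord0 i) = z.2 ord0 i.
Proof. by have := congr1 (fun p : RT * 'rV[R]_n => p.2 ord0 i) (cons_rVK z); rewrite mxE. Qed.

Lemma dotp_cons n (z w : RT * 'rV[R]_n) :
  dotp (cons_rV z) (cons_rV w) = z.1 * w.1 + dotp z.2 w.2.
Proof.
rewrite /dotp big_ord_recl !cons_rV0; congr (_ + _).
by apply: eq_bigr => i _; rewrite !cons_rVS.
Qed.

Lemma measurable_dotp n :
  measurable_fun setT (fun z : 'rV[R]_n * 'rV[R]_n => dotp z.1 z.2).
Proof.
rewrite /dotp; apply: measurable_sum => i; apply: measurable_funM.
  by apply: (@measurableT_comp _ _ _ _ _ _ (coord_rV i)) => //; exact: measurable_coord_rV.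
by apply: (@measurableT_comp _ _ _ _ _ _ (coord_rV i)) => //; exact: measurable_coord_rV.
Qed.

(* [fre a b] and [fre b (- a)] are the real and imaginary parts of the Fourier
   transform of [a + i b]. *)
Definition fre n (a b : 'rV[R]_n -> R) (xi : 'rV[R]_n) : R :=
  osc (leb n) (fun x => dotp x xi) a b.

Lemma measurable_osc_kernel d1 d2 (T1 : measurableType d1) (T2 : measurableType d2)
    (a b : T1 -> R) (theta : T1 * T2 -> R) :
  measurable_fun setT a -> measurable_fun setT b -> measurable_fun setT theta ->
  measurable_fun setT (fun z => a z.1 * cos (theta z) + b z.1 * sin (theta z)).
Proof.
move=> ma mb mt; apply: measurable_funD; apply: measurable_funM.
- exact: measurableT_comp.
- exact: (measurableT_comp measurable_cos mt).
- exact: measurableT_comp.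
- exact: (measurableT_comp measurable_sin mt).
Qed.

Lemma measurable_fre n (a b : 'rV[R]_n -> R) :
  measurable_fun setT a -> measurable_fun setT b -> measurable_fun setT (fre a b).
Proof.
move=> ma mb; apply: (@measurable_Rintegral2 _ _ _ _ R (leb n)
  (fun z => a z.1 * cos (dotp z.1 z.2) + b z.1 * sin (dotp z.1 z.2))).
exact: measurable_osc_kernel ma mb (@measurable_dotp n).
Qed.

Lemma integrable_osc d (T : measurableType d) (m : {measure set T -> \bar R})
    (theta a b : T -> R) : measurable_fun setT theta ->
  m.-integrable setT (EFin \o a) -> m.-integrable setT (EFin \o b) ->
  m.-integrable setT (EFin \o (fun x => a x * cos (theta x) + b x * sin (theta x))).
Proof.
move=> mt inta intb; apply: integrableDR.
  apply: (integrable_mul_bounded (M := 1) inta) => [|x]; last exact: cos_max.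
  exact: (measurableT_comp measurable_cos mt).
apply: (integrable_mul_bounded (M := 1) intb) => [|x]; last exact: sin_max.
exact: (measurableT_comp measurable_sin mt).
Qed.

Section step.
Variable n : nat.
Implicit Types a b : 'rV[R]_n.+1 -> R.

(** With [osc1 b (- a) t], the real and imaginary parts of the partial Fourier transform of
    [a + i b] in the first coordinate, as functions of the remaining ones. *)
Definition osc1 a b (t : R) (y : 'rV[R]_n) : R :=
  osc mu (fun x : RT => x * t) (fun x => a (cons_rV (x, y))) (fun x => b (cons_rV (x, y))).

Let slice_integrable a : (leb n.+1).-integrable setT (EFin \o a) ->
  {ae leb n, forall y, mu.-integrable setT (EFin \o (fun x => a (cons_rV (x, y))))}.
Proof. by move=> inta; exact: (ae_integrable2 (integrable_rVS inta)). Qed.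

Let measurable_phase (t : R) (s : 'rV[R]_n) :
  measurable_fun setT (fun z : RT * 'rV[R]_n => z.1 * t + dotp z.2 s).
Proof.
apply: measurable_funD; first exact: measurable_funM.
apply: (@measurableT_comp _ _ _ _ _ _ (fun y => dotp y s)) => //.
exact: (measurable_pair2 s (@measurable_dotp n)).
Qed.

Lemma integrable_osc1 a b t : (leb n.+1).-integrable setT (EFin \o a) ->
  (leb n.+1).-integrable setT (EFin \o b) ->
  (leb n).-integrable setT (EFin \o osc1 a b t).
Proof.
move=> inta intb.
have mt : measurable_fun setT (fun z : RT * 'rV[R]_n => z.1 * t) by exact: measurable_funM.
exact: (integrable_Rintegral2 (integrable_osc mt (integrable_rVS inta) (integrable_rVS intb))).
Qed.

Lemma measurable_osc1 a b : measurable_fun setT a -> measurable_fun setT b ->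
  measurable_fun setT (fun z : RT * 'rV[R]_n => osc1 a b z.1 z.2).
Proof.
move=> ma mb.
apply: (@measurable_Rintegral2 _ _ RT (RT * 'rV[R]_n)%type R mu
  (fun u => a (cons_rV (u.1, u.2.2)) * cos (u.1 * u.2.1) +
            b (cons_rV (u.1, u.2.2)) * sin (u.1 * u.2.1))).
have mp : measurable_fun setT (fun u : RT * (RT * 'rV[R]_n) => u.1 * u.2.1).
  by apply: measurable_funM => //; exact: measurableT_comp.
have mc : measurable_fun setT (fun u : RT * (RT * 'rV[R]_n) => (u.1, u.2.2)).
  by apply: measurable_fun_pair => //; exact: measurableT_comp.
apply: measurable_funD; apply: measurable_funM.
- exact: (measurableT_comp (measurable_cons_comp ma) mc).
- exact: (measurableT_comp measurable_cos mp).
- exact: (measurableT_comp (measurable_cons_comp mb) mc).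
- exact: (measurableT_comp measurable_sin mp).
Qed.

Lemma osc1_opp a b t : osc1 (\- a) (\- b) t = \- osc1 a b t.
Proof.
apply/funext => y; rewrite /= -RintegralN.
by apply: eq_Rintegral => x _ /=; rewrite !mulNr opprD.
Qed.

(** The phase is additive over coordinates, so the transform is that of the partial transform in the
    remaining variables. The integrands in [y] are compared only for almost every [y], where the
    slices of [a] and [b] are integrable. *)
Lemma fre_cons a b t s : (leb n.+1).-integrable setT (EFin \o a) ->
  (leb n.+1).-integrable setT (EFin \o b) ->
  fre a b (cons_rV (t, s)) = fre (osc1 a b t) (osc1 b (\- a) t) s.
Proof.
move=> inta intb.
have intNa : (leb n.+1).-integrable setT (EFin \o (\- a)) by exact: integrableNR.
have mdot : measurable_fun setT (fun x : 'rV[R]_n.+1 => dotp x (cons_rV (t, s))).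
  exact: (measurable_pair2 (cons_rV (t, s)) (@measurable_dotp n.+1)).
have int1 := integrable_osc mdot inta intb.
rewrite /fre {1}/osc Rintegral_rVS// -Rintegral21_prod; last exact: (integrable_rVS int1).
have mds : measurable_fun setT (fun y : 'rV[R]_n => dotp y s).
  exact: (measurable_pair2 s (@measurable_dotp n)).
congr fine; apply: ae_eq_integral => //.
- apply/measurable_EFinP.
  apply: (@measurable_Rintegral2 _ _ RT _ R mu (fun z => a (cons_rV z) *
    cos (dotp (cons_rV z) (cons_rV (t, s))) + b (cons_rV z) *
    sin (dotp (cons_rV z) (cons_rV (t, s))))).
  exact: (integrable_measurable (integrable_rVS int1)).
- exact: (measurable_int _ (integrable_osc mds (integrable_osc1 t inta intb)
    (integrable_osc1 t intb intNa))).
- have := slice_integrable inta; have := slice_integrable intb.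
  apply: filterS2 => y intby intay _ /=.
  have mxt : measurable_fun setT (fun x : RT => x * t) by exact: measurable_funM.
  have intNay : mu.-integrable setT (EFin \o (fun x => - a (cons_rV (x, y)))).
    exact: integrableNR.
  rewrite /osc1 /osc -!RintegralZr//; try exact: integrable_osc.
  rewrite -RintegralD//.
  + congr EFin; apply: eq_Rintegral => x _; rewrite dotp_cons/= cosD sinD; ring.
  + apply: (integrable_mul_bounded (M := 1) (integrable_osc mxt intay intby)) => //.
    by move=> _; exact: cos_max.
  + apply: (integrable_mul_bounded (M := 1) (integrable_osc mxt intby intNay)) => //.
    by move=> _; exact: sin_max.
Qed.

End step.

End rV_slices.

Section plancherel_rV.
Context {R : realType}.
Local Notation mu := (@lebesgue_measure R).
Local Notation RT := (measurableTypeR R).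
Local Notation leb n := (@lebesgue_rV R n).

Let plancherel_statement n := forall a b : 'rV[R]_n -> R,
  (leb n).-integrable setT (EFin \o a) -> (leb n).-integrable setT (EFin \o b) ->
  (leb n).-integrable setT (EFin \o (fun x => a x ^+ 2)) ->
  (leb n).-integrable setT (EFin \o (fun x => b x ^+ 2)) ->
  (\int[leb n]_xi (fre a b xi ^+ 2 + fre b (\- a)%R xi ^+ 2)%:E =
   ((2 * pi) ^+ n)%:E * \int[leb n]_x (a x ^+ 2 + b x ^+ 2)%:E)%E.

(** In dimension [0] the measure is the Dirac mass at the only point and the phase is [0], so the
    transform is evaluation. *)
Let plancherel0 : plancherel_statement 0.
Proof.
move=> a b inta intb inta2 intb2.
have [ma mb] := (integrable_measurable inta, integrable_measurable intb).
have mNa : measurable_fun setT (\- a) by exact: measurableT_comp.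
have dot0 (x y : 'rV[R]_0) : dotp x y = 0 by rewrite /dotp big_ord0.
have freE (f g : 'rV[R]_0 -> R) xi : measurable_fun setT f -> measurable_fun setT g ->
    fre f g xi = f 0.
  move=> mf mg; rewrite /fre /osc /Rintegral integral_dirac//.
    by rewrite diracT mul1e/= dot0 cos0 sin0 mulr1 mulr0 addr0.
  apply/measurable_EFinP.
  exact: (measurable_pair2 xi (measurable_osc_kernel mf mg (@measurable_dotp R 0))).
rewrite expr0 mul1e !integral_dirac//; last 2 first.
- by apply/measurable_EFinP; apply: measurable_funD; exact: measurable_funX.
- by apply/measurable_EFinP; apply: measurable_funD; apply: measurable_funX;
    exact: measurable_fre.
by rewrite !freE// sqrrN.
Qed.

(** The identity on the line applies in the first variable to almost every slice, and the induction
    hypothesis to the partial transform at almost every frequency [t]; Tonelli exchanges the two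
    integrations. *)
Let plancherelS n : plancherel_statement n -> plancherel_statement n.+1.
Proof.
move=> IH a b inta intb inta2 intb2.
have [ma mb] := (integrable_measurable inta, integrable_measurable intb).
have intNa : (leb n.+1).-integrable setT (EFin \o (\- a)) by exact: integrableNR.
have mNa : measurable_fun setT (\- a) by exact: measurableT_comp.
pose A t y := osc1 a b t y; pose B t y := osc1 b (\- a) t y.
have mA : measurable_fun setT (fun z : RT * 'rV[R]_n => A z.1 z.2) by exact: measurable_osc1.
have mB : measurable_fun setT (fun z : RT * 'rV[R]_n => B z.1 z.2) by exact: measurable_osc1.
pose S (z : RT * 'rV[R]_n) := (A z.1 z.2 ^+ 2 + B z.1 z.2 ^+ 2)%:E.
have mS : measurable_fun setT S.
  by apply/measurable_EFinP; apply: measurable_funD; exact: measurable_funX.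
have S0 z : (0 <= S z)%E by rewrite lee_fin addr_ge0 ?sqr_ge0.
pose N (x : 'rV[R]_n.+1) := (a x ^+ 2 + b x ^+ 2)%:E.
have mN : measurable_fun setT N.
  by apply/measurable_EFinP; apply: measurable_funD; exact: measurable_funX.
have N0 x : (0 <= N x)%E by rewrite lee_fin addr_ge0 ?sqr_ge0.
have mNc : measurable_fun setT (fun z => N (cons_rV z)) by exact: measurable_cons_comp.
have sumS : (\int[leb n]_y \int[mu]_t S (t, y) = (2 * pi)%:E * \int[leb n.+1]_x N x)%E.
  rewrite ge0_integral_rVS// fubini_tonelli2// -ge0_integralZl//; last 3 first.
  - exact: measurable_fun_fubini_tonelli_G.
  - by move=> y _; exact: integral_ge0.
  - by rewrite lee_fin mulr_ge0 ?pi_ge0.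
  apply: ge0_ae_eq_integral => //.
  - exact: measurable_fun_fubini_tonelli_G.
  - by apply: emeasurable_funM => //; exact: measurable_fun_fubini_tonelli_G.
  - by move=> y _; exact: integral_ge0.
  - move=> y _; rewrite mule_ge0//; last exact: integral_ge0.
    by rewrite lee_fin mulr_ge0 ?pi_ge0.
  - have Ia := ae_integrable2 (integrable_rVS inta).
    have Ib := ae_integrable2 (integrable_rVS intb).
    have Ia2 := ae_integrable2 (integrable_rVS inta2).
    have Ib2 := ae_integrable2 (integrable_rVS intb2).
    apply: filterS2 (filterI Ia Ib) (filterI Ia2 Ib2) => y [ya yb] [ya2 yb2] _.
    exact: (plancherel_line ya yb ya2 yb2).
have intN : (\int[leb n.+1]_x N x < +oo)%E.
  have := integrable_norm_lty (integrableDR inta2 intb2).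
  by under eq_integral do rewrite ger0_norm ?addr_ge0 ?sqr_ge0//.
(* Joint square integrability of the partial transform: it makes [A t] and [B t] square integrable
   for almost every [t], as the induction hypothesis requires. *)
have intS : (mu \x leb n)%E.-integrable setT S.
  apply/integrableP; split => //.
  under eq_integral do rewrite gee0_abs//.
  rewrite fubini_tonelli2// sumS lte_mul_pinfty// ?lee_fin ?mulr_ge0 ?pi_ge0//.
have mF : measurable_fun setT (fun xi : 'rV[R]_n.+1 =>
    (fre a b xi ^+ 2 + fre b (\- a) xi ^+ 2)%:E).
  by apply/measurable_EFinP; apply: measurable_funD; apply: measurable_funX;
    exact: measurable_fre.
have F0 (xi : 'rV[R]_n.+1) : (0 <= (fre a b xi ^+ 2 + fre b (\- a)%R xi ^+ 2)%:E)%E.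
  by rewrite lee_fin addr_ge0 ?sqr_ge0.
rewrite ge0_integral_rVS// fubini_tonelli1//; last exact: (measurable_cons_comp mF).
transitivity (\int[mu]_t (((2 * pi) ^+ n)%:E * \int[leb n]_y S (t, y)))%E.
  apply: ge0_ae_eq_integral => //.
  - by apply: measurable_fun_fubini_tonelli_F => //; exact: (measurable_cons_comp mF).
  - by apply: emeasurable_funM => //; exact: measurable_fun_fubini_tonelli_F.
  - by move=> t _; exact: integral_ge0.
  - move=> t _; rewrite mule_ge0//; last exact: integral_ge0.
    by rewrite lee_fin exprn_ge0// mulr_ge0 ?pi_ge0.
  have := ae_integrable1 intS; apply: filterS => t intSt _.
  have intA2 : (leb n).-integrable setT (EFin \o (fun y => A t y ^+ 2)).
    apply: (le_integrableR (g := fun y => A t y ^+ 2 + B t y ^+ 2)) => //.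
      by apply: measurable_funX; exact: (measurable_pair1 (t : RT) mA).
    by move=> y; rewrite ger0_norm ?sqr_ge0// lerDl sqr_ge0.
  have intB2 : (leb n).-integrable setT (EFin \o (fun y => B t y ^+ 2)).
    apply: (le_integrableR (g := fun y => A t y ^+ 2 + B t y ^+ 2)) => //.
      by apply: measurable_funX; exact: (measurable_pair1 (t : RT) mB).
    by move=> y; rewrite ger0_norm ?sqr_ge0// lerDr sqr_ge0.
  rewrite /fubini_F/= -(IH (A t) (B t))//; [|exact: integrable_osc1|exact: integrable_osc1].
  apply: eq_integral => s _.
  by rewrite !fre_cons// (_ : osc1 (\- a) (\- b) t = \- A t)// osc1_opp.
rewrite ge0_integralZl//; last 3 first.
- exact: measurable_fun_fubini_tonelli_F.
- by move=> t _; exact: integral_ge0.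
- by rewrite lee_fin exprn_ge0// mulr_ge0 ?pi_ge0.
by rewrite fubini_tonelli// sumS muleA -EFinM exprSr.
Qed.

Theorem plancherel_rV n (a b : 'rV[R]_n -> R) :
  (leb n).-integrable setT (EFin \o a) -> (leb n).-integrable setT (EFin \o b) ->
  (leb n).-integrable setT (EFin \o (fun x => a x ^+ 2)) ->
  (leb n).-integrable setT (EFin \o (fun x => b x ^+ 2)) ->
  (\int[leb n]_xi (fre a b xi ^+ 2 + fre b (\- a)%R xi ^+ 2)%:E =
   ((2 * pi) ^+ n)%:E * \int[leb n]_x (a x ^+ 2 + b x ^+ 2)%:E)%E.
Proof.
move: a b; elim: n => [|n IH]; [exact: plancherel0|exact: plancherelS].
Qed.

End plancherel_rV.

(** * Measure theory of row vectors *)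

Section rV_measure.
Context {R : realType}.
Local Notation mu := (@lebesgue_measure R).
Local Notation RT := (measurableTypeR R).
Local Notation leb n := (@lebesgue_rV R n).

Definition rVbox n (c : 'rV[R]_n) (r : R) : set 'rV[R]_n :=
  [set x | forall i, `|c ord0 i - x ord0 i| < r].

Lemma measurable_rVbox n (c : 'rV[R]_n) r : measurable (rVbox c r).
Proof.
rewrite (_ : rVbox c r = \bigcap_(i in [set: 'I_n]) [set x | `|c ord0 i - x ord0 i| < r]).
  apply: fin_bigcap_measurable => // i _.
  rewrite -[X in measurable X]setTI.
  exact: (@measurable_coord_rV R n i measurableT _ (measurable_ball (c ord0 i) r)).
apply/seteqP; split => [x xb i _|x xb i]; first exact: xb.
exact: xb.
Qed.

(** The sigma-algebra is generated by the coordinates, while openness refers to the sup-norm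
    topology. An open set is the union of the countably many boxes with rational centre and radius
    that it contains. *)
Lemma open_measurable_rV n (A : set 'rV[R]_n) : open A -> measurable A.
Proof.
move=> oA; pose F (u : 'rV[rat]_n * rat) : set 'rV[R]_n :=
  let b := rVbox (map_mx ratr u.1) (ratr u.2) in if `[< b `<=` A >] then b else set0.
suff -> : A = \bigcup_(u in setT) F u.
  apply: countable_bigcupT_measurable => [|u]; first exact: countableP.
  by rewrite /F; case: ifP => _ //; exact: measurable_rVbox.
apply/seteqP; split => [x Ax|x [u _]]; last first.
  by rewrite /F; case: ifPn => // /asboolP; apply.
have /nbhs_ballP[e /= e0 xeA] : nbhs x A by exact: open_nbhs_nbhs.
(* With radius below [e / 2] and centre within that radius of [x], the box contains [x] and stays in
   the ball of radius [e] around it. *)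
have [r] : exists r : rat, (ratr r : R) \in `]0, (e / 2)[.
  by apply: rat_in_itvoo; rewrite divr_gt0.
rewrite in_itv/= => /andP[r0 re].
have /choice[q qP] : forall i : 'I_n, exists q : rat, `|(ratr q : R) - x ord0 i| < ratr r.
  move=> i; have [q] : exists q : rat, (ratr q : R) \in `]x ord0 i - ratr r, (x ord0 i + ratr r)[.
    by apply: rat_in_itvoo; rewrite ltrBlDr -addrA ltrDl addr_gt0.
  rewrite in_itv/= => /andP[q1 q2]; exists q.
  by rewrite ltr_norml ltrBrDl q1 ltrBlDl q2.
exists (\row_i q i, r) => //; rewrite /F/=.
have xb : rVbox (map_mx ratr (\row_i q i)) (ratr r) x by move=> i; rewrite !mxE.
rewrite ifT//; apply/asboolP => y yb; apply: xeA; split => // i j.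
rewrite (ord1 i) /ball/=.
have := xb j; have := yb j; rewrite !mxE => h1 h2.
rewrite -(subrK (ratr (q j)) (x ord0 j)) -addrA (le_lt_trans (ler_normD _ _))//.
rewrite (splitr e) ltrD// ?(lt_trans _ re)//.
by rewrite distrC.
Qed.

Lemma continuous_measurable_rV n (f : 'rV[R]_n -> R) : continuous f -> measurable_fun setT f.
Proof.
move=> /continuousP cf; apply: (measurability _ (RGenOpens.measurableE R)).
move=> _ [_ [a [b ->] <-]]; rewrite setTI; apply: open_measurable_rV.
by apply: cf; exact: interval_open.
Qed.

Lemma measurable_affine_rV n (r : R) (h : 'rV[R]_n) :
  measurable_fun setT (fun x : 'rV[R]_n => r *: x + h).
Proof.
apply: measurable_fun_rV => i.
rewrite (_ : _ \o _ = fun x => r * coord_rV i x + h ord0 i); last first.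
  by apply/funext => x; rewrite /coord_rV/= !mxE.
apply: measurable_funD => //; apply: measurable_funM => //.
exact: measurable_coord_rV.
Qed.

Lemma affine_cons n (r : R) (h : 'rV[R]_n.+1) (z : RT * 'rV[R]_n) :
  r *: cons_rV z + h =
  cons_rV (r * z.1 + (uncons_rV h).1 : RT, r *: z.2 + (uncons_rV h).2).
Proof.
apply/rowP => i; rewrite 2!mxE.
have [j ->|->] := unliftP ord0 i.
  by rewrite !cons_rVS/= !mxE.
by rewrite !cons_rV0.
Qed.

(** Induction on the dimension by slices: each coordinate contributes one factor [r^-1]. *)
Lemma ge0_integral_affine_rV n (r : R) (h : 'rV[R]_n) (f : 'rV[R]_n -> \bar R) : 0 < r ->
  measurable_fun setT f -> (forall x, 0 <= f x)%E ->
  (\int[leb n]_x f (r *: x + h)%R = ((r^-1) ^+ n)%:E * \int[leb n]_x f x)%E.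
Proof.
move=> r0; have ri0 : 0 < r^-1 by rewrite invr_gt0.
elim: n h f => [|n IH] h f mf f0.
  rewrite expr0 mul1e; apply: eq_integral => x _; congr f.
  by apply/rowP => -[].
have mfa : measurable_fun setT (fun x : 'rV[R]_n.+1 => f (r *: x + h)).
  by apply: measurableT_comp => //; exact: measurable_affine_rV.
have mfc := measurable_cons_comp mf.
rewrite !ge0_integral_rVS// !fubini_tonelli1//; last exact: (measurable_cons_comp mfa).
set h1 := (uncons_rV h).1; set h2 := (uncons_rV h).2.
pose G (x : RT) := (\int[leb n]_y f (cons_rV (x, y)))%E.
have mG : measurable_fun setT G by exact: (measurable_fun_fubini_tonelli_F _ mfc).
have G0 x : (0 <= G x)%E by exact: integral_ge0.
transitivity (\int[mu]_x (((r^-1) ^+ n)%:E * G (r * x + h1)%R))%E.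
  apply: eq_integral => x _; rewrite /fubini_F.
  rewrite /G -(IH h2 (fun y => f (cons_rV (r * x + h1 : RT, y))))//; last first.
    by apply: (measurableT_comp mfc); exact: measurable_fun_pair.
  by apply: eq_integral => y _; rewrite affine_cons.
have mGa : measurable_fun setT (fun x : RT => G (r * x + h1)).
  by apply: measurableT_comp => //; exact: measurable_affine.
have rn0 : (0 <= ((r^-1) ^+ n)%:E)%E by rewrite lee_fin exprn_ge0// ltW.
rewrite (ge0_integralZl _ measurableT mGa (fun x _ => G0 _) rn0).
rewrite (@ge0_integral_comp _ RT R mu _ _ (measurable_affine r h1) ri0
  (fun A => @lebesgue_measure_affine _ r h1 A r0) G mG G0).
by rewrite muleA -EFinM -exprSr.
Qed.

Lemma lebesgue_rV_affine n (r : R) (h : 'rV[R]_n) (A : set 'rV[R]_n) : 0 < r ->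
  measurable A ->
  (leb n ((fun x => r *: x + h)%R @^-1` A) = ((r^-1) ^+ n)%:E * leb n A)%E.
Proof.
move=> r0 mA.
have mI : measurable_fun setT (fun x : 'rV[R]_n => (\1_A x : R)%:E).
  by apply/measurable_EFinP; exact: measurable_indic.
have I0 (x : 'rV[R]_n) : (0 <= (\1_A x : R)%:E)%E by rewrite lee_fin.
have mphi : measurable ((fun x => r *: x + h) @^-1` A).
  by rewrite -[X in measurable X]setTI; exact: measurable_affine_rV.
have := ge0_integral_affine_rV h r0 mI I0.
by rewrite (integral_indic _ _ mA)// setIT => <-; rewrite -[X in leb n X]setIT -integral_indic.
Qed.

Definition cube n (M : R) : set 'rV[R]_n := [set x | forall i, `|x ord0 i| <= M].

Lemma measurable_cube n M : measurable (@cube n M).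
Proof.
rewrite (_ : cube M = \bigcap_(i in [set: 'I_n]) [set x | `|x ord0 i| <= M]).
  apply: fin_bigcap_measurable => // i _.
  have := @measurable_coord_rV R n i measurableT _ (measurable_itv `[(- M), M]).
  rewrite setTI; congr measurable; apply/seteqP.
  by split => x /=; rewrite /coord_rV in_itv/= ler_norml.
by apply/seteqP; split => [x xb i _|x xb i]; exact: xb.
Qed.

Lemma lebesgue_rV_cube n M : 0 <= M -> (leb n (@cube n M) < +oo)%E.
Proof.
move=> M0; have muM : (lebesgue_measure `[(- M)%R, M] < +oo)%E.
  by rewrite lebesgue_measure_itv/=; case: ifPn; rewrite ?ltry// -EFinD ltry.
elim: n => [|n IH].
  by rewrite /= diracE; case: (_ \in _); rewrite ltry.
rewrite /= /lebesgue_rV_step/= /pushforward.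
rewrite (_ : _ @^-1` _ = (`[(- M), M]%classic : set RT) `*` @cube n M); last first.
  apply/seteqP; split => z /=.
    move=> zM; split; first by have := zM ord0; rewrite cons_rV0 in_itv/= ler_norml.
    by move=> i; have := zM (lift ord0 i); rewrite cons_rVS.
  move=> [z1 z2] i; have [j ->|->] := unliftP ord0 i; first by rewrite cons_rVS; exact: z2.
  by rewrite cons_rV0 ler_norml; move: z1; rewrite in_itv.
rewrite product_measure1E//; last exact: measurable_cube.
rewrite lte_mul_pinfty// ?ge0_fin_numE//.
Qed.

End rV_measure.

(** * Euclidean balls and the integral of the positive part of [m - ln |xi|] *)

Section riesz_mean.
Context {R : realType}.
Local Notation mu := (@lebesgue_measure R).
Local Notation RT := (measurableTypeR R).
Local Notation leb n := (@lebesgue_rV R n).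

Lemma measurable_enorm n : measurable_fun setT (@enorm R n).
Proof.
apply: (@measurableT_comp _ _ _ _ _ _ (@Num.sqrt R)).
  by apply: continuous_measurable_fun; exact: sqrt_continuous.
apply: (@measurableT_comp _ _ _ _ _ _ (fun z : 'rV[R]_n * 'rV[R]_n => dotp z.1 z.2) _
  (fun x => (x, x))).
  exact: measurable_dotp.
exact: measurable_fun_pair.
Qed.

Lemma enorm_ge0 n (x : 'rV[R]_n) : 0 <= enorm x.
Proof. exact: sqrtr_ge0. Qed.

Lemma dotp_ge0 n (x : 'rV[R]_n) : 0 <= dotp x x.
Proof. by apply: sumr_ge0 => i _; rewrite -expr2 sqr_ge0. Qed.

Lemma enorm_sqr n (x : 'rV[R]_n) : enorm x ^+ 2 = \sum_(i < n) x ord0 i ^+ 2.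
Proof. by rewrite sqr_sqrtr ?dotp_ge0//; apply: eq_bigr => i _; rewrite expr2. Qed.

Lemma enormZ n (c : R) (x : 'rV[R]_n) : 0 <= c -> enorm (c *: x) = c * enorm x.
Proof.
move=> c0; rewrite /enorm (_ : dotp (c *: x) (c *: x) = c ^+ 2 * dotp x x).
  by rewrite sqrtrM ?sqr_ge0// sqrtr_sqr ger0_norm.
by rewrite /dotp mulr_sumr; apply: eq_bigr => i _; rewrite !mxE; ring.
Qed.

Lemma normr_le_enorm n (x : 'rV[R]_n) i : `|x ord0 i| <= enorm x.
Proof.
rewrite -sqrtr_sqr ler_wsqrtr// /dotp (bigD1 i)//= expr2 lerDl.
by apply: sumr_ge0 => j _; rewrite -expr2 sqr_ge0.
Qed.

Lemma measurable_enorm_lt n (r : R) : measurable [set x : 'rV[R]_n | enorm x < r].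
Proof.
have := @measurable_enorm n measurableT _ (measurable_itv `]-oo, r[).
by rewrite setTI; congr measurable; apply/seteqP; split => x /=; rewrite in_itv.
Qed.

Lemma lebesgue_rV_ball n (r : R) : 0 < r ->
  (leb n [set x | (enorm x < r)%R] = (r ^+ n)%:E * leb n (unit_ball n))%E.
Proof.
move=> r0; have ri0 : 0 < r^-1 by rewrite invr_gt0.
have := lebesgue_rV_affine 0 ri0 (@measurable_enorm_lt n 1).
rewrite invrK => <-; congr (leb n _).
apply/seteqP; split => x /=; rewrite addr0 enormZ ?ltW//.
  by move=> xr; rewrite mulrC ltr_pdivrMr// mul1r.
by rewrite mulrC ltr_pdivrMr// mul1r.
Qed.

Lemma lebesgue_rV_unit_ball_lty n : (leb n (unit_ball n) < +oo)%E.
Proof.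
apply: le_lt_trans (lebesgue_rV_cube n ler01).
apply: le_measure; rewrite ?inE.
- exact: measurable_enorm_lt.
- exact: measurable_cube.
- by move=> x /= /ltW x1 i; exact: le_trans (normr_le_enorm x i) x1.
Qed.

Lemma integral_expw (e : R) : 0 < e -> (\int[mu]_t (expw e t)%:E = (e^-1)%:E)%E.
Proof.
move=> e0; rewrite -integrable_EFinE; last exact: integrable_expw.
have := Rintegral_expw_cos 0 e0; under eq_Rintegral do rewrite mul0r cos0 mulr1.
by move=> ->; rewrite /poisson expr0n addr0; congr EFin; field; rewrite lt0r_neq0.
Qed.

(* [ln 0 = 0]: the origin only has to satisfy the inequality. *)
Lemma pos_part_layer_cake (m u : R) : 0 <= u ->
  ((Num.max (m - ln u) 0)%:E <=
   \int[mu]_s ((\1_(`]0%R, +oo[) s * (u < expR (m - s))%R%:R))%:E)%E.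
Proof.
move=> u0.
pose D : set RT := if 0 < u then `]0, (m - ln u)[%classic else `]0, +oo[%classic.
have mD : measurable D by rewrite /D; case: ifP.
have -> : (\int[mu]_s ((\1_(`]0%R, +oo[) s * (u < expR (m - s))%R%:R))%:E = mu D)%E.
  rewrite -(setIT D) -(integral_indic mu measurableT mD).
  apply: eq_integral => s _; congr EFin; rewrite !indicE /D.
  case: ifPn => [u_gt0|].
    have -> : (u < expR (m - s)) = (s < m - ln u).
      by rewrite -{1}(lnK u_gt0) ltr_expR ltrBrDl ltrBrDl addrC.
    have -> : (s \in `]0, +oo[%classic) = (0 < s).
      by apply/idP/idP; rewrite inE/= in_itv/= andbT.
    have -> : (s \in `]0, m - ln u[%classic) = (0 < s) && (s < m - ln u).
      by apply/idP/idP; rewrite inE/= in_itv.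
    by case: (0 < s); rewrite ?mul1r ?mul0r.
  rewrite -leNgt => u_le0; have -> : u < expR (m - s) by rewrite (le_lt_trans u_le0)// expR_gt0.
  by rewrite mulr1.
rewrite /D; case: ifPn => [u_gt0|_].
  apply: le_trans (_ : ((lebesgue_measure `]0%R, (m - ln u)%R[) >= _)%E) => //.
  rewrite lebesgue_measure_itv/= lte_fin.
  by case: ltP => h; rewrite ?sube0.
apply: le_trans (_ : ((lebesgue_measure (`]0%R, +oo[)%classic) >= _)%E) => //.
by rewrite lebesgue_measure_itv/= ltry leey.
Qed.

Definition riesz_weight n (m : R) (xi : 'rV[R]_n) : R := Num.max (m - ln (enorm xi)) 0.

Lemma measurable_riesz_weight n m : measurable_fun setT (@riesz_weight n m).
Proof.
apply: measurable_maxr => //; apply: measurable_funB => //.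
by apply: measurableT_comp => //; exact: measurable_enorm.
Qed.

Lemma riesz_weight_ge0 n m xi : 0 <= @riesz_weight n m xi.
Proof. by rewrite /riesz_weight le_max lexx orbT. Qed.

(** After Tonelli, the slice at height [s] is the ball of radius [e^(m - s)], of measure
    [e^(m n) e^(- n s) |B_n|]; integrating [e^(- n s)] over [s > 0] produces [1 / n]. *)
Lemma integral_riesz_weight_le n (m : R) : (0 < n)%N ->
  (\int[leb n]_xi (riesz_weight m xi)%:E <=
   (expR (m * n%:R) / n%:R)%:E * leb n (unit_ball n))%E.
Proof.
move=> n0; have n0R : 0 < n%:R :> R by rewrite ltr0n.
(* The condition [|xi| < e^(m - s)] is encoded as positivity of a difference, which makes joint
   measurability a composition. *)
pose J (z : RT * 'rV[R]_n) : R := \1_(`]0, +oo[) z.1 * \1_(`]0, +oo[) (expR (m - z.1) - enorm z.2).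
have mJ : measurable_fun setT J.
  apply: measurable_funM.
    by apply: measurableT_comp => //; exact: measurable_indic.
  apply: (@measurableT_comp _ _ _ _ _ _ (\1_(`]0, +oo[) : R -> R)).
    exact: measurable_indic.
  apply: measurable_funB.
    apply: measurableT_comp => //; exact: measurable_funB.
  by apply: measurableT_comp => //; exact: measurable_enorm.
have J0 z : (0 <= (J z)%:E)%E by rewrite lee_fin mulr_ge0.
have mEJ : measurable_fun setT (fun z => (J z)%:E) by exact/measurable_EFinP.
have JE (s : R) (xi : 'rV[R]_n) :
    \1_(`]0, +oo[) (expR (m - s) - enorm xi) = (enorm xi < expR (m - s))%R%:R :> R.
  rewrite indicE; congr (_%:R); congr nat_of_bool.
  by apply/idP/idP; rewrite inE/= in_itv/= andbT subr_gt0.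
apply: (@le_trans _ _ (\int[leb n]_xi \int[mu]_s (J (s, xi))%:E)%E).
  apply: ge0_le_integral => //.
  - by move=> xi _; rewrite lee_fin riesz_weight_ge0.
  - by apply/measurable_EFinP; exact: measurable_riesz_weight.
  - exact: (measurable_fun_fubini_tonelli_G _ mEJ).
  - move=> xi _; rewrite /J/=; under [leRHS]eq_integral do rewrite JE.
    exact: pos_part_layer_cake (enorm_ge0 xi).
rewrite -(fubini_tonelli (fun z => (J z)%:E))//.
have -> : (\int[mu]_s \int[leb n]_xi (J (s, xi))%:E =
  \int[mu]_s ((expw n%:R s)%:E * ((expR (m * n%:R))%:E * leb n (unit_ball n))))%E.
  apply: eq_integral => s _; rewrite /J/=; under eq_integral do rewrite JE.
  rewrite /expw; case: ifPn => s0; last first.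
    rewrite mul0e; apply: integral0_eq => xi _.
    by rewrite indicE memNset ?mul0r//= in_itv/= andbT; exact/negP.
  transitivity (\int[leb n]_xi (\1_[set x | enorm x < expR (m - s)] xi)%:E)%E.
    apply: eq_integral => xi _; rewrite indicE mem_set ?mul1r//=; last by rewrite in_itv/= s0.
    rewrite indicE; congr ((_%:R)%:E); congr nat_of_bool.
    by apply/idP/idP; rewrite inE.
  rewrite integral_indic//; last exact: measurable_enorm_lt.
  rewrite setIT; apply: etrans (@lebesgue_rV_ball n _ (expR_gt0 (m - s))) _.
  rewrite -expRM_natr.
  rewrite (_ : (m - s) * n%:R = - (n%:R * s) + m * n%:R); last by ring.
  by rewrite expRD EFinM muleA.
have bf := lebesgue_rV_unit_ball_lty n.
have bfin : leb n (unit_ball n) \is a fin_num by rewrite ge0_fin_numE.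
rewrite -(fineK bfin) -EFinM ge0_integralZr//.
- by rewrite integral_expw// -!EFinM lee_fin mulrA [_^-1 * _]mulrC.
- by apply/measurable_EFinP; exact: measurable_expw.
- by move=> s _; rewrite lee_fin expw_ge0.
- by rewrite lee_fin mulr_ge0 ?expR_ge0 ?fine_ge0.
Qed.

End riesz_mean.

(** * Bessel inequality *)

Section bessel.
Context d (T : measurableType d) (R : realType).
Variable mu : {measure set T -> \bar R}.
Implicit Types f g : T -> R.

Definition square_integrable f := measurable_fun setT f /\
  mu.-integrable setT (EFin \o (fun x => f x ^+ 2)).

Lemma square_integrable_mul f g : square_integrable f -> square_integrable g ->
  mu.-integrable setT (EFin \o (fun x => f x * g x)).
Proof.
move=> [mf intf] [mg intg].
apply: (le_integrableR (g := fun x => f x ^+ 2 + g x ^+ 2)).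
- exact: measurable_funM.
- move=> x; rewrite normrM -(real_normK (num_real (f x))) -(real_normK (num_real (g x))).
  have := sqr_ge0 (`|f x| - `|g x|); have := normr_ge0 (f x); have := normr_ge0 (g x).
  by nra.
- exact: integrableDR.
Qed.

Lemma square_integrableN f : square_integrable f -> square_integrable (\- f).
Proof.
move=> [mf intf]; split; first exact: measurableT_comp.
by apply: eq_integrable intf => // x _; rewrite /= sqrrN.
Qed.

Lemma Rintegral_sum (J : finType) (h : J -> T -> R) :
  (forall j, mu.-integrable setT (EFin \o h j)) ->
  mu.-integrable setT (EFin \o (fun x => \sum_j h j x)) /\
  \int[mu]_x (\sum_j h j x) = \sum_j \int[mu]_x h j x.
Proof.
move=> inth.
suff H (r : seq J) : mu.-integrable setT (EFin \o (fun x => \sum_(j <- r) h j x)) /\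
    \int[mu]_x (\sum_(j <- r) h j x) = \sum_(j <- r) \int[mu]_x h j x by exact: H.
elim: r => [|j r [IH1 IH2]].
  split; first by under eq_fun do rewrite big_nil; exact: integrable0.
  by under eq_Rintegral do rewrite big_nil; rewrite big_nil Rintegral_cst// mul0r.
split; first by under eq_fun do rewrite big_cons; exact: integrableDR.
by under eq_Rintegral do rewrite big_cons; rewrite big_cons RintegralD// IH2.
Qed.

(** The pairs [(p j, q j)] are orthonormal in the direct sum of two copies of real [L^2]. The
    squared distance from [(c, s)] to its projection [(P, Q)] on their span is nonnegative and
    equals the difference of the two sides. *)
Lemma bessel_real (J : finType) (p q : J -> T -> R) (c s : T -> R) :
  (forall j, square_integrable (p j)) -> (forall j, square_integrable (q j)) ->
  square_integrable c -> square_integrable s ->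
  (forall i j, \int[mu]_x (p i x * p j x + q i x * q j x) = (i == j)%:R) ->
  \sum_j (\int[mu]_x (p j x * c x + q j x * s x)) ^+ 2 <=
  \int[mu]_x (c x ^+ 2 + s x ^+ 2).
Proof.
move=> sp sq sc ss pq.
pose t j := \int[mu]_x (p j x * c x + q j x * s x).
pose P x := \sum_j t j * p j x; pose Q x := \sum_j t j * q j x.
have int1 j : mu.-integrable setT (EFin \o (fun x => p j x * c x + q j x * s x)).
  by apply: integrableDR; exact: square_integrable_mul.
have int2 i j : mu.-integrable setT (EFin \o (fun x => p i x * p j x + q i x * q j x)).
  by apply: integrableDR; exact: square_integrable_mul.
have int0 : mu.-integrable setT (EFin \o (fun x => c x ^+ 2 + s x ^+ 2)).
  by apply: integrableDR; [case: sc|case: ss].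
have [int3 E3] := Rintegral_sum (fun j => integrableZlR (t j) (int1 j)).
have [int4 E4] := Rintegral_sum
  (fun ij : J * J => integrableZlR (t ij.1 * t ij.2) (int2 ij.1 ij.2)).
have E : \int[mu]_x ((c x - P x) ^+ 2 + (s x - Q x) ^+ 2) =
    \int[mu]_x (c x ^+ 2 + s x ^+ 2) - \sum_j t j ^+ 2.
  transitivity (\int[mu]_x ((c x ^+ 2 + s x ^+ 2) -
      (2 * \sum_j t j * (p j x * c x + q j x * s x) -
      \sum_(ij : J * J) t ij.1 * t ij.2 * (p ij.1 x * p ij.2 x + q ij.1 x * q ij.2 x)))).
    apply: eq_Rintegral => x _.
    have -> : \sum_j t j * (p j x * c x + q j x * s x) = P x * c x + Q x * s x.
      by rewrite /P /Q !mulr_suml -big_split; apply: eq_bigr => j _ /=; ring.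
    have -> : \sum_(ij : J * J) t ij.1 * t ij.2 *
        (p ij.1 x * p ij.2 x + q ij.1 x * q ij.2 x) = P x ^+ 2 + Q x ^+ 2.
      rewrite !expr2 /P /Q !big_distrlr/= !pair_big -big_split.
      by apply: eq_bigr => -[i j] _ /=; ring.
    by ring.
  rewrite RintegralB//; last by apply: integrableBR => //; exact: integrableZlR.
  rewrite RintegralB//; last exact: integrableZlR.
  rewrite RintegralZl// E3 E4; congr (_ - _).
  have -> : \sum_j \int[mu]_x (t j * (p j x * c x + q j x * s x)) = \sum_j t j ^+ 2.
    by apply: eq_bigr => j _; rewrite RintegralZl// expr2.
  have -> : \sum_(ij : J * J) \int[mu]_x (t ij.1 * t ij.2 *
      (p ij.1 x * p ij.2 x + q ij.1 x * q ij.2 x)) = \sum_j t j ^+ 2.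
    rewrite (eq_bigr (fun ij : J * J => t ij.1 * t ij.2 * (ij.1 == ij.2)%:R)); last first.
      by move=> ij _; rewrite RintegralZl// pq.
    rewrite -(pair_big xpredT xpredT (fun i j => t i * t j * (i == j)%:R))/=.
    apply: eq_bigr => i _; rewrite (bigD1 i)//= eqxx mulr1 big1 ?addr0 ?expr2// => j ji.
    by rewrite eq_sym (negbTE ji) mulr0.
  by ring.
by rewrite -subr_ge0 -E; apply: Rintegral_ge0 => x _; rewrite addr_ge0 ?sqr_ge0.
Qed.

(* Over the reals, the system is doubled by multiplying its elements by [i]. *)
Lemma bessel_complex n (a b : 'I_n -> T -> R) (c s : T -> R) :
  (forall k, square_integrable (a k)) -> (forall k, square_integrable (b k)) ->
  square_integrable c -> square_integrable s ->
  (forall j k, \int[mu]_x (a j x * a k x + b j x * b k x) = (j == k)%:R) ->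
  (forall j k, \int[mu]_x (b j x * a k x - a j x * b k x) = 0) ->
  \sum_k ((\int[mu]_x (a k x * c x + b k x * s x)) ^+ 2 +
          (\int[mu]_x (b k x * c x - a k x * s x)) ^+ 2) <=
  \int[mu]_x (c x ^+ 2 + s x ^+ 2).
Proof.
move=> sa sb sc ss ortho1 ortho2.
(* The index [true] stands for [a + i b], the index [false] for [- i (a + i b) = b - i a]. *)
pose p (u : 'I_n * bool) := if u.2 then a u.1 else b u.1.
pose q (u : 'I_n * bool) := if u.2 then b u.1 else \- a u.1.
have sp u : square_integrable (p u) by rewrite /p; case: ifP.
have sq u : square_integrable (q u).
  by rewrite /q; case: ifP => // _; exact: square_integrableN.
have pq u v : \int[mu]_x (p u x * p v x + q u x * q v x) = (u == v)%:R.
  case: u v => [j []] [k []]; rewrite /p /q/= xpair_eqE ?andbT ?andbF.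
  - exact: ortho1.
  - rewrite -[RHS](ortho2 k j); apply: eq_Rintegral => x _; ring.
  - rewrite -[RHS](ortho2 j k); apply: eq_Rintegral => x _; ring.
  - rewrite -ortho1; apply: eq_Rintegral => x _; ring.
apply: le_trans (bessel_real sp sq sc ss pq).
rewrite -(pair_big xpredT xpredT (fun j e =>
  (\int[mu]_x (p (j, e) x * c x + q (j, e) x * s x)) ^+ 2))/=.
apply: ler_sum => k _; rewrite big_bool/= /p /q/= lerD2l.
by rewrite le_eqVlt; apply/orP; left; apply/eqP; congr (_ ^+ 2);
  apply: eq_Rintegral => x _; ring.
Qed.

End bessel.

(** * Finite energy of test functions *)

Section translation.
Context {R : realType} (n : nat).
Local Notation leb := (@lebesgue_rV R n).
Implicit Types a b : 'rV[R]_n -> R.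

Lemma dotpDl (x y z : 'rV[R]_n) : dotp (x + y) z = dotp x z + dotp y z.
Proof. by rewrite /dotp -big_split; apply: eq_bigr => i _; rewrite !mxE mulrDl. Qed.

Lemma dotpZl (c : R) (x y : 'rV[R]_n) : dotp (c *: x) y = c * dotp x y.
Proof. by rewrite /dotp mulr_sumr; apply: eq_bigr => i _; rewrite !mxE mulrA. Qed.

Lemma dotp_delta i (y : 'rV[R]_n) : dotp (delta_mx ord0 i) y = y ord0 i.
Proof.
rewrite /dotp (bigD1 i)//= mxE !eqxx mul1r big1 ?addr0// => j ji.
by rewrite mxE (negbTE ji) andbF mul0r.
Qed.

Lemma measurable_translation (h : 'rV[R]_n) : measurable_fun setT (fun x : 'rV[R]_n => x + h).
Proof. by have := @measurable_affine_rV R n 1 h; under eq_fun do rewrite scale1r. Qed.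

Lemma lebesgue_rV_translation (h : 'rV[R]_n) (A : set 'rV[R]_n) : measurable A ->
  (leb ((fun x => x + h)%R @^-1` A) = 1%:E * leb A)%E.
Proof.
move=> mA; have := @lebesgue_rV_affine R n 1 h A ltr01 mA.
by rewrite invr1 expr1n => <-; congr (leb _); apply/seteqP; split => x /=; rewrite scale1r.
Qed.

Lemma integrable_translation h (f : 'rV[R]_n -> R) : leb.-integrable setT (EFin \o f) ->
  leb.-integrable setT (EFin \o (fun x => f (x + h))).
Proof.
exact: (integrable_comp (measurable_translation h) ltr01 (lebesgue_rV_translation h)).
Qed.

Lemma Rintegral_translation h (f : 'rV[R]_n -> R) : leb.-integrable setT (EFin \o f) ->
  \int[leb]_x f (x + h) = \int[leb]_x f x.
Proof.
move=> intf; rewrite -[RHS]mul1r.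
exact: (Rintegral_comp (measurable_translation h) ltr01 (lebesgue_rV_translation h) intf).
Qed.

Lemma measurable_dotpl (xi : 'rV[R]_n) : measurable_fun setT (fun x : 'rV[R]_n => dotp x xi).
Proof. exact: (measurable_pair2 xi (@measurable_dotp R n)). Qed.

Lemma integrable_fre_kernel a b xi :
  leb.-integrable setT (EFin \o a) -> leb.-integrable setT (EFin \o b) ->
  leb.-integrable setT (EFin \o (fun x => a x * cos (dotp x xi) + b x * sin (dotp x xi))).
Proof. exact: (integrable_osc (measurable_dotpl xi)). Qed.

Lemma fre_combine a b xi (u v : R) :
  leb.-integrable setT (EFin \o a) -> leb.-integrable setT (EFin \o b) ->
  u * fre a b xi + v * fre b (\- a) xi =
  fre (fun x => u * a x + v * b x) (fun x => u * b x - v * a x) xi.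
Proof.
move=> inta intb; have intNa := integrableNR inta.
have I1 := integrable_fre_kernel xi inta intb.
have I2 := integrable_fre_kernel xi intb intNa.
rewrite /fre /osc -!RintegralZl// -RintegralD//; try exact: integrableZlR.
by apply: eq_Rintegral => x _ /=; ring.
Qed.

(** The real part of the rule that translation by [h] multiplies the transform by [e^(i h.xi)]. *)
Lemma fre_translation a b h xi :
  leb.-integrable setT (EFin \o a) -> leb.-integrable setT (EFin \o b) ->
  fre (fun x => a (x + h)) (fun x => b (x + h)) xi =
  cos (dotp h xi) * fre a b xi - sin (dotp h xi) * fre b (\- a) xi.
Proof.
move=> inta intb; rewrite -mulNr fre_combine//.
set u := cos _; set v := - sin _.
pose f y := (u * a y + v * b y) * cos (dotp y xi) + (u * b y - v * a y) * sin (dotp y xi).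
rewrite /fre /osc -[RHS](Rintegral_translation h); last first.
  apply: integrable_fre_kernel.
    by apply: integrableDR; exact: integrableZlR.
  by apply: integrableBR; exact: integrableZlR.
apply: eq_Rintegral => x _; rewrite dotpDl cosD sinD -/u.
rewrite (_ : sin (dotp h xi) = - v); last by rewrite /v opprK.
have uv : u ^+ 2 + v ^+ 2 = 1 by rewrite /u /v sqrrN cos2Dsin2.
set A := a _; set B := b _; set C := cos _; set S := sin _.
(* Inserting the factor [u^2 + v^2 = 1] makes both sides quadratic in [u] and [v], hence a
   polynomial identity. *)
have -> : A * C + B * S = (u ^+ 2 + v ^+ 2) * (A * C + B * S) by rewrite uv mul1r.
by ring.
Qed.

Lemma freB a b a' b' xi :
  leb.-integrable setT (EFin \o a) -> leb.-integrable setT (EFin \o b) ->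
  leb.-integrable setT (EFin \o a') -> leb.-integrable setT (EFin \o b') ->
  fre (fun x => a x - a' x) (fun x => b x - b' x) xi = fre a b xi - fre a' b' xi.
Proof.
move=> inta intb inta' intb'; rewrite /fre /osc -RintegralB//; last 2 first.
- exact: integrable_fre_kernel.
- exact: integrable_fre_kernel.
by apply: eq_Rintegral => x _ /=; ring.
Qed.

(** The squared modulus of the Fourier transform of [a + i b]. *)
Definition specdensc a b xi : R := fre a b xi ^+ 2 + fre b (\- a) xi ^+ 2.

Lemma specdensc_ge0 a b xi : 0 <= specdensc a b xi.
Proof. by rewrite addr_ge0 ?sqr_ge0. Qed.

Lemma measurable_specdensc a b : measurable_fun setT a -> measurable_fun setT b ->
  measurable_fun setT (specdensc a b).
Proof.
move=> ma mb; have mNa : measurable_fun setT (\- a) by exact: measurableT_comp.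
by apply: measurable_funD; apply: measurable_funX; exact: measurable_fre.
Qed.

(** The factor is [|e^(i h.xi) - 1|^2]. *)
Lemma specdensc_increment a b h xi :
  leb.-integrable setT (EFin \o a) -> leb.-integrable setT (EFin \o b) ->
  specdensc (fun x => a (x + h) - a x) (fun x => b (x + h) - b x) xi =
  (2 - 2 * cos (dotp h xi)) * specdensc a b xi.
Proof.
move=> inta intb.
have [inta' intb'] := (integrable_translation h inta, integrable_translation h intb).
have intNa : leb.-integrable setT (EFin \o (\- a)) := integrableNR inta.
have intNa' : leb.-integrable setT (EFin \o (fun x => (\- a) (x + h))) :=
  integrable_translation h intNa.
rewrite /specdensc freB// fre_translation//.
have -> : \- (fun x => a (x + h) - a x) = (fun x => (\- a) (x + h) - (\- a) x).
  by apply/funext => x /=; rewrite opprB opprK addrC.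
rewrite freB//.
rewrite fre_translation//.
have -> : fre (\- a) (\- b) xi = - fre a b xi.
  rewrite /fre /osc -RintegralN; apply: eq_Rintegral => x _ /=; ring.
have := cos2Dsin2 (dotp h xi); set u := cos _; set v := sin _ => uv.
have -> : 2 - 2 * u = (u - 1) ^+ 2 + v ^+ 2.
  by rewrite -[v ^+ 2](addKr (u ^+ 2)) uv; ring.
by ring.
Qed.

End translation.

(** * Logarithmic energy of Lipschitz functions supported in a cube *)

Section log_energy.
Context {R : realType} (n : nat).
Local Notation leb := (@lebesgue_rV R n).
Implicit Types a b : 'rV[R]_n -> R.

Lemma integrable_bounded_cube (f : 'rV[R]_n -> R) (M K : R) : 0 <= K ->
  measurable_fun setT f -> (forall x, `|f x| <= M) ->
  (forall x, ~ cube K x -> f x = 0) -> leb.-integrable setT (EFin \o f).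
Proof.
move=> K0 mf fM f0.
have mc := @measurable_cube R n K.
apply: (le_integrableR (g := fun x => M * \1_(cube K) x)) => //.
- move=> x; rewrite indicE; case: (boolP (x \in cube K)) => xK; first by rewrite mulr1.
  by rewrite mulr0 f0 ?normr0//; move: xK; rewrite notin_setE.
- apply: integrableZlR; apply: integrable_ge0 => //.
  by rewrite integral_indic// setIT lebesgue_rV_cube.
Qed.

(** With [2 - 2 cos (r c) = 4 sin^2 (r c / 2)], this is the square of the difference quotient at [0]
    of the function [h |-> sin (h c / 2)], up to the factor [4]. *)
Lemma cvg_cos_quotient (c : R) :
  (rate m) ^- 2 * (2 - 2 * cos (rate m * c)) @[m --> \oo] --> c ^+ 2.
Proof.
have dS : is_derive (0 : R) (1 : R) (fun h : R => sin (h * (c / 2))) (c / 2).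
  have d1 : is_derive (0 : R) (1 : R) (fun h : R => h * (c / 2)) (c / 2).
    have := is_deriveM (is_derive_id (0 : R) (1:R)) (is_derive_cst (c / 2) (0 : R) (1:R)).
    by move=> /is_derive_eq; apply; rewrite /GRing.scale/= mul0r add0r mulr1.
  have := @is_derive1_comp R sin (fun h : R => h * (c / 2)) 0 _ _ (is_derive_sin _) d1.
  by move=> /is_derive_eq; apply; rewrite mul0r cos0 mul1r.
have /cvgr_dnbhsP : (fun h => h^-1 * sin (h * (c / 2))) h @[h --> 0^'] --> c / 2.
  have [dd dE] := dS; rewrite -[X in _ --> X]dE /derive.
  have H := dd; rewrite /derivable in H; move/cvg_ex : H => [l cl].
  rewrite (cvg_lim _ cl)//; move: cl; apply: cvg_trans; apply: near_eq_cvg.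
  by apply: nearW => h; rewrite /= mul0r sin0 subr0 addr0 [h *: _]mulr1.
move=> /(_ (@rate R)) H.
have {}H : (rate m)^-1 * sin (rate m * (c / 2)) @[m --> \oo] --> c / 2.
  by apply: H; split; [move=> m; rewrite lt0r_neq0// rate_gt0|exact: cvg_rate].
have -> : c ^+ 2 = 4 * ((c / 2) * (c / 2)) by field.
have : 4 * (((rate m)^-1 * sin (rate m * (c / 2))) * ((rate m)^-1 * sin (rate m * (c / 2))))
    @[m --> \oo] --> 4 * ((c / 2) * (c / 2)).
  by apply: cvgM; [exact: cvg_cst|exact: cvgM].
apply: cvg_trans; apply: near_eq_cvg; apply: nearW => m.
have -> : cos (rate m * c) = 1 - 2 * sin (rate m * (c / 2)) ^+ 2.
  have -> : rate m * c = (rate m * (c / 2)) *+ 2 by rewrite mulr2n; field.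
  by rewrite cos_mulr2n cos2sin2; ring.
by have := rate_gt0 (R := R) m; set r := rate m => r0; field; rewrite lt0r_neq0.
Qed.

Section coordinate.
Variables (a b : 'rV[R]_n -> R) (i : 'I_n) (M K : R).
Hypotheses (K0 : 0 <= K) (M0 : 0 <= M).
Hypotheses (inta : leb.-integrable setT (EFin \o a)) (intb : leb.-integrable setT (EFin \o b)).
Let e : 'rV[R]_n := delta_mx ord0 i.
Hypothesis lipa : forall x h, 0 < h -> `|a (x + h *: e) - a x| <= M * h.
Hypothesis lipb : forall x h, 0 < h -> `|b (x + h *: e) - b x| <= M * h.
Hypothesis a0 : forall x, ~ cube K x -> a x = 0.
Hypothesis b0 : forall x, ~ cube K x -> b x = 0.

Let rate_le1 m : rate m <= 1 :> R.
Proof. by rewrite invf_le1 ?ler1n// ltr0n. Qed.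

Let incr f m (x : 'rV[R]_n) : R := f (x + rate m *: e) - f x.

(** The steps are at most [1], so all increments live in one enlarged cube, whose finite measure
    bounds them uniformly in [m]. *)
Let incr0 f m x : (forall x, ~ cube K x -> f x = 0) -> ~ cube (K + 1) x -> incr f m x = 0.
Proof.
move=> f0 xK; rewrite /incr.
have -> : f x = 0.
  by apply: f0 => xK'; apply: xK => j; rewrite (le_trans (xK' j))// lerDl.
rewrite f0 ?subrr// => xK'; apply: xK => j.
have := xK' j.
have -> : (x + rate m *: e) ord0 j = x ord0 j + rate m * e ord0 j by rewrite !mxE.
move=> h1.
have h2 : `|rate m * e ord0 j| <= 1.
  rewrite normrM; apply: mulr_ile1 => //.
    by rewrite (gtr0_norm (rate_gt0 m)) rate_le1.
  by rewrite mxE normr_nat lern1; case: (_ && _).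
rewrite -(addrK (rate m * e ord0 j) (x ord0 j)) (le_trans (ler_normB _ _))//.
exact: lerD.
Qed.

Let measurable_incr (f : 'rV[R]_n -> R) (m : nat) :
  measurable_fun setT f -> measurable_fun setT (incr f m).
Proof.
move=> mf; apply: measurable_funB => //.
by apply: (measurableT_comp mf); exact: measurable_translation.
Qed.

Let integral_incr (f : 'rV[R]_n -> R) (m : nat) : measurable_fun setT f ->
  (forall x h, 0 < h -> `|f (x + h *: e) - f x| <= M * h) ->
  (forall x, ~ cube K x -> f x = 0) ->
  [/\ leb.-integrable setT (EFin \o incr f m),
      leb.-integrable setT (EFin \o (fun x => incr f m x ^+ 2)) &
      (\int[leb]_x (incr f m x ^+ 2)%:E <= ((M * rate m) ^+ 2)%:E * leb (cube (K + 1)))%E].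
Proof.
move=> mf lipf f0; have K10 : 0 <= K + 1 by rewrite addr_ge0.
have bnd x : `|incr f m x| <= M * rate m by exact: lipf (rate_gt0 m).
have mi := measurable_incr m mf.
have mc := @measurable_cube R n (K + 1).
split.
- by apply: (integrable_bounded_cube K10 mi bnd) => x; exact: incr0.
- apply: (integrable_bounded_cube (M := (M * rate m) ^+ 2) K10).
  + exact: measurable_funX.
  + by move=> x; rewrite ger0_norm ?sqr_ge0//; exact: sqr_le_norm.
  + by move=> x xK; rewrite incr0// expr0n.
- rewrite -(setIT (cube _)) -(integral_indic leb measurableT mc) -ge0_integralZl//; last 2 first.
  + by apply/measurable_EFinP; exact: measurable_indic.
  + by rewrite lee_fin sqr_ge0.
  apply: ge0_le_integral => //.
  + by move=> x _; rewrite lee_fin sqr_ge0.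
  + by apply/measurable_EFinP; exact: measurable_funX.
  + by apply: emeasurable_funM => //; apply/measurable_EFinP; exact: measurable_indic.
  + move=> x _; rewrite -EFinM lee_fin indicE.
    case: (boolP (x \in cube _)) => xK; first by rewrite mulr1 sqr_le_norm.
    by rewrite incr0 ?expr0n ?mulr0//; move: xK; rewrite notin_setE.
Qed.

(* Plancherel for the difference quotients, then Fatou as the step tends to 0. *)
Lemma integral_coord_energy_lty :
  (\int[leb]_xi (xi ord0 i ^+ 2 * specdensc a b xi)%:E < +oo)%E.
Proof.
have [ma mb] := (integrable_measurable inta, integrable_measurable intb).
(* The factor [(2 pi)^n] comes from Plancherel and [2 M^2] from the Lipschitz bounds of [a] and [b];
   the squared step cancels in the difference quotient. *)
pose C := (((2 * pi) ^+ n * (2 * M ^+ 2))%:E * leb (cube (K + 1)))%E.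
have Coo : (C < +oo)%E.
  rewrite /C lte_mul_pinfty ?lee_fin ?mulr_ge0 ?exprn_ge0 ?pi_ge0 ?sqr_ge0//.
    by rewrite mulr_ge0// pi_ge0.
  by rewrite lebesgue_rV_cube// addr_ge0.
apply: le_lt_trans Coo.
have ms := measurable_specdensc ma mb.
have mq m : measurable_fun setT
    (fun xi : 'rV[R]_n => (rate m) ^- 2 * (2 - 2 * cos (rate m * xi ord0 i)) : R).
  apply: measurable_funM => //; apply: measurable_funB => //; apply: measurable_funM => //.
  apply: (measurableT_comp measurable_cos); apply: measurable_funM => //.
  exact: measurable_coord_rV.
have q0 m (xi : 'rV[R]_n) : 0 <= (rate m) ^- 2 * (2 - 2 * cos (rate m * xi ord0 i)) :> R.
  by rewrite mulr_ge0// ?invr_ge0 ?sqr_ge0.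
apply: (@ge0_integral_lim_le _ _ _ leb setT (fun m xi =>
  ((rate m) ^- 2 * (2 - 2 * cos (rate m * xi ord0 i)) * specdensc a b xi)%:E)) => //.
- by move=> m; apply/measurable_EFinP; exact: measurable_funM.
- by move=> m xi _; rewrite lee_fin mulr_ge0 ?specdensc_ge0.
- apply/measurable_EFinP; apply: measurable_funM => //; apply: measurable_funX.
  exact: measurable_coord_rV.
- by move=> xi _; rewrite lee_fin mulr_ge0 ?specdensc_ge0 ?sqr_ge0.
- apply: nearW => xi _; apply: cvg_EFin; first exact: nearW.
  by apply: cvgM; [exact: cvg_cos_quotient|exact: cvg_cst].
move=> m; have [ia1 ia2 ia3] := integral_incr m ma lipa a0.
have [ib1 ib2 ib3] := integral_incr m mb lipb b0.
have r0 : 0 < rate m :> R := rate_gt0 m.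
have E (xi : 'rV[R]_n) : (rate m) ^- 2 * (2 - 2 * cos (rate m * xi ord0 i)) * specdensc a b xi =
    (rate m) ^- 2 * specdensc (incr a m) (incr b m) xi.
  by rewrite /incr specdensc_increment// dotpZl dotp_delta mulrA.
under eq_integral do rewrite E EFinM.
rewrite ge0_integralZl//; last 3 first.
- by apply/measurable_EFinP; apply: measurable_specdensc; exact: measurable_incr.
- by move=> xi _; rewrite lee_fin specdensc_ge0.
- by rewrite lee_fin invr_ge0 sqr_ge0.
rewrite plancherel_rV//.
under eq_integral do rewrite EFinD.
rewrite ge0_integralD//; first last.
- exact: measurable_int ib2.
- by move=> x _; rewrite lee_fin sqr_ge0.
- exact: measurable_int ia2.
- by move=> x _; rewrite lee_fin sqr_ge0.
rewrite muleA -EFinM.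
apply: (@le_trans _ _ (((rate m) ^- 2 * (2 * pi) ^+ n)%:E *
  (((M * rate m) ^+ 2)%:E * leb (cube (K + 1)) + ((M * rate m) ^+ 2)%:E * leb (cube (K + 1))))%E).
  apply: lee_wpmul2l; last exact: leeD.
  by rewrite lee_fin mulr_ge0 ?invr_ge0 ?sqr_ge0 ?exprn_ge0// mulr_ge0 ?pi_ge0.
rewrite -ge0_muleDl ?lee_fin ?sqr_ge0// -EFinD muleA -EFinM /C.
rewrite le_eqVlt; apply/orP; left; apply/eqP; congr (_%:E * _)%E.
by field; rewrite lt0r_neq0.
Qed.

End coordinate.

(** From [ln y <= y - 1] at [y = e + |xi|] and [|xi| - 1 <= |xi|^2]. The logarithmic energy is thus
    bounded by the [L^2] norm and the energies in the single coordinates. *)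
Lemma ln_e_enorm_le (xi : 'rV[R]_n) :
  ln (expR 1 + enorm xi) <= expR 1 + \sum_(i < n) xi ord0 i ^+ 2.
Proof.
rewrite -enorm_sqr; have := enorm_ge0 xi; set r := enorm xi => r0.
have e0 : 0 < expR 1 :> R by exact: expR_gt0.
have := @le_ln1Dx R (expR 1 + r - 1).
have -> : 1 + (expR 1 + r - 1) = expR 1 + r by ring.
move=> H; by have {}H := H ltac:(lra); have := sqr_ge0 (r - 1); nra.
Qed.

Lemma integral_log_energy_lty a b (M K : R) : 0 <= K -> 0 <= M ->
  measurable_fun setT a -> measurable_fun setT b ->
  (forall x, `|a x| <= M) -> (forall x, `|b x| <= M) ->
  (forall i x h, 0 < h -> `|a (x + h *: delta_mx ord0 i) - a x| <= M * h) ->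
  (forall i x h, 0 < h -> `|b (x + h *: delta_mx ord0 i) - b x| <= M * h) ->
  (forall x, ~ cube K x -> a x = 0) -> (forall x, ~ cube K x -> b x = 0) ->
  (\int[leb]_xi (ln (expR 1 + enorm xi) * specdensc a b xi)%:E < +oo)%E.
Proof.
move=> K0 M0 ma mb aM bM lipa lipb a0 b0.
have inta := integrable_bounded_cube K0 ma aM a0.
have intb := integrable_bounded_cube K0 mb bM b0.
have sq (f : 'rV[R]_n -> R) : measurable_fun setT f -> (forall x, `|f x| <= M) ->
    (forall x, ~ cube K x -> f x = 0) -> leb.-integrable setT (EFin \o (fun x => f x ^+ 2)).
  move=> mf fM f0; apply: (integrable_bounded_cube (M := M ^+ 2) K0).
  - exact: measurable_funX.
  - by move=> x; rewrite ger0_norm ?sqr_ge0//; exact: sqr_le_norm.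
  - by move=> x xK; rewrite f0// expr0n.
have [inta2 intb2] := (sq _ ma aM a0, sq _ mb bM b0).
have ms := measurable_specdensc ma mb.
have e0 : 0 <= expR 1 :> R by exact: expR_ge0.
have mcoord i : measurable_fun setT (fun xi : 'rV[R]_n => xi ord0 i ^+ 2).
  by apply: measurable_funX; exact: measurable_coord_rV.
have mln : measurable_fun setT (fun xi : 'rV[R]_n => ln (expR 1 + enorm xi)).
  apply: measurableT_comp => //; apply: measurable_funD => //; exact: measurable_enorm.
have ln0 (xi : 'rV[R]_n) : 0 <= ln (expR 1 + enorm xi).
  by rewrite ln_ge0// (@le_trans _ _ (expR 1))// ?lerDl ?enorm_ge0// -{1}expR0 ler_expR.
apply: (@le_lt_trans _ _ (\int[leb]_xi ((expR 1)%:E * (specdensc a b xi)%:E +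
   \sum_(i < n) (xi ord0 i ^+ 2 * specdensc a b xi)%:E))%E).
  apply: ge0_le_integral => //.
  - by move=> xi _; rewrite lee_fin mulr_ge0 ?specdensc_ge0.
  - by apply/measurable_EFinP; exact: measurable_funM.
  - apply: emeasurable_funD.
      by apply: emeasurable_funM => //; exact/measurable_EFinP.
    apply: emeasurable_sum => i; apply/measurable_EFinP; exact: measurable_funM.
  - move=> xi _; rewrite sumEFin -EFinM -EFinD lee_fin -mulr_suml -mulrDl.
    by rewrite ler_wpM2r ?specdensc_ge0// ln_e_enorm_le.
rewrite ge0_integralD//; first last.
- by apply: emeasurable_sum => i; apply/measurable_EFinP; exact: measurable_funM.
- by move=> xi _; apply: sume_ge0 => i _; rewrite lee_fin mulr_ge0 ?specdensc_ge0 ?sqr_ge0.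
- by apply: emeasurable_funM => //; exact/measurable_EFinP.
- by move=> xi _; rewrite -EFinM lee_fin mulr_ge0 ?specdensc_ge0.
rewrite ge0_integralZl//; last 2 first.
- exact/measurable_EFinP.
- by move=> xi _; rewrite lee_fin specdensc_ge0.
rewrite lte_add_pinfty//.
  rewrite lte_mul_pinfty ?lee_fin// plancherel_rV// lte_mul_pinfty//.
    by rewrite lee_fin exprn_ge0// mulr_ge0 ?pi_ge0.
  have := integrable_norm_lty (integrableDR inta2 intb2).
  by under eq_integral do rewrite ger0_norm ?addr_ge0 ?sqr_ge0//.
rewrite ge0_integral_sum//; last 2 first.
- by move=> i; apply/measurable_EFinP; exact: measurable_funM.
- by move=> i xi _; rewrite lee_fin mulr_ge0 ?specdensc_ge0 ?sqr_ge0.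
apply: lte_sum_pinfty => i _.
exact: (integral_coord_energy_lty (M := M) (K := K) K0 M0 inta intb (lipa i) (lipb i)).
Qed.

End log_energy.

(** * Bounds for smooth functions of compact support *)

Section test_functions.
Context {R : realType} (n : nat).
Local Notation leb := (@lebesgue_rV R n).
Local Notation Rn := 'rV[R]_n.

Lemma normr_coord_le (x : Rn) i : `|x ord0 i| <= `|x|.
Proof.
rewrite /Num.Def.normr/= mx_normrE.
exact: (le_bigmax _ (fun ij : 'I_1 * 'I_n => `|x ij.1 ij.2|) (ord0, i)).
Qed.

Lemma compact_sub_cube (S : set Rn) : compact S -> exists2 K : R, 0 <= K & S `<=` cube K.
Proof.
move=> cS; have /pinfty_ex_gt0[K K0 SK] := compact_bounded cS.
by exists K; [exact: ltW|move=> x Sx i; exact: le_trans (normr_coord_le x i) (SK x Sx)].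
Qed.

Lemma bounded_of_compact_support (S : set Rn) (f : Rn -> R) : compact S ->
  continuous f -> (forall x, ~ S x -> f x = 0) ->
  exists2 M : R, 0 <= M & forall x, `|f x| <= M.
Proof.
move=> cS cf f0.
have cfS : compact [set f x | x in S].
  by apply: continuous_compact => //; exact: continuous_subspaceT.
have /pinfty_ex_gt0[M M0 SM] := compact_bounded cfS.
exists M; first exact: ltW.
move=> x; have [Sx|Sx] := pselect (S x); last by rewrite f0// normr0 ltW.
by apply: SM; exists x.
Qed.

(** Differentiation is local and the complement of [S] is open. Partial derivatives thus inherit the
    compact support, and with it boundedness. *)
Lemma partial_eq0 (S : set Rn) (f : Rn -> R) i : closed S ->
  (forall x, ~ S x -> f x = 0) -> forall x, ~ S x -> partial i f x = 0.
Proof.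
move=> clS f0 x Sx; rewrite /partial.
rewrite (@near_eq_derive _ _ _ _ (cst 0)); first exact: derive_cst.
have : nbhs x (~` S) by apply: open_nbhs_nbhs; split => //; exact: closed_openC.
by apply: filterS => y Sy; rewrite f0.
Qed.

Lemma is_derive_line (f : Rn -> R) (v x : Rn) (t : R) :
  derivable f (x + t *: v) v ->
  is_derive t (1 : R) (fun s : R => f (x + s *: v)) ('D_v f (x + t *: v)).
Proof.
have E : (fun h : R => h^-1 *: (f (x + (h *: (1 : R) + t) *: v) - f (x + t *: v))) =
         (fun h : R => h^-1 *: (f (h *: v + (x + t *: v)) - f (x + t *: v))).
  apply/funext => h; congr (_ *: (f _ - _)).
  by rewrite [h *: (1 : R)]mulr1 scalerDl addrCA.
by move=> df; split; rewrite /derivable/= ?/derive/= E.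
Qed.

Lemma lipschitz_of_partial (f : Rn -> R) i (M : R) :
  (forall x, derivable f x (delta_mx ord0 i)) -> (forall x, `|partial i f x| <= M) ->
  forall x h, 0 < h -> `|f (x + h *: delta_mx ord0 i) - f x| <= M * h.
Proof.
move=> df dM x h h0; set v := delta_mx _ _.
have dg (t : R) := is_derive_line (df (x + t *: v)).
have cg : {within `[0, h], continuous (fun s : R => f (x + s *: v))}.
  apply: continuous_subspaceT => t.
  by apply/differentiable_continuous/derivable1_diffP; have [] := dg t.
have [c _] := MVT h0 (fun t _ => dg t) cg.
rewrite scale0r addr0 subr0 => ->; rewrite normrM (gtr0_norm h0) ler_wpM2r ?(ltW h0)//.
exact: dM.
Qed.

Lemma smooth_compact_support_bounds (S : set Rn) (f : Rn -> R) : compact S -> closed S ->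
  smooth f -> (forall x, ~ S x -> f x = 0) ->
  exists M : R, [/\ 0 <= M, forall x, `|f x| <= M &
    forall i x h, 0 < h -> `|f (x + h *: delta_mx ord0 i) - f x| <= M * h].
Proof.
move=> cS clS sf f0.
(* The empty list gives continuity and partial derivatives of [f] itself; a list [[:: i]] will give
   continuity of the partial derivative in direction [i]. *)
have [cf df] := sf [::].
have [M0 M00 fM0] := bounded_of_compact_support cS cf f0.
have /choice[m mP] : forall i : 'I_n, exists m : R, 0 <= m /\ forall x, `|partial i f x| <= m.
  move=> i; have [cp _] := sf [:: i].
  have [m m0 fm] := bounded_of_compact_support cS cp (partial_eq0 i clS f0).
  by exists m.
have sm0 : 0 <= \sum_i m i by apply: sumr_ge0 => i _; have [] := mP i.
exists (M0 + \sum_i m i); split.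
- by rewrite addr_ge0.
- by move=> x; rewrite (le_trans (fM0 x))// lerDl.
- move=> i x h h0; have [_ pm] := mP i.
  rewrite (le_trans (lipschitz_of_partial (df i) pm x h0))// ler_wpM2r ?(ltW h0)//.
  rewrite (bigD1 i)//= addrCA lerDl addr_ge0// sumr_ge0// => j _.
  by have [] := mP j.
Qed.

End test_functions.

(** * Eigenvalue bound *)

Section complex_bridge.
Context {R : realType} (n : nat).
Local Notation leb := (@lebesgue_rV R n).
Local Notation Rn := 'rV[R]_n.
Implicit Types (phi psi u : Rn -> R[i]) (Omega : set Rn).

Definition re phi (x : Rn) : R := complex.Re (phi x).
Definition im phi (x : Rn) : R := complex.Im (phi x).

Lemma Re_fourier phi xi : complex.Re (fourier phi xi) = fre (re phi) (im phi) xi.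
Proof.
rewrite /fourier /cintegral/=; apply: eq_Rintegral => x _.
by rewrite /re /im; case: (phi x) => a b /=; ring.
Qed.

Lemma Im_fourier phi xi : complex.Im (fourier phi xi) = fre (im phi) (\- re phi) xi.
Proof.
rewrite /fourier /cintegral/=; apply: eq_Rintegral => x _.
by rewrite /re /im/=; case: (phi x) => a b /=; ring.
Qed.

Lemma normc_sqr (z : R[i]) : Normc.normc z ^+ 2 = complex.Re z ^+ 2 + complex.Im z ^+ 2.
Proof. by case: z => a b /=; rewrite sqr_sqrtr// addr_ge0 ?sqr_ge0. Qed.

Definition sd phi (xi : Rn) : R := specdensc (re phi) (im phi) xi.

Lemma normc_fourier_sqr phi xi : Normc.normc (fourier phi xi) ^+ 2 = sd phi xi.
Proof. by rewrite normc_sqr Re_fourier Im_fourier. Qed.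

Lemma star_normsqE phi :
  star_normsq phi = (\int[leb]_xi (ln (expR 1 + enorm xi) * sd phi xi)%:E)%E.
Proof. by apply: eq_integral => xi _; rewrite normc_fourier_sqr. Qed.

Lemma L2_measurable Omega phi : L2 Omega phi ->
  measurable_fun setT (re phi) /\ measurable_fun setT (im phi).
Proof. by move=> [[]]. Qed.

Lemma L2_square_integrable Omega phi : L2 Omega phi ->
  square_integrable leb (re phi) /\ square_integrable leb (im phi).
Proof.
move=> L2phi; have [mr mi] := L2_measurable L2phi.
have [_ oo _] := L2phi.
have int : leb.-integrable setT (EFin \o (fun x => re phi x ^+ 2 + im phi x ^+ 2)).
  apply: integrable_ge0.
  - by apply: measurable_funD; exact: measurable_funX.
  - by move=> x; rewrite addr_ge0 ?sqr_ge0.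
  - by under eq_integral do rewrite /re /im -normc_sqr.
split; split => //; apply: le_integrableR int.
- exact: measurable_funX.
- by move=> x; rewrite ger0_norm ?sqr_ge0// lerDl sqr_ge0.
- exact: measurable_funX.
- by move=> x; rewrite ger0_norm ?sqr_ge0// lerDr sqr_ge0.
Qed.

Section finite_measure.
Variable Omega : set Rn.
Hypotheses (mOmega : measurable Omega) (Omega_fin : (leb Omega < +oo)%E).

Lemma Rintegral_ae_support (f : Rn -> R) : measurable_fun setT f ->
  {ae leb, forall x, ~ Omega x -> f x = 0} ->
  \int[leb]_(x in Omega) f x = \int[leb]_x f x.
Proof.
move=> mf f0; rewrite Rintegral_mkcond; congr fine; apply: ae_eq_integral => //.
- by apply/measurable_EFinP/(measurable_restrictT _ _).1 => //; exact: measurable_funTS.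
- exact/measurable_EFinP.
- apply: filterS f0 => x /= f0x _; rewrite patchE; case: ifPn => //.
  by rewrite notin_setE => /f0x ->.
Qed.

(** Almost everywhere [|f| <= 1 + f^2] on Omega and [f = 0] outside, and the indicator of Omega is
    integrable because Omega has finite measure. *)
Lemma square_integrable_integrable (f : Rn -> R) : square_integrable leb f ->
  {ae leb, forall x, ~ Omega x -> f x = 0} -> leb.-integrable setT (EFin \o f).
Proof.
move=> [mf f2] f0; apply/integrableP; split; first exact/measurable_EFinP.
have mI : measurable_fun setT (\1_Omega : Rn -> R) by exact: measurable_indic.
have int1 : leb.-integrable setT (EFin \o (fun x => \1_Omega x + f x ^+ 2)).
  apply: integrableDR => //; apply: integrable_ge0 => //.
  by rewrite integral_indic// setIT.
have [m1 _] := integrableP _ _ _ int1.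
apply: le_lt_trans (integrable_norm_lty int1).
apply: ae_ge0_le_integral => //.
- by apply/measurable_EFinP; exact: measurableT_comp.
- by apply/measurable_EFinP; apply: measurableT_comp => //; exact/measurable_EFinP.
- apply: filterS f0 => x /= f0x _; rewrite lee_fin [leRHS]ger0_norm ?addr_ge0 ?sqr_ge0//.
  rewrite indicE; case: (boolP (x \in Omega)) => xO.
    rewrite -(real_normK (num_real (f x))) (_ : true%:R = 1 :> R)//.
    by have := sqr_ge0 (`|f x| - 1); have := normr_ge0 (f x); nra.
  by move: xO; rewrite notin_setE => /f0x ->; rewrite normr0 expr0n addr0.
Qed.

Lemma L2_ae_support phi : L2 Omega phi ->
  {ae leb, forall x, ~ Omega x -> re phi x = 0 /\ im phi x = 0}.
Proof.
move=> [_ _]; apply: filterS => x H xO; rewrite /re /im H//.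
Qed.

Lemma L2_integrable phi : L2 Omega phi ->
  leb.-integrable setT (EFin \o re phi) /\ leb.-integrable setT (EFin \o im phi).
Proof.
move=> L2phi; have [sr si] := L2_square_integrable L2phi.
have s0 := L2_ae_support L2phi; split.
- apply: square_integrable_integrable => //.
  by apply: filterS s0 => x H xO; have [] := H xO.
- apply: square_integrable_integrable => //.
  by apply: filterS s0 => x H xO; have [] := H xO.
Qed.

Lemma test_function_star u : test_function Omega u ->
  [/\ leb.-integrable setT (EFin \o re u), leb.-integrable setT (EFin \o im u) &
      (star_normsq u < +oo)%E].
Proof.
move=> [sr si cS _]; set S := closure _ in cS.
have clS : closed S by exact: closed_closure.
have u0 x : ~ S x -> u x = 0.
  by move=> xS; apply/eqP/negPn/negP => ux; apply: xS; exact: subset_closure.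
have r0 x : ~ S x -> re u x = 0 by move=> /u0; rewrite /re => ->.
have i0 x : ~ S x -> im u x = 0 by move=> /u0; rewrite /im => ->.
have [M1 [M10 rM1 rl]] := smooth_compact_support_bounds cS clS sr r0.
have [M2 [M20 iM2 il]] := smooth_compact_support_bounds cS clS si i0.
have [K K0 SK] := compact_sub_cube cS.
have r0K x : ~ cube K x -> re u x = 0 by move=> xK; apply: r0 => /SK.
have i0K x : ~ cube K x -> im u x = 0 by move=> xK; apply: i0 => /SK.
have mr : measurable_fun setT (re u).
  by apply: continuous_measurable_rV; have [] := sr [::].
have mi : measurable_fun setT (im u).
  by apply: continuous_measurable_rV; have [] := si [::].
split.
- exact: integrable_bounded_cube K0 mr rM1 r0K.
- exact: integrable_bounded_cube K0 mi iM2 i0K.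
- rewrite star_normsqE; apply: (integral_log_energy_lty (M := M1 + M2) K0) => //.
  + by rewrite addr_ge0.
  + by move=> x; rewrite (le_trans (rM1 x))// lerDl.
  + by move=> x; rewrite (le_trans (iM2 x))// lerDr.
  + by move=> i x h h0; rewrite (le_trans (rl i x h h0))// ler_wpM2r ?(ltW h0)// lerDl.
  + by move=> i x h h0; rewrite (le_trans (il i x h h0))// ler_wpM2r ?(ltW h0)// lerDr.
Qed.

Lemma sd_ge0 phi xi : 0 <= sd phi xi. Proof. exact: specdensc_ge0. Qed.

Lemma L2_measurable_sd phi : L2 Omega phi -> measurable_fun setT (sd phi).
Proof. by move=> /L2_measurable[mr mi]; exact: measurable_specdensc. Qed.

Lemma measurable_log_weight : measurable_fun setT (fun xi : Rn => ln (expR 1 + enorm xi) : R).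
Proof.
by apply: measurableT_comp => //; apply: measurable_funD => //; exact: measurable_enorm.
Qed.

Lemma log_weight_ge0 (xi : Rn) : 0 <= ln (expR 1 + enorm xi) :> R.
Proof.
by rewrite ln_ge0// (@le_trans _ _ (expR 1))// ?lerDl ?enorm_ge0// -{1}expR0 ler_expR.
Qed.

(* Without this, the integral defining [log_form phi phi] could be [+oo], for
   which the library's real-valued integral returns the junk value 0. *)
Lemma form_domain_star phi : form_domain Omega phi -> (star_normsq phi < +oo)%E.
Proof.
move=> [L2phi [u [tu cu]]].
(* Convergence to [0] in the extended reals makes the terms finite from some index on; one such [k]
   suffices. *)
have /fine_cvgP[[k _ fink] _] := cu.
have wk : (star_normsq (fun x => (u k x - phi x)%R) < +oo)%E.
  by have /fin_numPlt/andP[] := fink k (leqnn k).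
have [inur inui uoo] := test_function_star (tu k).
have [inpr inpi] := L2_integrable L2phi.
have [mur mui] := (integrable_measurable inur, integrable_measurable inui).
have [mpr mpi] := L2_measurable L2phi.
have msd : measurable_fun setT (sd phi) by exact: L2_measurable_sd L2phi.
have msu : measurable_fun setT (sd (u k)) by exact: measurable_specdensc.
pose w x := u k x - phi x.
have rw : re w = fun x => re (u k) x - re phi x.
  by apply/funext => x; rewrite /w /re; case: (u k x) => ? ?; case: (phi x).
have iw : im w = fun x => im (u k) x - im phi x.
  by apply/funext => x; rewrite /w /im; case: (u k x) => ? ?; case: (phi x).
have msw : measurable_fun setT (sd w).
  by apply: measurable_specdensc; rewrite ?rw ?iw; exact: measurable_funB.
(* Since [phi = u k - w]; the two sides differ by the squared modulus of the transform of
   [2 u k - phi]. *)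
have bound xi : sd phi xi <= 2 * sd w xi + 2 * sd (u k) xi.
  rewrite /sd /specdensc rw iw freB//.
  rewrite (_ : \- (fun x => re (u k) x - re phi x) =
    (fun x => (\- re (u k)) x - (\- re phi) x)); last first.
    by apply/funext => x /=; rewrite opprB opprK addrC.
  rewrite freB//; [|exact: integrableNR|exact: integrableNR].
  set A := fre _ _ xi; set B := fre _ _ xi; set C := fre _ _ xi; set D := fre _ _ xi.
  have := sqr_ge0 (2 * C - A); have := sqr_ge0 (2 * D - B); nra.
have mlw := measurable_log_weight.
rewrite star_normsqE.
apply: (@le_lt_trans _ _ (\int[leb]_xi (2%:E * (ln (expR 1 + enorm xi) * sd w xi)%:E +
   2%:E * (ln (expR 1 + enorm xi) * sd (u k) xi)%:E))%E).
  apply: ge0_le_integral => //.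
  - by move=> xi _; rewrite lee_fin mulr_ge0 ?sd_ge0 ?log_weight_ge0.
  - by apply/measurable_EFinP; exact: measurable_funM.
  - by apply: emeasurable_funD; apply: emeasurable_funM => //;
      apply/measurable_EFinP; exact: measurable_funM.
  - move=> xi _; rewrite -!EFinM -EFinD lee_fin.
    have -> : 2 * (ln (expR 1 + enorm xi) * sd w xi) +
      2 * (ln (expR 1 + enorm xi) * sd (u k) xi) =
      ln (expR 1 + enorm xi) * (2 * sd w xi + 2 * sd (u k) xi) by ring.
    by rewrite ler_wpM2l ?log_weight_ge0.
rewrite ge0_integralD//; first last.
- by apply: emeasurable_funM => //; apply/measurable_EFinP; exact: measurable_funM.
- by move=> xi _; rewrite -EFinM lee_fin !mulr_ge0 ?sd_ge0 ?log_weight_ge0.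
- by apply: emeasurable_funM => //; apply/measurable_EFinP; exact: measurable_funM.
- by move=> xi _; rewrite -EFinM lee_fin !mulr_ge0 ?sd_ge0 ?log_weight_ge0.
rewrite !ge0_integralZl//; try by [apply/measurable_EFinP; exact: measurable_funM|
  move=> xi _; rewrite lee_fin mulr_ge0 ?sd_ge0 ?log_weight_ge0].
have finE psi : (star_normsq psi < +oo)%E ->
    (2%:E * \int[leb]_xi (ln (expR 1 + enorm xi) * sd psi xi)%:E < +oo)%E.
  by move=> fin; rewrite -star_normsqE; exact: lte_mul_pinfty fin.
by apply: lte_add_pinfty; [exact: finE wk|exact: finE uoo].
Qed.

End finite_measure.
End complex_bridge.

(** * Summation over the eigenfunctions *)

Section berezin_li_yau.
Context {R : realType} (n : nat).
Local Notation leb := (@lebesgue_rV R n).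
Local Notation Rn := 'rV[R]_n.
Variable Omega : set Rn.
Hypotheses (n_gt0 : (0 < n)%N) (mOmega : measurable Omega).
Hypothesis Omega_fin : (leb Omega < +oo)%E.

Let twopi_gt0 : 0 < (2 * pi : R) ^+ n.
Proof. by rewrite exprn_gt0// mulr_gt0// pi_gt0. Qed.

Lemma integrable_riesz_weight m : leb.-integrable setT (EFin \o riesz_weight m).
Proof.
apply: integrable_ge0.
- exact: measurable_riesz_weight.
- exact: riesz_weight_ge0.
- apply: le_lt_trans (integral_riesz_weight_le m n_gt0) _.
  by rewrite lte_mul_pinfty ?lee_fin ?divr_ge0 ?expR_ge0// lebesgue_rV_unit_ball_lty.
Qed.

(** The transform of an integrable function is bounded by [L^1] norms. Boundedness is needed near
    the origin, where [ln |xi|] is not. *)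
Lemma sd_bounded phi : L2 Omega phi -> exists2 M : R, 0 <= M & forall xi, sd phi xi <= M.
Proof.
move=> L2phi; have [ir ii] := L2_integrable mOmega Omega_fin L2phi.
have bnd a b xi : leb.-integrable setT (EFin \o a) -> leb.-integrable setT (EFin \o b) ->
    `|fre a b xi| <= \int[leb]_x `|a x| + \int[leb]_x `|b x|.
  move=> ia ib; have ik := integrable_fre_kernel xi ia ib.
  have [ina inb] := (integrable_norm ia, integrable_norm ib).
  apply: le_trans (le_normr_Rintegral measurableT ik) _.
  rewrite -RintegralD//; apply: le_Rintegral => //; first exact: integrable_norm ik.
    exact: integrableDR.
  move=> x _; rewrite (le_trans (ler_normD _ _))// lerD// normrM ler_piMr//.
    exact: cos_max.
  exact: sin_max.
set A := \int[leb]_x `|re phi x|; set B := \int[leb]_x `|im phi x|.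
exists (2 * (A + B) ^+ 2); first by rewrite mulr_ge0 ?sqr_ge0.
move=> xi; rewrite /sd /specdensc mulr_natl mulr2n lerD//.
  by apply: sqr_le_norm; exact: bnd.
apply: sqr_le_norm; rewrite (le_trans (bnd _ _ _ ii (integrableNR ir)))// addrC.
rewrite lerD//; apply: le_Rintegral => //.
- exact: (integrable_norm (integrableNR ir)).
- exact: integrable_norm.
- by move=> x _; rewrite /= normrN.
Qed.

(** Where [ln |xi|] is negative, its absolute value is [riesz_weight 0], integrable against the
    bounded [sd phi]. Elsewhere it is at most [ln (e + |xi|)], controlled by the finite star
    norm. *)
Lemma integrable_log_sd phi : form_domain Omega phi ->
  leb.-integrable setT (EFin \o (fun xi => ln (enorm xi) * sd phi xi)).
Proof.
move=> fphi; have L2phi := fphi.1.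
have [M M0 sdM] := sd_bounded L2phi.
have msd := L2_measurable_sd L2phi.
have mlw := @measurable_log_weight R n.
have int1 : leb.-integrable setT (EFin \o (fun xi => ln (expR 1 + enorm xi) * sd phi xi)).
  apply: integrable_ge0.
  - exact: measurable_funM.
  - by move=> xi; rewrite mulr_ge0 ?sd_ge0 ?log_weight_ge0.
  - by rewrite -star_normsqE; exact: form_domain_star fphi.
have int2 := integrableZlR M (integrable_riesz_weight 0).
apply: le_integrableR (integrableDR int1 int2).
  apply: measurable_funM => //; apply: measurableT_comp => //; exact: measurable_enorm.
move=> xi; rewrite normrM (ger0_norm (sd_ge0 _ _)).
have lw0 := log_weight_ge0 xi; have rw0 := riesz_weight_ge0 0 xi.
have s0 := sd_ge0 phi xi; have sM := sdM xi.
have [l0|l0] := ltP (ln (enorm xi)) 0.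
  rewrite ltr0_norm// /riesz_weight sub0r (max_idPl _); last by rewrite oppr_ge0 ltW.
  have : 0 <= ln (expR 1 + enorm xi) * sd phi xi by rewrite mulr_ge0.
  have : 0 <= - ln (enorm xi) * (M - sd phi xi) by rewrite mulr_ge0 ?subr_ge0// oppr_ge0 ltW.
  by nra.
rewrite ger0_norm//.
have : 0 <= M * riesz_weight 0 xi by rewrite mulr_ge0.
have : ln (enorm xi) <= ln (expR 1 + enorm xi).
  (* The origin falls in this case, because [ln 0 = 0] by convention. *)
  have [e0|e0] := ltP 0 (enorm xi); last by rewrite (ln0 e0).
  by rewrite ler_ln ?posrE// ?addr_gt0 ?expR_gt0// lerDr expR_ge0.
by move=> h1 h2; have := ler_wpM2r s0 h1; lra.
Qed.

Lemma Re_realM (c : R) (z : R[i]) : complex.Re (c%:C%C * z) = c * complex.Re z.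
Proof. by case: z => a b /=; rewrite mul0r subr0. Qed.

Lemma Re_realM_normc (c : R) (z : R[i]) :
  complex.Re (c%:C%C * z * (z^*)%C) = c * Normc.normc z ^+ 2.
Proof. by rewrite normc_sqr; case: z => a b /=; ring. Qed.

Lemma Re_log_form phi : complex.Re (log_form phi phi) =
  ((2 * pi) ^+ n)^-1 * \int[leb]_xi (ln (enorm xi) * sd phi xi).
Proof.
rewrite /log_form Re_realM; congr (_ * _).
by apply: eq_Rintegral => xi _; rewrite Re_realM_normc normc_fourier_sqr.
Qed.

Lemma Re_L2_inner phi psi : L2 Omega phi -> L2 Omega psi ->
  complex.Re (L2_inner Omega phi psi) =
  \int[leb]_x (re phi x * re psi x + im phi x * im psi x).
Proof.
move=> L1 L2; have [mr mi] := L2_measurable L1; have [mr' mi'] := L2_measurable L2.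
rewrite -(Rintegral_ae_support mOmega).
- rewrite /L2_inner /cintegral/=; apply: eq_Rintegral => x _; rewrite /re /im.
  by case: (phi x) => a b; case: (psi x) => c e /=; ring.
- by apply: measurable_funD; exact: measurable_funM.
- apply: filterS (L2_ae_support L1) => x H xO; have [-> ->] := H xO.
  by rewrite !mul0r addr0.
Qed.

Lemma Im_L2_inner phi psi : L2 Omega phi -> L2 Omega psi ->
  complex.Im (L2_inner Omega phi psi) =
  \int[leb]_x (im phi x * re psi x - re phi x * im psi x).
Proof.
move=> L1 L2; have [mr mi] := L2_measurable L1; have [mr' mi'] := L2_measurable L2.
rewrite -(Rintegral_ae_support mOmega).
- rewrite /L2_inner /cintegral/=; apply: eq_Rintegral => x _; rewrite /re /im.
  by case: (phi x) => a b; case: (psi x) => c e /=; ring.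
- by apply: measurable_funB; exact: measurable_funM.
- apply: filterS (L2_ae_support L1) => x H xO; have [-> ->] := H xO.
  by rewrite !mul0r subr0.
Qed.

Lemma Rintegral_sd phi : L2 Omega phi -> L2_inner Omega phi phi = 1 ->
  leb.-integrable setT (EFin \o sd phi) /\ \int[leb]_xi sd phi xi = (2 * pi) ^+ n.
Proof.
move=> L2phi norm1.
have [ir ii] := L2_integrable mOmega Omega_fin L2phi.
have [[mr ir2] [mi ii2]] := L2_square_integrable L2phi.
have := Re_L2_inner L2phi L2phi; rewrite norm1 /= => E.
have P := plancherel_rV ir ii ir2 ii2.
have E1 : \int[leb]_x (re phi x ^+ 2 + im phi x ^+ 2) = 1.
  by rewrite [RHS]E; apply: eq_Rintegral => x _; rewrite !expr2.
rewrite -(integrable_EFinE (integrableDR ir2 ii2)) E1 mule1 in P.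
split; last by rewrite /Rintegral P.
apply: integrable_ge0; first exact: L2_measurable_sd L2phi.
  exact: sd_ge0.
by rewrite P ltry.
Qed.

Lemma eigenvalue_riesz_le phi (l m : R) : eigenfunction Omega l phi ->
  L2_inner Omega phi phi = 1 ->
  (((2 * pi) ^+ n * (m - l))%:E <= \int[leb]_xi (riesz_weight m xi * sd phi xi)%:E)%E.
Proof.
move=> [fphi _ eig] norm1; have L2phi := fphi.1.
have [M M0 sdM] := sd_bounded L2phi.
have msd := L2_measurable_sd L2phi.
have [isd Esd] := Rintegral_sd L2phi norm1.
have ilog := integrable_log_sd fphi.
have El : \int[leb]_xi (ln (enorm xi) * sd phi xi) = (2 * pi) ^+ n * l.
  (* The weak equation tested with the eigenfunction itself; its real part determines [l]. *)
  have := congr1 (@complex.Re R) (eig phi fphi).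
  rewrite Re_log_form norm1 mulr1/= => <-.
  by rewrite mulrA divff ?mul1r// lt0r_neq0.
have iw : leb.-integrable setT (EFin \o (fun xi => riesz_weight m xi * sd phi xi)).
  apply: (integrable_mul_bounded (M := M) (integrable_riesz_weight m) msd) => xi.
  by rewrite ger0_norm ?sd_ge0.
rewrite -integrable_EFinE// lee_fin mulrBr -El -Esd mulrC -RintegralZl//.
rewrite -RintegralB//; last exact: integrableZlR.
apply: le_Rintegral => //; first by apply: integrableBR => //; exact: integrableZlR.
move=> xi _; rewrite -mulrBl ler_wpM2r ?sd_ge0//.
by rewrite /riesz_weight le_max lexx.
Qed.

Lemma bessel_fourier (phi : nat -> Rn -> R[i]) (N : nat) xi :
  (forall k, L2 Omega (phi k)) ->
  (forall j k, L2_inner Omega (phi j) (phi k) = (j == k)%:R) ->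
  \sum_(k < N) sd (phi k) xi <= fine (leb Omega).
Proof.
move=> L2phi ortho.
pose c (x : Rn) : R := \1_Omega x * cos (dotp x xi).
pose s (x : Rn) : R := \1_Omega x * sin (dotp x xi).
have mI : measurable_fun setT (\1_Omega : Rn -> R) by exact: measurable_indic.
have iI : leb.-integrable setT (EFin \o (\1_Omega : Rn -> R)).
  by apply: integrable_ge0 => //; rewrite integral_indic// setIT.
have mcos := measurableT_comp (@measurable_cos R) (@measurable_dotpl R n xi).
have msin := measurableT_comp (@measurable_sin R) (@measurable_dotpl R n xi).
have mc : measurable_fun setT c by exact: measurable_funM.
have ms : measurable_fun setT s by exact: measurable_funM.
have I01 (x : Rn) : \1_Omega x = 0 :> R \/ \1_Omega x = 1 :> R.
  by rewrite indicE; case: (_ \in _); [right|left].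
have sc : square_integrable leb c.
  split => //; apply: le_integrableR iI; first exact: measurable_funX.
  move=> x; rewrite /c ger0_norm ?sqr_ge0//; have := sqr_le_norm (cos_max (dotp x xi)).
  by case: (I01 x) => ->; rewrite ?mul0r ?mul1r ?expr0n ?expr1n.
have ss : square_integrable leb s.
  split => //; apply: le_integrableR iI; first exact: measurable_funX.
  move=> x; rewrite /s ger0_norm ?sqr_ge0//; have := sqr_le_norm (sin_max (dotp x xi)).
  by case: (I01 x) => ->; rewrite ?mul0r ?mul1r ?expr0n ?expr1n.
have cs : \int[leb]_x (c x ^+ 2 + s x ^+ 2) = fine (leb Omega).
  transitivity (\int[leb]_x (\1_Omega x : R)).
    apply: eq_Rintegral => x _; rewrite /c /s.
    by case: (I01 x) => ->; rewrite ?mul0r ?mul1r ?cos2Dsin2 ?expr0n ?addr0.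
  by rewrite /Rintegral integral_indic// setIT.
(* Cutting the exponential off outside Omega puts it in [L^2] with squared norm [|Omega|], and
   leaves its pairings with functions vanishing there unchanged. *)
have cut (a b : Rn -> R) : measurable_fun setT a -> measurable_fun setT b ->
    {ae leb, forall x, ~ Omega x -> a x = 0 /\ b x = 0} ->
    \int[leb]_x (a x * c x + b x * s x) = fre a b xi.
  move=> ma mb ab0.
  transitivity (\int[leb]_(x in Omega) (a x * cos (dotp x xi) + b x * sin (dotp x xi))).
    rewrite [RHS]Rintegral_mkcond; apply: eq_Rintegral => x _; rewrite patchE /c /s indicE.
    by case: ifPn => _; rewrite ?mul1r// !mul0r !mulr0 addr0.
  apply: Rintegral_ae_support => //.
    by apply: measurable_funD; exact: measurable_funM.
  by apply: filterS ab0 => x H xO; have [-> ->] := H xO; rewrite !mul0r addr0.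
rewrite -cs.
apply: le_trans (bessel_complex (a := fun k : 'I_N => re (phi k)) (b := fun k : 'I_N => im (phi k))
  _ _ sc ss _ _).
- rewrite le_eqVlt; apply/orP; left; apply/eqP; apply: eq_bigr => k _.
  have [mr mi] := L2_measurable (L2phi k).
  have mNr : measurable_fun setT (\- re (phi k)) by exact: measurableT_comp.
  have s0 := L2_ae_support (L2phi k).
  rewrite /sd /specdensc -!cut//.
    by congr (_ + _ ^+ 2); apply: eq_Rintegral => x _ /=; rewrite mulNr.
  by apply: filterS s0 => x H xO; have [/= -> ->] := H xO; rewrite oppr0.
- by move=> k; have [] := L2_square_integrable (L2phi k).
- by move=> k; have [] := L2_square_integrable (L2phi k).
- move=> j k; rewrite -Re_L2_inner// ortho -val_eqE/=.
  by case: (_ == _).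
- move=> j k; rewrite -Im_L2_inner// ortho.
  by case: (_ == _).
Qed.

Lemma eigenvalue_count_le (lam : nat -> R) (lambda : R) (N : nat) :
  dirichlet_eigenvalues Omega lam -> (forall k, (k < N)%N -> lam k < lambda) ->
  N%:R <= expR (lambda * n%:R + 1) * ((2 * pi) ^+ n)^-1 *
    fine (leb Omega) * fine (leb (unit_ball n)).
Proof.
move=> [_ _ _ [phi [[L2phi ortho _] eig]]] lamN.
have n0 : 0 < n%:R :> R by rewrite ltr0n.
(* Any [m > lambda] bounds [N] by a constant times [e^(m n) / (n (m - lambda))], which is smallest
   when [m - lambda = 1 / n]; the exponent [m n] then becomes [lambda n + 1]. *)
pose m := lambda + n%:R^-1.
have norm1 k : L2_inner Omega (phi k) (phi k) = 1 by rewrite ortho eqxx.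
have msd k := L2_measurable_sd (L2phi k).
have mw := @measurable_riesz_weight R n m.
have b_fin : leb (unit_ball n) \is a fin_num.
  by rewrite ge0_fin_numE// lebesgue_rV_unit_ball_lty.
have H : (((2 * pi) ^+ n * (N%:R / n%:R))%:E <=
    (fine (leb Omega) * (expR (m * n%:R) / n%:R * fine (leb (unit_ball n))))%:E)%E.
  apply: (@le_trans _ _ (\sum_(k < N) ((2 * pi) ^+ n * (m - lam k))%:E)%E).
    rewrite sumEFin lee_fin -mulr_sumr ler_wpM2l ?(ltW twopi_gt0)//.
    rewrite mulr_natl -[N in leLHS](card_ord N) -sumr_const; apply: ler_sum => k _.
    by have := lamN k (ltn_ord k); rewrite /m; lra.
  apply: (@le_trans _ _ (\sum_(k < N) \int[leb]_xi (riesz_weight m xi * sd (phi k) xi)%:E)%E).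
    by apply: lee_sum => k _; apply: eigenvalue_riesz_le => //; exact: eig.
  rewrite -ge0_integral_sum//; last 2 first.
  - by move=> k; apply/measurable_EFinP; exact: measurable_funM.
  - by move=> k xi _; rewrite lee_fin mulr_ge0 ?riesz_weight_ge0 ?sd_ge0.
  apply: (@le_trans _ _ (\int[leb]_xi ((fine (leb Omega))%:E * (riesz_weight m xi)%:E))%E).
    apply: ge0_le_integral => //.
    - by move=> xi _; apply: sume_ge0 => k _; rewrite lee_fin mulr_ge0 ?riesz_weight_ge0 ?sd_ge0.
    - by apply: emeasurable_sum => k; apply/measurable_EFinP; exact: measurable_funM.
    - by apply: emeasurable_funM => //; exact/measurable_EFinP.
    - move=> xi _; rewrite sumEFin -EFinM lee_fin -mulr_sumr mulrC.
      by rewrite ler_wpM2r ?riesz_weight_ge0//; exact: bessel_fourier.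
  rewrite ge0_integralZl//; last 3 first.
  - exact/measurable_EFinP.
  - by move=> xi _; rewrite lee_fin riesz_weight_ge0.
  - by rewrite lee_fin fine_ge0.
  rewrite EFinM; apply: lee_wpmul2l; first by rewrite lee_fin fine_ge0.
  by rewrite EFinM fineK//; exact: integral_riesz_weight_le.
move: H; rewrite lee_fin.
have -> : m * n%:R = lambda * n%:R + 1 by rewrite /m; field; rewrite lt0r_neq0.
set E := expR _; set O := fine _; set B := fine _; set P := _ ^+ n => H.
have P0 : 0 < P by exact: twopi_gt0.
have -> : E * P^-1 * O * B = P^-1 * n%:R * (O * (E / n%:R * B)).
  by field; rewrite !lt0r_neq0.
have -> : N%:R = P^-1 * n%:R * (P * (N%:R / n%:R)) :> R.
  by field; rewrite !lt0r_neq0.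
by rewrite ler_wpM2l// mulr_ge0 ?invr_ge0 ?(ltW P0)// ltW.
Qed.

End berezin_li_yau.

Lemma counting_II {R : realType} (N : nat) : counting `I_N = (N%:R)%:E :> \bar R.
Proof.
rewrite /counting asboolT; last exact: finite_II.
rewrite fset_set_II finmap.card_imfset/=; last exact: val_inj.
by rewrite size_enum_ord.
Qed.

Theorem corollary3p2 (R : realType) (d : nat) (d_ge1 : (1 <= d)%N)
    (Omega : set 'rV[R]_d) (Omega_open : open Omega) (Omega_neq0 : Omega !=set0)
    (Omega_fin : (lebesgue_rV d Omega < +oo)%E)
    (lam : nat -> R) (lam_eig : dirichlet_eigenvalues Omega lam) (lambda : R) :
  (eigenvalue_count lam lambda <=
   (expR (lambda * d%:R + 1) * ((2 * pi) ^+ d)^-1)%:E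
     * lebesgue_rV d Omega * lebesgue_rV d (unit_ball d))%E.
Proof.
have mO := open_measurable_rV Omega_open.
have [_ nd cvglam _] := lam_eig.
have exP : exists N, lambda <= lam N.
  have /cvgryPge/(_ lambda)[N _ HN] := cvglam.
  by exists N; exact: HN (leqnn N).
(* The first index with [lambda <= lam N]. By monotonicity the counted indices are exactly those
   below [N], and as they start at [0] their number is [N]. *)
pose N := ex_minn exP.
have [NP Nmin] : lambda <= lam N /\ forall k, lambda <= lam k -> (N <= k)%N.
  by rewrite /N; case: ex_minnP.
have -> : eigenvalue_count lam lambda = (N%:R)%:E.
  rewrite -counting_II /eigenvalue_count; congr counting.
  apply/seteqP; split => k /=.
    by move=> lk; rewrite ltnNge; apply/negP => /nd Nk; have := lt_le_trans lk (le_trans NP Nk);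
      rewrite ltxx.
  by rewrite ltNge => kN; apply/negP => /Nmin; rewrite leqNgt kN.
have O_fin : lebesgue_rV d Omega \is a fin_num by rewrite ge0_fin_numE.
have := @lebesgue_rV_unit_ball_lty R d; rewrite -ge0_fin_numE// => b_fin.
rewrite -(fineK O_fin) -(fineK b_fin) -!EFinM lee_fin.
apply: (eigenvalue_count_le d_ge1 mO Omega_fin lam_eig) => k kN.
by rewrite ltNge; apply/negP => /Nmin; rewrite leqNgt kN.
Qed.
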